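(* Let $(\Omega,\mu)$ be a measure space with $\mu(\Omega)=1$. Let $E$ be an r.i. space, $b\in SV(0,1)$, $1<p_0<p_1<\infty$ and $\alpha,\beta>0$. Put $\rho(u)=u^{\frac1{p_0}-\frac1{p_1}}\ell^{\frac{\alpha}{p_0'}-\frac{\beta}{p_1'}}(u)$, $u\in(0,1)$. (a) If $0<\theta<1$, then $\big(L^{(p_0,\alpha},L^{(p_1,\beta}\big)_{\theta,b,E}=L_{p,B_\theta,E}$, where $\frac1p=\frac{1-\theta}{p_0}+\frac{\theta}{p_1}$ and $B_\theta(u)=\ell^{\frac{\alpha(1-\theta)}{p_0'}+\frac{\beta\theta}{p_1'}}(u)\,b(\rho(u))$, $u\in(0,1)$. (b) If $\theta=0$, then $$\big(L^{(p_0,\alpha},L^{(p_1,\beta}\big)_{0,b,E}=L^{\mathcal L}_{p_0,B_0,E,1,L_{p_0}}\cap L^{\mathcal L,\mathcal L}_{p_0,\,b\circ\rho,\,E,\,\ell^{\alpha/p_0'-1}(u),\,L_1,\,1,\,L_{p_0}},$$ where $B_0(u)=\ell^{\alpha/p_0'}(u)\,b(\rho(u))$, $u\in(0,1)$. (c) If $\theta=1$ and $\|b\|_{\widetilde E(0,1)}<\infty$, then $\big(L^{(p_0,\alpha},L^{(p_1,\beta}\big)_{1,b,E}=L^{\mathcal L,\mathcal R}_{p_1,\,b\circ\rho,\,E,\,\ell^{\beta/p_1'-1}(u),\,L_1,\,1,\,L_{p_1}}$.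
   Context: Notation. $\ell(t)=1+|\log t|$, $\ell^\sigma(t)=(\ell(t))^\sigma$; $\frac1p+\frac1{p'}=1$. An r.i. space $E$ is a rearrangement invariant Banach function space on $(0,\infty)$ with the Fatou property; $\widetilde E$ is the corresponding space for the measure $dt/t$, with $\|g\|_{\widetilde E}=\|g^\star\|_E$ ($g^\star$ the non-increasing rearrangement with respect to $dt/t$); for an interval $I$, $\|g\|_{\widetilde E(I)}=\|g\chi_I\|_{\widetilde E}$. So $\|g\|_{\widetilde L_q(I)}=(\int_I|g(s)|^q\,ds/s)^{1/q}$ and $\widetilde L_\infty=L_\infty$. A positive finite measurable $b$ on $(0,1)$ is in $SV(0,1)$ if for all $\varepsilon>0$, $t^\varepsilon b(t)$ is equivalent to a non-decreasing function and $t^{-\varepsilon}b(t)$ to a non-increasing one on $(0,1)$. In $b(\rho(u))$, $b$ is understood as extended to $[1,\infty)$ by $b(s)=1$ for $s\ge1$ (the choice of slowly varying extension is immaterial up to equivalence of norms). Interpolation spaces: for (quasi-)Banach spaces with $Y_1\hookrightarrow Y_0$, $(Y_0,Y_1)_{\theta,b,E}$ is the set of $f\in Y_0$ with $\|t^{-\theta}b(t)K(t,f;Y_0,Y_1)\|_{\widetilde E(0,1)}<\infty$, $0\le\theta\le1$, where $K$ is Peetre's $K$-functional. Function spaces: $f^*$ is the non-increasing rearrangement of a $\mu$-measurable function $f$ on $\Omega$. Each space is the set of measurable $f$ with finite indicated norm (innermost norm in $s$, next in $t$, outermost in $u$), $1<p<\infty$: - $L_{p,b,E}$: $\|t^{1/p}b(t)f^*(t)\|_{\widetilde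 E(0,1)}$; - $L^{\mathcal L}_{p,b,E,a,F}$: $\big\|b(t)\|s^{1/p}a(s)f^*(s)\|_{\widetilde F(0,t)}\big\|_{\widetilde E(0,1)}$; - $L^{\mathcal L,\mathcal L}_{p,c,E,b,F,a,G}$: $\Big\|c(u)\big\|b(t)\|s^{1/p}a(s)f^*(s)\|_{\widetilde G(0,t)}\big\|_{\widetilde F(0,u)}\Big\|_{\widetilde E(0,1)}$; - $L^{\mathcal L,\mathcal R}_{p,c,E,b,F,a,G}$: $\Big\|c(u)\big\|b(t)\|s^{1/p}a(s)f^*(s)\|_{\widetilde G(u,t)}\big\|_{\widetilde F(u,1)}\Big\|_{\widetilde E(0,1)}$; - small Lebesgue space $L^{(p,\alpha}$ ($\alpha>0$): $\Big\|\ell^{\alpha/p'-1}(t)\|s^{1/p}f^*(s)\|_{\widetilde L_p(0,t)}\Big\|_{\widetilde L_1(0,1)}$. Equality of spaces means equality as sets with equivalent norms. *)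

(* Defs.v *)
From HB Require Import structures.
From mathcomp Require Import all_boot all_order all_algebra.
From mathcomp Require Import all_classical all_reals all_analysis.
From mathcomp Require Import measurable_realfun.

Set Implicit Arguments.
Unset Strict Implicit.
Unset Printing Implicit Defensive.

Import Order.TTheory GRing.Theory Num.Theory.
Import numFieldNormedType.Exports.

Local Open Scope classical_set_scope.
Local Open Scope ring_scope.
Local Open Scope ereal_scope.

Section Scalars.
Context {R : realType}.
Implicit Types (p sigma s t theta : R) (b : R -> R).

Definition conjexp p : R := ((1 - p^-1)^-1)%R.

Definition ell sigma t : R := ((1 + `|ln t|) `^ sigma)%R.

Definition equiv01 (f phi : R -> R) : Prop :=
  exists c C : R, [/\ (0 < c)%R, (0 < C)%R &
    forall t, (0 < t < 1)%R -> (c * phi t <= f t <= C * phi t)%R].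

Definition equiv_nondecreasing (f : R -> R) : Prop :=
  exists phi, equiv01 f phi /\
    forall s t, (0 < s)%R -> (s <= t)%R -> (t < 1)%R -> (phi s <= phi t)%R.

Definition equiv_nonincreasing (f : R -> R) : Prop :=
  exists phi, equiv01 f phi /\
    forall s t, (0 < s)%R -> (s <= t)%R -> (t < 1)%R -> (phi t <= phi s)%R.

(* The class SV(0,1); the values of [b] outside (0,1) are irrelevant. *)
Definition slowly_varying b : Prop :=
  [/\ measurable_fun (`]0%R, 1%R[ : set R) b,
      forall t, (0 < t < 1)%R -> (0 < b t)%R &
      forall eps : R, (0 < eps)%R ->
        equiv_nondecreasing (fun t => t `^ eps * b t)%R /\
        equiv_nonincreasing (fun t => t `^ (- eps) * b t)%R].

Definition sv_ext b s : R := if (s < 1)%R then b s else 1%R.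

End Scalars.

(* The measure dt/t on (0,oo), seen as a measure on R carried by (0,oo). *)
Section LogMeasure.
Context (R : realType).

Definition log_measure (A : set R) : \bar R :=
  \int[lebesgue_measure]_(t in A `&` `]0%R, +oo[) (t^-1)%:E.

Let posR : set R := `]0%R, +oo[.

Let measurable_posR : measurable posR.
Proof. exact: measurable_itv. Qed.

Let log_measure0 : log_measure set0 = 0.
Proof. by rewrite /log_measure set0I integral_set0. Qed.

Let inv_ge0 (A : set R) t : (A `&` posR) t -> 0 <= (t^-1)%:E.
Proof.
by move=> [_]; rewrite /posR/= in_itv/= andbT lee_fin invr_ge0 => /ltW.
Qed.

Let log_measure_ge0 A : 0 <= log_measure A.
Proof. by apply: integral_ge0 => t /inv_ge0. Qed.

Let measurable_inv : measurable_fun posR (@GRing.inv R : R -> R).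
Proof.
apply: open_continuous_measurable_fun; first exact: interval_open.
move=> t; rewrite inE /posR/= in_itv/= andbT => t0.
by apply: inv_continuous; rewrite gt_eqF.
Qed.

Let log_measure_sigma_additive : semi_sigma_additive log_measure.
Proof.
move=> /= F mF tF mUF; rewrite /log_measure; apply: cvg_toP.
  apply: ereal_nondecreasing_is_cvgn => m n mn.
  apply: lee_sum_nneg_natr => // k _ _.
  by apply: integral_ge0 => t /inv_ge0.
rewrite setI_bigcupl ge0_integral_bigcup//=.
- by move=> k; exact: measurableI (mF k) measurable_posR.
- apply/measurable_EFinP; apply: measurable_funS measurable_inv => //.
  by move=> t [? _ []].
- by move=> t [? _ /inv_ge0].
- exact: trivIset_setIr.
Qed.

HB.instance Definition _ := isMeasure.Build _ _ _ log_measure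
  log_measure0 log_measure_ge0 log_measure_sigma_additive.

End LogMeasure.

(* Non-increasing rearrangement with respect to [mu]; it takes the value +oo
   where no level works (infimum of the empty set). *)
Definition rearrangement {d} {T : measurableType d} {R : realType}
    (mu : {measure set T -> \bar R}) (g : T -> \bar R) (t : R) : \bar R :=
  ereal_inf [set y%:E | y in
    [set y : R | (0 <= y)%R /\ mu [set x | y%:E < `|g x|] <= t%:E]].

Section RearrangementInvariant.
Context {R : realType}.
Implicit Types (N : (R -> \bar R) -> \bar R) (f g : R -> \bar R) (q : R).

Let lambda := @lebesgue_measure R.

Definition nneg_mfun f : Prop :=
  measurable_fun (`]0%R, +oo[ : set R) f /\
  forall t : R, (0 < t)%R -> 0 <= f t.

Definition ae_pos (P : R -> Prop) : Prop := {ae lambda, forall t, (0 < t)%R -> P t}.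

Definition equimeasurable f g : Prop := forall y : R, (0 <= y)%R ->
  lambda [set t | (0 < t)%R /\ y%:E < f t] =
  lambda [set t | (0 < t)%R /\ y%:E < g t].

(* [N] is a rearrangement invariant Banach function norm on (0,oo) with the
   Fatou property, in the sense of Bennett and Sharpley; the associated r.i.
   space consists of the measurable f with N |f| < oo. Functions on (0,oo) are
   represented by functions on R: only their values on (0,oo) matter. *)
Record is_ri_norm N : Prop := IsRiNorm {
  ri_ge0 : forall f, nneg_mfun f -> 0 <= N f ;
  ri_eq0 : forall f, nneg_mfun f -> N f = 0 <-> ae_pos (fun t => f t = 0) ;
  ri_scale : forall (a : R) f, (0 <= a)%R -> nneg_mfun f ->
    N (fun t => a%:E * f t) = a%:E * N f ;
  ri_triangle : forall f g, nneg_mfun f -> nneg_mfun g ->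
    N (fun t => f t + g t) <= N f + N g ;
  ri_monotone : forall f g, nneg_mfun f -> nneg_mfun g ->
    ae_pos (fun t => f t <= g t) -> N f <= N g ;
  ri_fatou : forall (h : nat -> R -> \bar R) f,
    (forall n, nneg_mfun (h n)) -> nneg_mfun f ->
    (forall n, ae_pos (fun t => h n t <= h n.+1 t)) ->
    ae_pos (fun t => h n t @[n --> \oo] --> f t) ->
    N (h n) @[n --> \oo] --> N f ;
  ri_indic : forall A : set R, measurable A ->
    A `<=` `]0%R, +oo[ -> lambda A < +oo -> N (EFin \o \1_A) < +oo ;
  ri_integral : forall A : set R, measurable A ->
    A `<=` `]0%R, +oo[ -> lambda A < +oo ->
    exists C : R, forall f, nneg_mfun f ->
      \int[lambda]_(t in A) f t <= C%:E * N f ;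
  ri_rearr : forall f g, nneg_mfun f -> nneg_mfun g ->
    equimeasurable f g -> N f = N g }.

Definition Lq q f : \bar R := Lnorm lambda q%:E (f \_ `]0%R, +oo[).

(* The norm of E~(I), for the space E with norm [N]. *)
Definition tnorm N (I : interval R) g : \bar R :=
  N (rearrangement (@log_measure R) (g \_ [set` I])).

End RearrangementInvariant.

(* A function space over T: the set of its elements and its (quasi-)norm, the
   latter being meaningful on the carrier only. Functions equal almost
   everywhere are not identified; the spaces below are invariant under
   almost everywhere equality. *)
Record funspace {R : realType} (T : Type) := FunSpace {
  carrier : set (T -> R) ;
  fnorm : (T -> R) -> \bar R }.

Definition space_eq {R : realType} {T : Type} (X Y : @funspace R T) : Prop :=
  carrier X = carrier Y /\
  exists c C : R, [/\ (0 < c)%R, (0 < C)%R &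
    forall f, carrier X f ->
      c%:E * fnorm Y f <= fnorm X f /\ fnorm X f <= C%:E * fnorm Y f].

Definition space_cap {R : realType} {T : Type} (X Y : @funspace R T) :=
  FunSpace (carrier X `&` carrier Y) (fun f => maxe (fnorm X f) (fnorm Y f)).

Section Interpolation.
Context {R : realType} {T : Type}.
Implicit Types (E : (R -> \bar R) -> \bar R).

Definition Kfun (Y0 Y1 : @funspace R T) (t : R) (f : T -> R) : \bar R :=
  ereal_inf [set x | exists f0 f1 : T -> R,
    [/\ carrier Y0 f0, carrier Y1 f1, f = (f0 \+ f1)%R &
        x = fnorm Y0 f0 + t%:E * fnorm Y1 f1]].

Definition interp_norm (Y0 Y1 : @funspace R T) (theta : R) (b : R -> R) E (f : T -> R) : \bar R :=
  tnorm E `]0%R, 1%R[ (fun t => (t `^ (- theta) * b t)%:E * Kfun Y0 Y1 t f).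

(* (Y0, Y1)_{theta,b,E}, for an ordered couple: Y1 embedded in Y0. *)
Definition interp (Y0 Y1 : @funspace R T) (theta : R) (b : R -> R) E : @funspace R T :=
  FunSpace [set f | carrier Y0 f /\ interp_norm Y0 Y1 theta b E f < +oo]
           (interp_norm Y0 Y1 theta b E).

End Interpolation.

Section FunctionSpaces.
Context {R : realType} {d} {T : measurableType d} (mu : {measure set T -> \bar R}).
Implicit Types (p alpha : R) (a b c : R -> R) (E F G : (R -> \bar R) -> \bar R).

(* Lpb, LL, LLL, LLR and smallL are the spaces L_{p,b,E}, L^L_{p,b,E,a,F},
   L^{L,L}_{p,c,E,b,F,a,G}, L^{L,R}_{p,c,E,b,F,a,G} and L^{(p,alpha}; the
   letters E, F, G stand for norms on functions over (0,oo). *)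
Definition of_norm (N : (T -> R) -> \bar R) : @funspace R T :=
  FunSpace [set f | measurable_fun setT f /\ N f < +oo] N.

Local Notation "f ^*" := (rearrangement mu (EFin \o f)) : function_scope.

Definition Lpb p b E : @funspace R T := of_norm (fun f =>
  tnorm E `]0%R, 1%R[ (fun t => (t `^ p^-1 * b t)%:E * (f^*)%FUN t)).

Definition LL p b E a F : @funspace R T := of_norm (fun f =>
  tnorm E `]0%R, 1%R[ (fun t => (b t)%:E *
    tnorm F `]0%R, t[ (fun s => (s `^ p^-1 * a s)%:E * (f^*)%FUN s))).

Definition LLL p c E b F a G : @funspace R T := of_norm (fun f =>
  tnorm E `]0%R, 1%R[ (fun u => (c u)%:E *
    tnorm F `]0%R, u[ (fun t => (b t)%:E *
      tnorm G `]0%R, t[ (fun s => (s `^ p^-1 * a s)%:E * (f^*)%FUN s)))).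

Definition LLR p c E b F a G : @funspace R T := of_norm (fun f =>
  tnorm E `]0%R, 1%R[ (fun u => (c u)%:E *
    tnorm F `]u, 1%R[ (fun t => (b t)%:E *
      tnorm G `]u, t[ (fun s => (s `^ p^-1 * a s)%:E * (f^*)%FUN s)))).

Definition smallL p alpha : @funspace R T := of_norm (fun f =>
  tnorm (Lq 1) `]0%R, 1%R[ (fun t => (ell (alpha / conjexp p - 1) t)%:E *
    tnorm (Lq p) `]0%R, t[ (fun s => (s `^ p^-1)%:E * (f^*)%FUN s))).

End FunctionSpaces.

(* Main.v *)
(** Everything is discretised along the points [e^-k]. Put
    [h_k = f*(e^-(k+1))], [r_k = rho(e^-k)], [a0 = alpha/p0'] and
    [a1 = beta/p1']. Splitting [f] at the height [f*(e^-(k+1))] gives a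
    Holmstedt type formula [K(r_k, f) ~ P_k + Q_k + r_k R_k], where
    [P_k = sum_(n >= k) (1+n)^(a0-1) G_n], [Q_k = (1+k)^a0 G_k], [G_n] is the
    [l_p0] norm of [(e^(-j/p0) h_j)_(j >= n)], and
    [R_k = sum_(n <= k) (1+n)^(a1-1) G_(n,k)] with [G_(n,k)] the [l_p1] norm of
    [(e^(-j/p1) h_j)_(n <= j <= k)]. An r.i. norm of step functions is
    monotone under injections of the index set; this yields Hardy inequalities
    with geometric kernels, and, because [-ln r_k] has bounded steps and
    eventually grows linearly, it permits the change of variables [t = rho(u)]
    in the interpolation norm. With
    [W_k = r_k^(-theta) b(r_k) (1+k)^a0 e^(-k/p0)], the [Q] term is absorbed by
    [W_k h_k] and the [P] term by [Q] if [theta > 0], the [R] term is absorbed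
    by [W_k h_k] if [theta < 1], and both [Q] and [R] always dominate
    [W_k h_k]. *)

Require Import Defs.
From mathcomp Require Import all_boot all_order all_algebra.
From mathcomp Require Import all_classical all_reals all_analysis.
From mathcomp Require Import measurable_realfun.
From mathcomp Require Import ring lra zify.

Set Implicit Arguments.
Unset Strict Implicit.
Unset Printing Implicit Defensive.

Import Order.TTheory GRing.Theory Num.Theory.
Import numFieldNormedType.Exports.

Local Open Scope classical_set_scope.
Local Open Scope ring_scope.

(** * Rearrangements and distribution functions *)

Section Rearrangement.
Local Open Scope ereal_scope.
Context {d} {T : measurableType d} {R : realType}.
Variable mu : {measure set T -> \bar R}.
Implicit Types (g : T -> \bar R) (t : R).

(** Up to equivalence, [rho] is the quotient of the fundamental functions [u^(1/p_i) ell^(a_i)(u)]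
    of the two small Lebesgue spaces. Hence [r_k (1+k)^a1 e^(-k/p1) = (1+k)^a0 e^(-k/p0)]: the two
    pieces of a truncation balance at level [k], and this one identity links the [Q] and [R] terms
    through [W_k h_k]. Three obstacles shape the argument. The measurability of [t |-> K(t, f)] is
    never established, so norms are only compared with those of step functions, cell by cell; this
    costs a shift by one or two cells in lower bounds, which weights of regular variation absorb.
    Next, [rho] may fail to be monotone near 1, so its inverse is replaced by index maps whose
    fibres have bounded diameter. Finally, the infimum defining [K] ranges over pieces of finite
    norm, so [K <= C Phi] is proved for [f] in the larger space; each case therefore has to show
    that a finite target norm forces a finite small Lebesgue norm. *)

Lemma rearrangement_ge0 g t : 0 <= rearrangement mu g t.
Proof. by apply/ereal_infP => _ [y [y0 _] <-]; rewrite lee_fin. Qed.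

Lemma rearrangement_nincr g s t : (s <= t)%R ->
  rearrangement mu g t <= rearrangement mu g s.
Proof.
move=> st; apply: ereal_inf_le_tmp => _ [y [y0 my] <-]; exists y => //.
by split=> //; rewrite (le_trans my)// lee_fin.
Qed.

(** A monotone function pulls rays back to intervals. Here [g] is arbitrary, which covers functions
    built from the K-functional. *)
Lemma rearrangement_measurable g (D : set R) : measurable D ->
  measurable_fun D (rearrangement mu g).
Proof.
move=> mD; apply: (measurability _ (ErealGenOInfty.measurableE R)) => //.
move=> _ [_ [x ->] <-]; apply: measurableI => //.
apply: is_interval_measurable => s t /=; rewrite !in_itv/= !andbT => sx tx u.
move=> /andP[su ut]; rewrite in_itv/= andbT.
exact: lt_le_trans tx (rearrangement_nincr _ ut).
Qed.

Lemma rearrangement_nneg g : nneg_mfun (rearrangement mu g).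
Proof.
split; first exact: rearrangement_measurable (measurable_itv _).
by move=> t _; exact: rearrangement_ge0.
Qed.

(** The infimum is attained: the superlevel set at [y] is the increasing union of those at
    [y + 1/(n+1)], and a measure is continuous from below. *)
Lemma rearrangement_le g t (y : R) : measurable_fun setT g -> (0 <= y)%R ->
  (rearrangement mu g t <= y%:E) <-> (mu [set x | y%:E < `|g x|] <= t%:E).
Proof.
move=> mg y0; split; last by move=> h; apply: ereal_inf_lbound; exists y.
move=> ry.
pose F n := [set x | (y + n.+1%:R^-1)%:E < `|g x|].
have mF n : measurable (F n).
  rewrite -[F n]setTI; apply: emeasurable_fun_o_infty => //.
  exact: measurableT_comp.
have FE : [set x | y%:E < `|g x|] = \bigcup_n F n.
  apply/seteqP; split => x /=; last first.
    by move=> [n _]; apply: le_lt_trans; rewrite lee_fin lerDl.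
  have := abse_ge0 (g x); case E: (`|g x|) => [r|//|//] _; last first.
    by exists 0%N => //=; rewrite /F /= E ltry.
  rewrite lte_fin -subr_gt0 => yr.
  have /ltr_add_invr[n nyr] := yr.
  by exists n => //; rewrite /F /= E lte_fin; move: nyr; rewrite add0r ltrBrDl addrC.
rewrite FE; have mUF : measurable (\bigcup_n F n) by exact: bigcup_measurable.
have ndF : nondecreasing_seq F.
  move=> m n mn; apply/subsetPset => x; apply: le_lt_trans.
  by rewrite lee_fin lerD2l lef_pV2 ?posrE ?ltr0n// ler_nat ltnS.
have h := nondecreasing_cvg_mu (mu := mu) mF mUF ndF.
rewrite -(cvg_lim _ h)//; apply: lime_le; first by apply/cvg_ex; eexists; exact: h.
near=> n; rewrite /=.
have : rearrangement mu g t < (y + n.+1%:R^-1)%:E.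
  by rewrite (le_lt_trans ry)// lte_fin ltrDl.
move=> /ereal_inf_lt[_ [z [z0 mz] <-]]; rewrite lte_fin => zy.
apply: le_trans mz; apply: le_measure; rewrite ?inE//.
  rewrite -[X in measurable X]setTI; apply: emeasurable_fun_o_infty => //.
  exact: measurableT_comp.
by move=> x; apply: lt_trans; rewrite lte_fin.
Unshelve. all: by end_near. Qed.

Lemma le_rearrangement g1 g2 t :
  (forall y, (0 <= y)%R ->
    mu [set x | y%:E < `|g1 x|] <= mu [set x | y%:E < `|g2 x|]) ->
  rearrangement mu g1 t <= rearrangement mu g2 t.
Proof.
move=> h; apply: ereal_inf_le_tmp => _ [y [y0 my] <-]; exists y => //.
by split=> //; rewrite (le_trans (h _ y0)).
Qed.

End Rearrangement.

(** * Step functions and the measure dt/t *)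

Section Cells.
Local Open Scope ereal_scope.
Context {R : realType}.
Implicit Types (a : nat -> \bar R) (N : (R -> \bar R) -> \bar R).
Local Notation lambda := (@lebesgue_measure R).
Local Notation lm := (@log_measure R).

(* The index of the interval [(k, k+1]] containing [x]; [cell k] below is the
   image of that interval under [x |-> e^-x]. *)
Definition idx (x : R) : nat := `|Num.ceil x|%N.-1.

Definition step a (x : R) : \bar R := a (idx x).

Lemma idxP (x : R) k : (0 < x)%R -> (idx x = k) <-> (k%:R < x <= k.+1%:R)%R.
Proof.
move=> x0; split; last first.
  move=> /andP[kx xk]; rewrite /idx (@ceil_def _ x k.+1%:Z)//.
  by rewrite xk andbT intrB /= -!pmulrn -natr1 addrK.
have c0 : (0 < Num.ceil x)%R by rewrite ceil_gt0.
rewrite /idx; move: (ceil_itv x) c0; case: (Num.ceil x) => // -[//|n] + _ /= <-.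
by rewrite intrB /= -!pmulrn -natr1 addrK.
Qed.

Definition cell (k : nat) : set R := `[expR (- k.+1%:R), expR (- k%:R)[%classic.

Lemma cellP (t : R) k : (0 < t)%R ->
  cell k t <-> (k%:R < - ln t <= k.+1%:R)%R.
Proof.
move=> t0; rewrite /cell/= in_itv/= -{1 2}(@lnK _ t) ?posrE//.
by rewrite ler_expR ltr_expR lerNl ltrNr andbC.
Qed.

Lemma cell_gt0 k t : cell k t -> (0 < t)%R.
Proof.
by rewrite /cell/= in_itv/= => /andP[+ _]; apply: lt_le_trans; exact: expR_gt0.
Qed.

Lemma cell_lt1 k t : cell k t -> (t < 1)%R.
Proof.
rewrite /cell/= in_itv/= => /andP[_ h]; apply: (lt_le_trans h).
by rewrite expR_le1 oppr_le0.
Qed.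

Lemma cell_idx (t : R) : (0 < t < 1)%R -> cell (idx (- ln t)) t.
Proof.
move=> /andP[t0 t1]; apply/cellP => //; apply/idxP => //.
by rewrite oppr_gt0; apply: ln_lt0; rewrite t0.
Qed.

Lemma idx_cell (t : R) k : cell k t -> idx (- ln t) = k.
Proof.
move=> kt; have t0 := cell_gt0 kt; have t1 := cell_lt1 kt.
apply/idxP; last exact/cellP.
by rewrite oppr_gt0; apply: ln_lt0; rewrite t0.
Qed.

Lemma measurable_cell k : measurable (cell k).
Proof. exact: measurable_itv. Qed.

(** Since [ln] is a primitive of [1/t], the cells play for [dt/t] the role of the unit intervals of
    (0,oo); step functions on both are then equimeasurable. *)
Lemma log_measure_cell k : lm (cell k) = 1.
Proof.
set u : R := expR (- k.+1%:R); set v : R := expR (- k%:R).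
have u0 : (0 < u)%R by exact: expR_gt0.
have uv : (u < v)%R by rewrite ltr_expR ltrN2 ltr_nat.
have pos t : `[u, v]%classic t -> (0 < t)%R.
  by rewrite /= in_itv/= => /andP[+ _]; exact: lt_le_trans.
rewrite /log_measure.
have -> : cell k `&` `]0%R, +oo[ = `[u, v[%classic.
  by apply: setIidl => t /cell_gt0; rewrite /= in_itv/= andbT.
have ct : {within `[u, v], continuous (@GRing.inv R)}.
  apply: continuous_in_subspaceT => t /set_mem /pos t0.
  by apply: inv_continuous; rewrite gt_eqF.
have dln (t : R) : (0 < t)%R -> is_derive t 1%R (@ln R) t^-1%R by move=> t0; exact: is_derive1_ln.
rewrite integral_itv_bndo_bndc; last first.
  apply/measurable_EFinP; apply: (@measurable_funS _ _ _ _ `[u, v]%classic).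
  - exact: measurable_itv.
  - exact: subset_itv_co_cc.
  - by apply: subspace_continuous_measurable_fun => //; exact: measurable_itv.
rewrite (@continuous_FTC2 _ _ (@ln R))//.
- by rewrite /u /v !expRK -EFinB -natr1; congr EFin; ring.
- split.
  + move=> t; rewrite in_itv/= => /andP[ut _].
    by have [] := dln t (lt_trans u0 ut).
  + by apply: cvg_at_right_filter; exact: continuous_ln.
  + by apply: cvg_at_left_filter; apply: continuous_ln; exact: expR_gt0.
- move=> t; rewrite in_itv/= => /andP[ut _].
  by rewrite derive1E; apply: derive_val; exact: dln (lt_trans u0 ut).
Qed.

Lemma trivIset_cell (D : set nat) : trivIset D cell.
Proof. by move=> i j _ _ [t [/idx_cell <- /idx_cell <-]]. Qed.

(** The distribution function of the sequence [a] for the counting measure. *)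
Definition count_gt a (y : R) : \bar R := \sum_(k <oo | y%:E < a k) 1.

Lemma eq_nneseries_cond (P Q : pred nat) (f : nat -> \bar R) : P =1 Q ->
  \sum_(k <oo | P k) f k = \sum_(k <oo | Q k) f k.
Proof. by move=> /funext ->. Qed.

Lemma lebesgue_step a y : lambda [set t | (0 < t)%R /\ y%:E < step a t] = count_gt a y.
Proof.
pose J k := `]k%:R, k.+1%:R]%classic : set R.
have -> : [set t | (0 < t)%R /\ y%:E < step a t] =
    \bigcup_(k in [set k | y%:E < a k]) J k.
  apply/seteqP; split => t /=.
    move=> [t0 ya]; exists (idx t) => //; rewrite /J/= in_itv/=.
    exact/idxP.
  move=> [k /= ya]; rewrite /J/= in_itv/= => kt.
  have t0 : (0 < t)%R by case/andP: kt => + _; apply: le_lt_trans.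
  by split=> //; rewrite /step (_ : idx t = k)//; exact/idxP.
rewrite measure_bigcup; last 2 first.
- by move=> k _; exact: measurable_itv.
- move=> i j _ _ [t [+ +]]; rewrite /J /= !in_itv/= => hi hj.
  have t0 : (0 < t)%R by case/andP: hi => + _; apply: le_lt_trans.
  by move/(idxP _ t0): hi <-; move/(idxP _ t0): hj <-.
rewrite (eq_nneseries_cond (Q := fun k => y%:E < a k)); last first.
  by move=> k; apply/idP/idP; rewrite inE.
apply: eq_eseriesr => k _; rewrite [LHS]lebesgue_measure_itv/= lte_fin ltr_nat leqnn.
by rewrite -EFinB -natr1 addrAC subrr add0r.
Qed.

Lemma log_measure_step a y : (forall k, 0 <= a k) -> (0 <= y)%R ->
  lm [set t | y%:E < `|((fun t => step a (- ln t)) \_ `]0%R, 1%R[) t|] = count_gt a y.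
Proof.
move=> a0 y0.
have -> : [set t | y%:E < `|((fun t => step a (- ln t)) \_ `]0%R, 1%R[) t|] =
    \bigcup_(k in [set k | y%:E < a k]) cell k.
  apply/seteqP; split => t /=.
    rewrite patchE; case: ifPn => [|_]; last by rewrite abse0 lte_fin ltNge y0.
    rewrite inE/= in_itv/= => t01; rewrite gee0_abs ?a0// => h.
    by exists (idx (- ln t)) => //; exact: cell_idx.
  move=> [k /= ya kt]; rewrite patchE ifT.
    by rewrite gee0_abs ?a0// /step (idx_cell kt).
  by rewrite inE/= in_itv/= (cell_gt0 kt) (cell_lt1 kt).
rewrite measure_bigcup; last 2 first.
- by move=> k _; exact: measurable_cell.
- exact: trivIset_cell.
rewrite (eq_nneseries_cond (Q := fun k => y%:E < a k)); last first.
  by move=> k; apply/idP/idP; rewrite inE.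
by apply: eq_eseriesr => k _; exact: log_measure_cell.
Qed.

End Cells.

(** * The norm of the space for dt/t and its values on step functions *)

Section TildeNorm.
Local Open Scope ereal_scope.
Context {R : realType}.
Implicit Types (a : nat -> \bar R) (N : (R -> \bar R) -> \bar R) (f g : R -> \bar R).
Local Notation lambda := (@lebesgue_measure R).
Local Notation lm := (@log_measure R).

(* Neither set is assumed measurable, so [tnorm] is monotone without any
   measurability of the functions, in particular of [t |-> K(t, f)]. *)
Lemma le_log_measure (A B : set R) : A `<=` B -> log_measure A <= log_measure B.
Proof.
move=> AB; rewrite /log_measure.
have pos C t : (C `&` `]0%R, +oo[%classic) t -> 0 <= (t^-1)%:E :> \bar R.
  by move=> [_]; rewrite /= in_itv/= andbT lee_fin invr_ge0 => /ltW.
rewrite !ge0_integralE//; try exact: pos.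
apply: le_ereal_sup => _ [h hA <-]; exists h => // x; apply: (le_trans (hA x)).
rewrite !patchE; case: ifPn => [|_]; last first.
  by case: ifPn => // /set_mem; exact: pos.
by rewrite inE => -[Ax x0]; rewrite ifT// inE; split => //; exact: AB.
Qed.

(** A common abstraction of [E] and of the inner norms [Lq q]: monotonicity and rearrangement
    invariance are what the passage from [tnorm] to sequences uses. *)
Definition rearr_norm N : Prop :=
  (forall f g, nneg_mfun f -> nneg_mfun g ->
    (forall t, (0 < t)%R -> f t <= g t) -> N f <= N g) /\
  (forall f g, nneg_mfun f -> nneg_mfun g -> equimeasurable f g -> N f = N g).

Lemma ri_rearr_norm N : is_ri_norm N -> rearr_norm N.
Proof.
move=> hN; split; last exact: ri_rearr hN.
by move=> f g mf mg fg; apply: (ri_monotone hN) => //; exact: aeW.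
Qed.

Let J k := `]k%:R, k.+1%:R]%classic : set R.

Let Jgt0 k t : J k t -> (0 < t)%R.
Proof. by rewrite /J/= in_itv/= => /andP[+ _]; apply: le_lt_trans. Qed.

Let J_idx k t : (0 < t)%R -> J k t <-> idx t = k.
Proof. by move=> t0; rewrite /J/= in_itv/= -idxP. Qed.

Lemma step_measurable a : measurable_fun (`]0%R, +oo[%classic : set R) (step a).
Proof.
move=> mD Y mY.
have -> : `]0%R, +oo[%classic `&` step a @^-1` Y = \bigcup_(k in [set k | Y (a k)]) J k.
  apply/seteqP; split => t /=.
    by rewrite in_itv/= andbT => -[t0 Yt]; exists (idx t) => //; exact/J_idx.
  move=> [k /= Yk kt]; rewrite in_itv/= andbT (Jgt0 kt); split => //.
  by rewrite /step (_ : idx t = k)//; apply/J_idx => //; exact: Jgt0 kt.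
by apply: bigcup_measurable => k _; exact: measurable_itv.
Qed.

Lemma step_nneg a : (forall k, 0 <= a k) -> nneg_mfun (step a).
Proof. by move=> a0; split; [exact: step_measurable|move=> t _; exact: a0]. Qed.

Lemma stepln_measurable a :
  measurable_fun setT ((fun t : R => step a (- ln t)) \_ `]0%R, 1%R[).
Proof.
apply/(measurable_restrictT _ (measurable_itv _)) => mD Y mY.
have -> : `]0%R, 1%R[%classic `&` (fun t : R => step a (- ln t)) @^-1` Y =
    \bigcup_(k in [set k | Y (a k)]) cell k.
  apply/seteqP; split => t /=.
    by rewrite in_itv/= => -[t0 Yt]; exists (idx (- ln t)) => //; exact: cell_idx.
  move=> [k /= Yk kt]; rewrite in_itv/= (cell_gt0 kt) (cell_lt1 kt); split => //.
  by rewrite /step (idx_cell kt).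
by apply: bigcup_measurable => k _; exact: measurable_cell.
Qed.

Lemma lebesgue_lt (c : \bar R) : 0 <= c ->
  lambda [set t | (0 < t)%R /\ t%:E < c] = c.
Proof.
case: c => [c c0|_|//].
- rewrite (_ : [set t | _] = `]0%R, c[%classic); last first.
    by apply/seteqP; split => t /=; rewrite in_itv/= lte_fin => /andP.
  rewrite lebesgue_measure_itv/= lte_fin; case: ltP => [_|]; first by rewrite sube0.
  by move=> c0'; apply/eqP; rewrite eq_le c0 lee_fin.
- rewrite (_ : [set t | _] = `]0%R, +oo[%classic); last first.
    by apply/seteqP; split => t /=; rewrite in_itv/= andbT ltry => -[].
  by rewrite lebesgue_measure_itv/= ltry.
Qed.

(** By [rearrangement_le], the rearrangement exceeds [y] exactly on the interval (0, m), where m is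
    the [dt/t]-measure of the superlevel set at [y]; its length m is the count. *)
Lemma equimeasurable_step a : (forall k, 0 <= a k) ->
  equimeasurable (rearrangement lm ((fun t => step a (- ln t)) \_ `]0%R, 1%R[)) (step a).
Proof.
move=> a0 y y0; rewrite lebesgue_step.
set g := (X in rearrangement _ X).
rewrite (_ : [set t | _] = [set t | (0 < t)%R /\ t%:E < lm [set x | y%:E < `|g x|]]).
  by rewrite lebesgue_lt// log_measure_step.
have mg : measurable_fun setT g by exact: stepln_measurable.
apply/seteqP; split => t /= [t0 h]; split => //; move: h; rewrite !ltNge;
  by apply: contra => /(rearrangement_le _ _ mg y0).
Qed.

Lemma tnorm_step N a : rearr_norm N -> (forall k, 0 <= a k) ->
  tnorm N `]0%R, 1%R[ (fun t => step a (- ln t)) = N (step a).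
Proof.
move=> [_ hN] a0; apply: hN; [exact: rearrangement_nneg|exact: step_nneg|].
exact: equimeasurable_step.
Qed.

Lemma le_tnorm N (I1 I2 : interval R) g1 g2 : rearr_norm N ->
  (forall t, t \in I1 -> `|g1 t| <= `|(g2 \_ [set` I2]) t|) ->
  tnorm N I1 g1 <= tnorm N I2 g2.
Proof.
move=> [hN _] h; apply: hN; [exact: rearrangement_nneg|exact: rearrangement_nneg|].
move=> t _; apply: le_rearrangement => y y0; apply: le_log_measure => x /=.
rewrite {1}patchE; case: ifPn => [/set_mem /= xI|_].
  by move=> /lt_le_trans; apply; exact: h.
by rewrite abse0 lte_fin ltNge y0.
Qed.

Lemma tnorm_le N (I : interval R) g a : rearr_norm N -> (forall k, 0 <= a k) ->
  (forall t, t \in I -> (0 < t < 1)%R) ->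
  (forall k t, cell k t -> t \in I -> `|g t| <= a k) ->
  tnorm N I g <= N (step a).
Proof.
move=> hN a0 I01 h; rewrite -tnorm_step//; apply: le_tnorm => // t tI.
have t01 := I01 _ tI.
rewrite patchE ifT; last by rewrite inE/= in_itv/=.
by rewrite [leRHS]gee0_abs ?a0//; apply: h => //; exact: cell_idx.
Qed.

(** Only cells with [a k > 0] have to lie in [I], so that masked sequences give lower bounds over
    subintervals of (0,1). *)
Lemma tnorm_ge N (I : interval R) g a : rearr_norm N -> (forall k, 0 <= a k) ->
  (forall k t, cell k t -> 0 < a k -> t \in I /\ a k <= `|g t|) ->
  N (step a) <= tnorm N I g.
Proof.
move=> hN a0 h; rewrite -tnorm_step//; apply: le_tnorm => // t.
rewrite in_itv/= => /cell_idx ht; rewrite gee0_abs ?a0//.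
have [->|ak] := eqVneq (step a (- ln t)) 0; first exact: abse_ge0.
have [|tI gt] := h _ _ ht; first by rewrite lt_def ak a0.
by rewrite patchE ifT// inE.
Qed.

End TildeNorm.

(** * Rearrangement invariance of the Lq norms *)

Section LqNorm.
Local Open Scope ereal_scope.
Context {R : realType}.
Implicit Types (f g : R -> \bar R).
Local Notation lambda := (@lebesgue_measure R).

(** Tonelli's theorem for the indicator of the region [S] below the graph. *)
Lemma layer_cake f : measurable_fun setT f -> (forall x, 0 <= f x) ->
  \int[lambda]_x f x = \int[lambda]_y (if (0 < y)%R then lambda [set x | y%:E < f x] else 0).
Proof.
move=> mf f0.
pose S := [set z : R * R | (0 < z.2)%R /\ z.2%:E < f z.1].
have mS : measurable S.
  rewrite (_ : S = [set z | (z.2 \in `]0%R, +oo[)] `&` [set z | (EFin \o snd) z < (f \o fst) z]).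
    apply: measurableI.
      rewrite -[X in measurable X]setTI.
      have m2 : measurable_fun setT (@snd R R) by exact: measurable_snd.
      exact: (m2 measurableT _ (measurable_itv `]0%R, +oo[)).
    rewrite -[X in measurable X]setTI; apply: measurable_lte => //.
      by apply/measurable_EFinP; exact: measurable_snd.
    by apply: measurableT_comp => //; exact: measurable_fst.
  by apply/seteqP; split => -[x y] /=; rewrite in_itv/= andbT.
pose F (z : R * R) := (\1_S z)%:E : \bar R.
have mF : measurable_fun setT F by apply/measurable_EFinP; exact: measurable_indic.
have F0 z : 0 <= F z by rewrite lee_fin.
transitivity (\int[lambda]_x \int[lambda]_y F (x, y)).
  apply: eq_integral => x _.
  pose Sx := [set t : R | (0 < t)%R /\ t%:E < f x].
  rewrite (_ : (fun y => F (x, y)) = (fun y => (\1_Sx y)%:E)).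
    rewrite integral_indic ?setIT//; first by rewrite [RHS]lebesgue_lt.
    rewrite (_ : Sx = xsection S x); first exact: measurable_xsection.
    by apply/seteqP; split => t; rewrite /xsection/= inE.
  by apply/funext => y; rewrite /F !indicE; congr (_%:R%:E); apply/idP/idP; rewrite !inE.
transitivity (\int[lambda]_y \int[lambda]_x F (x, y)).
  exact: (fubini_tonelli (m1 := lambda) (m2 := lambda) F mF F0).
apply: eq_integral => y _.
pose Sy := [set t : R | (0 < y)%R /\ y%:E < f t].
rewrite (_ : (fun x => F (x, y)) = (fun x => (\1_Sy x)%:E)); last first.
  by apply/funext => x; rewrite /F !indicE; congr (_%:R%:E); apply/idP/idP; rewrite !inE.
have mys : measurable [set t | y%:E < f t].
  by rewrite -[X in measurable X]setTI; apply: emeasurable_fun_o_infty.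
case: ifPn => y0.
  rewrite (_ : Sy = [set t | y%:E < f t]); first by rewrite integral_indic// setIT.
  by apply/seteqP; split => t //= [].
rewrite (_ : Sy = set0); first by rewrite indic0 integral0.
by apply/seteqP; split => t //= [yy _]; rewrite yy in y0.
Qed.

Lemma restrict_measurable f (D : set R) : measurable D -> measurable_fun D f ->
  measurable_fun setT (f \_ D).
Proof. by move=> mD /(measurable_restrictT _ mD). Qed.

Let pos : set R := `]0%R, +oo[%classic.
Let mpos : measurable pos. Proof. exact: measurable_itv. Qed.

Let pw_meas q f : nneg_mfun f -> measurable_fun setT (fun x => `|(f \_ pos) x| `^ q).
Proof.
move=> [mf _]; apply: (measurableT_comp (measurable_poweR q)).
by apply: measurableT_comp => //; exact: restrict_measurable.
Qed.

Lemma Lq_rearr_norm q : (0 < q)%R -> rearr_norm (@Lq R q).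
Proof.
move=> q0; split => [f g hf hg fg|f g hf hg fg].
  rewrite /Lq unlock; apply: gt0_ler_poweR.
  - by rewrite invr_ge0 ltW.
  - by rewrite in_itv/= leey andbT; apply: integral_ge0 => x _; exact: poweR_ge0.
  - by rewrite in_itv/= leey andbT; apply: integral_ge0 => x _; exact: poweR_ge0.
  apply: ge0_le_integral => //=.
  - by move=> x _; exact: poweR_ge0.
  - exact: pw_meas hf.
  - exact: pw_meas hg.
  move=> x _; apply: gt0_ler_poweR; rewrite ?in_itv/= ?abse_ge0 ?leey ?(ltW q0)//.
  rewrite !patchE; case: ifPn => [/set_mem /=|_//].
  rewrite in_itv/= andbT => x0; rewrite !gee0_abs ?fg//.
    exact: hg.2.
  exact: hf.2.
rewrite /Lq unlock; congr (_ `^ _).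
rewrite [LHS](layer_cake (pw_meas q hf)); last by move=> x; exact: poweR_ge0.
rewrite [RHS](layer_cake (pw_meas q hg)); last by move=> x; exact: poweR_ge0.
apply: eq_integral => y _; case: ifPn => // y0.
(* Superlevel sets of the [q]-th power at [y] are those of [h] at [y^(1/q)], so equimeasurability
   applies under the layer cake integral. *)
have key h : nneg_mfun h -> [set x | y%:E < `|(h \_ pos) x| `^ q] =
    [set t | (0 < t)%R /\ (y `^ q^-1)%:E < h t].
  move=> hh.
  have yE : y%:E = (y `^ q^-1)%:E `^ q.
    by rewrite poweR_EFin -powRrM mulVf ?gt_eqF// powRr1// ltW.
  have pE (z : \bar R) : 0 <= z -> (y%:E < z `^ q) = ((y `^ q^-1)%:E < z).
    move=> z0; apply/idP/idP; rewrite !ltNge; apply: contra => hz.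
      by rewrite yE; apply: gt0_ler_poweR; rewrite ?in_itv/= ?z0 ?leey ?lee_fin ?powR_ge0 ?(ltW q0).
    have : (z `^ q) `^ q^-1 <= y%:E `^ q^-1.
      apply: gt0_ler_poweR => //; rewrite ?in_itv/= ?leey ?poweR_ge0 ?lee_fin ?(ltW y0)//.
      by rewrite invr_ge0 ltW.
    by rewrite -poweRrM mulfV ?gt_eqF// poweRe1// poweR_EFin.
  apply/seteqP; split => x /=; rewrite pE ?abse_ge0//; rewrite patchE.
    case: ifPn => [/set_mem |_]; last by rewrite abse0 lte_fin ltNge powR_ge0.
    by rewrite /pos /= in_itv/= andbT => x0; rewrite gee0_abs//; exact: hh.2.
  move=> [x0 h1]; rewrite ifT; last by rewrite inE /pos/= in_itv/= andbT.
  by rewrite gee0_abs//; exact: hh.2.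
by rewrite (key f)// (key g)//; apply: fg; exact: powR_ge0.
Qed.

Lemma Lq_step q (a : nat -> \bar R) : (0 < q)%R -> (forall k, 0 <= a k) ->
  Lq q (step a) = (\sum_(k <oo) a k `^ q) `^ q^-1.
Proof.
move=> q0 a0; rewrite /Lq unlock; congr (_ `^ _).
pose J k := `]k%:R, k.+1%:R]%classic : set R.
have Jgt0 k t : J k t -> (0 < t)%R.
  by rewrite /J/= in_itv/= => /andP[+ _]; apply: le_lt_trans.
have J_idx k t : (0 < t)%R -> J k t <-> idx t = k.
  by move=> t0; rewrite /J/= in_itv/= -idxP.
have -> : (fun x => `|(step a \_ pos) x| `^ q) = (fun x => step a x `^ q) \_ pos.
  apply/funext => x; rewrite !patchE; case: ifPn => _; last first.
    by rewrite abse0 poweR0r ?gt_eqF.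
  by rewrite gee0_abs// a0.
rewrite -integral_mkcond.
have -> : pos = \bigcup_k J k.
  apply/seteqP; split => t; rewrite /pos /= in_itv/= andbT.
    by move=> t0; exists (idx t) => //; exact/J_idx.
  by move=> [k _ /Jgt0].
rewrite ge0_integral_bigcup//=.
- apply: eq_eseriesr => k _.
  rewrite (eq_integral (fun=> a k `^ q)); last first.
    move=> x /set_mem Jx; rewrite /step (_ : idx x = k)//.
    by apply/J_idx => //; exact: Jgt0 Jx.
  rewrite integral_cst; last exact: measurable_itv.
  rewrite [X in _ * X]lebesgue_measure_itv/= lte_fin ltr_nat leqnn.
  by rewrite -EFinB -natr1 addrAC subrr add0r mule1.
- by move=> k; exact: measurable_itv.
- apply: (measurableT_comp (measurable_poweR q)).
  apply: measurable_funS (step_measurable a) => //.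
  by move=> t [k _ /Jgt0 t0]; rewrite /= in_itv/= t0.
- by move=> x _; exact: poweR_ge0.
- by move=> i j _ _ [t [hi hj]]; move/(J_idx _ _ (Jgt0 _ _ hi)): (hi) <-; move/(J_idx _ _ (Jgt0 _ _ hj)): hj.
Qed.

End LqNorm.

(** * Non-negative series cut off by a Boolean mask *)

Section MaskedSeries.
Local Open Scope ereal_scope.
Context {R : realType}.
Implicit Types f g : nat -> \bar R.

Lemma le_ser f g : (forall n, 0 <= f n) -> (forall n, f n <= g n) ->
  \sum_(n <oo) f n <= \sum_(n <oo) g n.
Proof. by move=> f0 fg; apply: lee_nneseries. Qed.

Lemma ser_ge0 f : (forall n, 0 <= f n) -> 0 <= \sum_(n <oo) f n.
Proof. by move=> f0; apply: nneseries_ge0. Qed.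

Lemma ser_scale (c : R) f : (0 <= c)%R -> (forall n, 0 <= f n) ->
  \sum_(n <oo) (c%:E * f n) = c%:E * \sum_(n <oo) f n.
Proof. by move=> c0 f0; rewrite nneseriesZl. Qed.

Lemma ser_add f g : (forall n, 0 <= f n) -> (forall n, 0 <= g n) ->
  \sum_(n <oo) (f n + g n) = \sum_(n <oo) f n + \sum_(n <oo) g n.
Proof. by move=> f0 g0; rewrite nneseriesD. Qed.

Lemma ser_term f k : (forall n, 0 <= f n) -> f k <= \sum_(n <oo) f n.
Proof.
move=> f0; apply: le_trans (nneseries_lim_ge k.+1 _) => //.
by rewrite big_nat_recr//= leeDr// sume_ge0.
Qed.

Lemma ser_shift f k : (forall n, 0 <= f n) ->
  \sum_(j <oo) (if (k <= j)%N then f j else 0) = \sum_(d <oo) f (d + k)%N.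
Proof.
move=> f0; pose F j := if (k <= j)%N then f j else 0.
have F0 j : 0 <= F j by rewrite /F; case: ifP.
rewrite (nneseries_split 0 k) ?add0n => [|j _]; last exact: F0.
rewrite big_nat big1 ?add0e; last first.
  by move=> i /andP[_ ik]; rewrite leqNgt ik.
rewrite -(nneseries_addn k F0).
by apply: eq_eseriesr => d _; rewrite /F leq_addl.
Qed.

Lemma ser_trunc f k : (forall n, 0 <= f n) ->
  \sum_(j <oo) (if (j <= k)%N then f j else 0) = \sum_(j < k.+1) f j.
Proof.
move=> f0; rewrite (nneseries_split 0 k.+1) ?add0n => [|j _]; last by case: ifP.
rewrite [X in _ + X]eseries0 ?adde0; last first.
  by move=> i ki _; rewrite leqNgt ki.
by rewrite big_mkord; apply: eq_bigr => i _; rewrite -ltnS ltn_ord.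
Qed.

Lemma ser_le_ub f (C : \bar R) : (forall n, 0 <= f n) ->
  (forall n, \sum_(j < n) f j <= C) -> \sum_(j <oo) f j <= C.
Proof.
move=> f0 fC; apply: lime_le; first exact: is_cvg_nneseries.
by apply: nearW => n; rewrite big_mkord.
Qed.

Lemma geometric_sum_le (q : R) n : (0 <= q < 1)%R ->
  (\sum_(j < n) q ^+ j <= (1 - q)^-1)%R.
Proof.
move=> /andP[q0 q1].
have h : ((1 - q) * \sum_(j < n) q ^+ j = 1 - q ^+ n)%R.
  elim: n => [|n IH]; first by rewrite big_ord0 expr0; ring.
  by rewrite big_ord_recr/= mulrDr IH exprS; ring.
rewrite -(@ler_pM2l _ (1 - q)) ?subr_gt0// h mulfV ?subr_eq0 ?gt_eqF//.
by rewrite gerBl exprn_ge0.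
Qed.

Lemma geometric_ser_le (q : R) : (0 <= q < 1)%R ->
  \sum_(d <oo) (q ^+ d)%:E <= ((1 - q)^-1)%:E.
Proof.
move=> q01; apply: ser_le_ub => n.
  by rewrite lee_fin exprn_ge0//; case/andP: q01.
by rewrite sumEFin lee_fin geometric_sum_le.
Qed.

End MaskedSeries.

(** * The sequence norm of an r.i. space *)

Section SequenceNorm.
Local Open Scope ereal_scope.
Context {R : realType}.
Variable E : (R -> \bar R) -> \bar R.
Hypothesis hE : is_ri_norm E.
Implicit Types (a b x y : nat -> \bar R).
Local Notation M a := (E (step a)).

Let hr : rearr_norm E := ri_rearr_norm hE.

Lemma M_ge0 a : (forall k, 0 <= a k) -> 0 <= M a.
Proof. by move=> a0; apply: (ri_ge0 hE); exact: step_nneg. Qed.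

Lemma M_mono a b : (forall k, 0 <= a k) -> (forall k, a k <= b k) -> M a <= M b.
Proof.
move=> a0 ab; have b0 k : 0 <= b k by exact: le_trans (ab k).
by apply: hr.1 => [||t _]; [exact: step_nneg|exact: step_nneg|exact: ab].
Qed.

Lemma M_add a b : (forall k, 0 <= a k) -> (forall k, 0 <= b k) ->
  M (fun k => a k + b k) <= M a + M b.
Proof. by move=> a0 b0; apply: (ri_triangle hE); exact: step_nneg. Qed.

Lemma M_scale (c : R) a : (0 <= c)%R -> (forall k, 0 <= a k) ->
  M (fun k => c%:E * a k) = c%:E * M a.
Proof. by move=> c0 a0; apply: (ri_scale hE) => //; exact: step_nneg. Qed.

Lemma M_zero : M (fun=> 0) = 0.
Proof. by apply/(ri_eq0 hE); [exact: step_nneg|exact: aeW]. Qed.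

Lemma M_sum n (z : nat -> nat -> \bar R) : (forall d k, 0 <= z d k) ->
  M (fun k => \sum_(d < n) z d k) <= \sum_(d < n) M (z d).
Proof.
move=> z0; elim: n => [|n IH].
  rewrite big_ord0 (_ : (fun _ => _) = fun=> 0) ?M_zero//.
  by apply/funext => k; rewrite big_ord0.
rewrite big_ord_recr/=; apply: le_trans (leeD IH (lexx _)).
rewrite (_ : (fun _ => _) = fun k => \sum_(d < n) z d k + z n k).
  by apply: M_add => // k; exact: sume_ge0.
by apply/funext => k; rewrite big_ord_recr.
Qed.

(** Countable subadditivity: the Fatou property is applied to the partial sums. The Hardy
    inequalities below rest on it. *)
Lemma M_series (z : nat -> nat -> \bar R) : (forall d k, 0 <= z d k) ->
  M (fun k => \sum_(d <oo) z d k) <= \sum_(d <oo) M (z d).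
Proof.
move=> z0; pose h n := step (fun k => \sum_(d < n) z d k).
have h0 n : nneg_mfun (h n) by apply: step_nneg => k; exact: sume_ge0.
have cvh : E (h n) @[n --> \oo] --> M (fun k => \sum_(d <oo) z d k).
  apply: (ri_fatou hE) => //.
  - by apply: step_nneg => k; exact: ser_ge0.
  - move=> n; apply: aeW => t _; rewrite /h /step big_ord_recr/=.
    by rewrite leeDl.
  - apply: aeW => t _; rewrite /h /step.
    under eq_fun do rewrite -(big_mkord xpredT (z ^~ (idx t))).
    exact: is_cvg_nneseries.
rewrite -(cvg_lim _ cvh)//; apply: lime_le; first by apply/cvg_ex; eexists; exact: cvh.
apply: nearW => n; apply: le_trans (M_sum _ z0) _.
rewrite -(big_mkord xpredT (fun d => M (z d))).
by apply: nneseries_lim_ge => d _ _; exact: M_ge0.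
Qed.

(** Domination of the distribution functions gives pointwise domination of the rearrangements, and
    [tnorm_step] reads both norms off the rearrangements. *)
Lemma M_count a b : (forall k, 0 <= a k) -> (forall k, 0 <= b k) ->
  (forall c, (0 <= c)%R -> count_gt a c <= count_gt b c) -> M a <= M b.
Proof.
move=> a0 b0 ab; rewrite -!tnorm_step//.
apply: hr.1 => [||t _]; [exact: rearrangement_nneg|exact: rearrangement_nneg|].
apply: le_rearrangement => c c0.
by rewrite [leLHS](log_measure_step a0 c0) [leRHS](log_measure_step b0 c0); exact: ab.
Qed.

(** The superlevel sets of [x] are mapped injectively into those of [y]. Injectivity is asked on the
    support of [x] alone, so that truncated maps such as [n |-> n - d] qualify. *)
Lemma M_inj x y (s : nat -> nat) : (forall k, 0 <= x k) -> (forall k, 0 <= y k) ->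
  (forall n, 0 < x n -> x n <= y (s n)) ->
  (forall n n', 0 < x n -> 0 < x n' -> s n = s n' -> n = n') ->
  M x <= M y.
Proof.
move=> x0 y0 xy inj; apply: M_count => // c c0; rewrite /count_gt.
have pos n : c%:E < x n -> 0 < x n by apply: le_lt_trans; rewrite lee_fin.
rewrite !nneseries_esum//.
pose X := [set k | c%:E < x k]; pose Y := [set k | c%:E < y k].
have -> : [set k | is_true (c%:E < x k)] = X by [].
rewrite -/X -/Y.
have sXY : s @` X `<=` Y.
  by move=> _ [n Xn <-]; apply: (lt_le_trans Xn); apply: xy; exact: pos.
rewrite (_ : \esum_(i in X) 1 = \esum_(i in s @` X) 1).
  rewrite [leRHS](esumID (s @` X))//.
  by rewrite setIidr// leeDl// esum_ge0.
rewrite (@esum_image _ _ _ X s (fun=> 1))//.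
by move=> n n' /set_mem Xn /set_mem Xn'; apply: inj; exact: pos.
Qed.

Definition unit0 (n : nat) : \bar R := if n == 0%N then 1 else 0.

Lemma unit0_ge0 n : 0 <= unit0 n. Proof. by rewrite /unit0; case: ifP. Qed.

Lemma M_unit_gt0 : 0 < M unit0.
Proof.
rewrite lt_def M_ge0 ?andbT; last exact: unit0_ge0.
apply/eqP => /(ri_eq0 hE (step_nneg unit0_ge0)) [A [mA A0 hA]].
have : lebesgue_measure (`]0%R, 1%R]%classic : set R) <= 0.
  rewrite -A0; apply: le_measure; rewrite ?inE//=.
  apply: subset_trans hA => t /=; rewrite in_itv/= => /andP[t0 t1] /(_ t0).
  rewrite /step (_ : idx t = 0%N); first by rewrite /unit0/= => /eqP; rewrite eqe oner_eq0.
  by apply/idxP => //; rewrite t0 t1.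
by rewrite lebesgue_measure_itv/= lte_fin ltr01 sube0 lee_fin ler10.
Qed.

Lemma M_term (c : R) a k : (0 <= c)%R -> (forall k, 0 <= a k) -> c%:E <= a k ->
  c%:E * M unit0 <= M a.
Proof.
move=> c0 a0 ca; rewrite -M_scale//; last exact: unit0_ge0.
have p n : 0 < c%:E * unit0 n -> n = 0%N.
  by rewrite /unit0; case: eqP => // _; rewrite mule0 ltxx.
apply: (@M_inj _ _ (fun=> k)) => //.
- by move=> n; rewrite mule_ge0// unit0_ge0.
- by move=> n /p ->; rewrite /unit0 mule1.
- by move=> n n' /p -> /p ->.
Qed.

(** The embedding into bounded sequences: one term of size [c] already costs [c * M unit0], and
    [M unit0 > 0]. It is used to deduce finiteness of the small Lebesgue norm. *)
Lemma M_fin a : (forall k, 0 <= a k) -> M a < +oo ->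
  exists2 C : R, (0 <= C)%R & forall k, a k <= C%:E.
Proof.
move=> a0 afin; have u0 := M_unit_gt0.
have afn : M a \is a fin_num by rewrite ge0_fin_numE// M_ge0.
pose r := fine (M a); have r0 : (0 <= r)%R by rewrite fine_ge0// M_ge0.
have rE : M a = r%:E by rewrite fineK.
have [m m0 mu] : exists2 m : R, (0 < m)%R & m%:E <= M unit0.
  move: u0; case: (M unit0) => [m|_|//]; first by rewrite lte_fin; exists m.
  by exists 1%R => //; rewrite leey.
exists (r / m)%R; first by rewrite divr_ge0// ltW.
move=> k; rewrite leNgt; apply/negP => h.
have [c rc ca] : exists2 c : R, (r / m < c)%R & c%:E <= a k.
  move: h; case: (a k) => [c|_|//]; first by rewrite lte_fin; exists c.
  by exists (r / m + 1)%R; rewrite ?ltrDl ?leey.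
have c0 : (0 <= c)%R by rewrite (le_trans _ (ltW rc))// divr_ge0// ltW.
have := M_term c0 a0 ca; rewrite rE => /(le_trans (lee_wpmul2l _ mu)).
by rewrite lee_fin => /(_ c0); rewrite -EFinM lee_fin leNgt -ltr_pdivrMr// rc.
Qed.

Lemma M_shift a d : (forall k, 0 <= a k) ->
  M a <= M (fun k => if (d <= k)%N then a (k - d)%N else 0).
Proof.
move=> a0; apply: (@M_inj _ _ (fun n => (n + d)%N)) => //.
- by move=> k; case: ifP.
- by move=> n _; rewrite leq_addl addnK.
- by move=> n n' _ _; lia.
Qed.

(** The fibres of [s] have diameter at most [m], so [s] is injective on each residue class modulo
    [m+1]; the norm is split over these classes. *)
Lemma M_finite_mult a (s : nat -> nat) m : (forall k, 0 <= a k) ->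
  (forall n n', s n = s n' -> (n' <= n + m)%N) ->
  M (a \o s) <= m.+1%:R%:E * M a.
Proof.
move=> a0 hs.
pose z (i n : nat) := if (n %% m.+1 == i)%N then a (s n) else 0.
have z0 i n : 0 <= z i n by rewrite /z; case: ifP.
have -> : a \o s = fun n => \sum_(i < m.+1) z i n.
  apply/funext => n /=.
  rewrite (bigD1 (Ordinal (ltn_pmod n (ltn0Sn m))))//= /z eqxx big1 ?adde0//.
  move=> i; rewrite -val_eqE/= eq_sym => /negbTE ->//.
apply: le_trans (M_sum _ z0) _.
have -> : m.+1%:R%:E * M a = \sum_(i < m.+1) M a.
  elim: m.+1 => [|n IH]; first by rewrite big_ord0 mul0e.
  by rewrite big_ord_recr/= -IH -natr1 EFinD ge0_muleDl ?lee_fin// mul1e.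
apply: lee_sum => i _.
apply: (@M_inj _ _ s) => //.
  by move=> n; rewrite /z; case: ifP.
move=> n n'; rewrite /z; case: eqP => [ni|_]; last by rewrite ltxx.
case: eqP => [ni'|_ _]; last by rewrite ltxx.
move=> _ _ e; have h1 := hs _ _ e; have h2 := hs _ _ (esym e).
have key k k' : (k <= k')%N -> (k' <= k + m)%N -> (k' %% m.+1 = k %% m.+1)%N -> k = k'.
  move=> kk' k'm /eqP; rewrite eqn_mod_dvd// => /dvdn_leq.
  by case: (posnP (k' - k)) => [|_ /(_ isT)]; lia.
case: (leqP n n') => nn'; first by apply: key => //; rewrite ni.
by apply/esym/key => //; [exact: ltnW|rewrite ni].
Qed.

(** In the variable [d = j - k] the sum is a geometric combination of left shifts of [x], each of
    norm at most [M x], and [M_series] adds them up. *)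
Lemma Hardy_up (q : R) x : (0 <= q < 1)%R -> (forall k, 0 <= x k) ->
  M (fun k => \sum_(j <oo) (if (k <= j)%N then (q ^+ (j - k))%:E * x j else 0))
    <= ((1 - q)^-1)%:E * M x.
Proof.
move=> q01 x0; have [q0 q1] := andP q01.
have qd d : 0 <= (q ^+ d)%:E by rewrite lee_fin exprn_ge0.
rewrite (_ : (fun _ => _) = fun k => \sum_(d <oo) (q ^+ d)%:E * x (d + k)%N); last first.
  apply/funext => k.
  rewrite (@ser_shift _ (fun j => (q ^+ (j - k))%:E * x j)).
    by apply: eq_eseriesr => d _; rewrite addnK.
  by move=> n; rewrite mule_ge0.
apply: le_trans (M_series _) _; first by move=> d k; rewrite mule_ge0.
apply: (@le_trans _ _ (\sum_(d <oo) (q ^+ d)%:E * M x)).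
  apply: le_ser => d; first by rewrite M_ge0// => k; rewrite mule_ge0.
  rewrite (M_scale (exprn_ge0 d q0))// lee_wpmul2l//.
  apply: (@M_inj _ _ (fun n => (d + n)%N)) => //.
  by move=> n n' _ _; lia.
have : 0 <= M x by exact: M_ge0.
case: (M x) => [r r0|_|//]; last first.
  by rewrite [leRHS]gt0_muley ?leey// lte_fin invr_gt0 subr_gt0.
under eq_eseriesr => d _ do rewrite muleC.
by rewrite ser_scale// muleC lee_wpmul2r// geometric_ser_le.
Qed.

Lemma Hardy_down (q : R) x : (0 <= q < 1)%R -> (forall k, 0 <= x k) ->
  M (fun k => \sum_(j <oo) (if (j <= k)%N then (q ^+ (k - j))%:E * x j else 0))
    <= ((1 - q)^-1)%:E * M x.
Proof.
move=> q01 x0; have [q0 q1] := andP q01.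
have qd d : 0 <= (q ^+ d)%:E by rewrite lee_fin exprn_ge0.
(* The right shift by [d], padded with zeros: [n |-> n - d] is injective on its support, as [M_inj]
   requires. *)
pose z (d k : nat) := if (d <= k)%N then x (k - d)%N else 0.
have z0 d k : 0 <= z d k by rewrite /z; case: ifP.
rewrite (_ : (fun _ => _) = fun k => \sum_(d <oo) (q ^+ d)%:E * z d k); last first.
  apply/funext => k.
  rewrite (@ser_trunc _ (fun j => (q ^+ (k - j))%:E * x j)); last first.
    by move=> n; rewrite mule_ge0.
  transitivity (\sum_(d <oo) (if (d <= k)%N then (q ^+ d)%:E * x (k - d)%N else 0)); last first.
    by apply: eq_eseriesr => d _; rewrite /z; case: ifP => // _; rewrite mule0.
  rewrite (@ser_trunc _ (fun d => (q ^+ d)%:E * x (k - d)%N)); last first.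
    by move=> n; rewrite mule_ge0.
  rewrite (reindex_inj rev_ord_inj)/=; apply: eq_bigr => i _.
  by rewrite subSS subKn// -ltnS.
apply: le_trans (M_series _) _; first by move=> d k; rewrite mule_ge0.
apply: (@le_trans _ _ (\sum_(d <oo) (q ^+ d)%:E * M x)).
  apply: le_ser => d; first by rewrite M_ge0// => k; rewrite mule_ge0.
  rewrite (M_scale (exprn_ge0 d q0))// lee_wpmul2l//.
  apply: (@M_inj _ _ (fun n => (n - d)%N)) => //.
    by move=> n; rewrite /z; case: ifP => // _; rewrite ltxx.
  move=> n n'; rewrite /z; case: leqP => [h1 _|_]; last by rewrite ltxx.
  by case: leqP => [h2 _|_]; [lia|rewrite ltxx].
have : 0 <= M x by exact: M_ge0.
case: (M x) => [r r0|_|//]; last first.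
  by rewrite [leRHS]gt0_muley ?leey// lte_fin invr_gt0 subr_gt0.
under eq_eseriesr => d _ do rewrite muleC.
by rewrite ser_scale// muleC lee_wpmul2r// geometric_ser_le.
Qed.

End SequenceNorm.

(** * Regularly varying sequences *)

Section Weights.
Context {R : realType}.
Implicit Types (c s : R) (v w : nat -> R).

(* The increments of [- ln v] are [c] per step, up to an arbitrarily small slope. *)
Definition regvar c v : Prop := (forall n, 0 < v n) /\
  forall eps : R, 0 < eps -> exists2 C : R, 0 < C &
    forall n m, v n <= C * expR (- c * (n%:R - m%:R) + eps * `|n%:R - m%:R|) * v m.

(** [wt s n] and [ew c n] are the values of [ell^s(t)] and [t^c] at [t = e^-n]. *)
Definition wt s (n : nat) : R := n.+1%:R `^ s.

Definition ew c (n : nat) : R := expR (- (c * n%:R)).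

Lemma wt_gt0 s n : 0 < wt s n. Proof. by rewrite powR_gt0. Qed.

Lemma ew_gt0 c n : 0 < ew c n. Proof. exact: expR_gt0. Qed.

Lemma wtD s t n : wt (s + t) n = wt s n * wt t n.
Proof. by rewrite /wt powRD// pnatr_eq0 implybT. Qed.

Lemma wt0 n : wt 0 n = 1. Proof. by rewrite /wt powRr0. Qed.

Lemma wt_le s t n : s <= t -> wt s n <= wt t n.
Proof. by move=> st; apply: ler_powR => //; rewrite ler1n. Qed.

Lemma ewD c d n : ew (c + d) n = ew c n * ew d n.
Proof. by rewrite /ew mulrDl opprD expRD. Qed.

Lemma ew0 n : ew 0 n = 1. Proof. by rewrite /ew mul0r oppr0 expR0. Qed.

Lemma ewS c n : ew c n = expR c * ew c n.+1.
Proof. by rewrite /ew -expRD -natr1; congr expR; ring. Qed.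

Lemma regvar_ew c : regvar c (ew c).
Proof.
split=> [n|eps e0]; first exact: ew_gt0.
exists 1 => // n m; rewrite mul1r /ew -expRD ler_expR.
have : 0 <= eps * `|n%:R - m%:R| by rewrite mulr_ge0// ltW.
lra.
Qed.

Lemma regvar_mul c d v w : regvar c v -> regvar d w -> regvar (c + d) (fun n => v n * w n).
Proof.
move=> [v0 hv] [w0 hw]; split=> [n|eps e0]; first exact: mulr_gt0.
have e2 : 0 < eps / 2 by rewrite divr_gt0.
have [C C0 hC] := hv _ e2; have [D D0 hD] := hw _ e2.
exists (C * D); first exact: mulr_gt0.
move=> n m; apply: le_trans (ler_pM _ _ (hC n m) (hD n m)) _.
- exact: ltW.
- exact: ltW.
set a := n%:R - m%:R.
rewrite [leRHS](_ : _ = C * expR (- c * a + eps / 2 * `|a|) * v m *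
  (D * expR (- d * a + eps / 2 * `|a|) * w m))//.
rewrite (_ : - (c + d) * a + _ = (- c * a + eps / 2 * `|a|) + (- d * a + eps / 2 * `|a|)).
  by rewrite expRD; ring.
by field.
Qed.

Lemma regvar_inv c v : regvar c v -> regvar (- c) (fun n => (v n)^-1).
Proof.
move=> [v0 hv]; split=> [n|eps e0]; first by rewrite invr_gt0.
have [C C0 hC] := hv _ e0; exists C => // n m.
rewrite -[leLHS]mul1r ler_pdivrMr// mulrAC ler_pdivlMr// mul1r.
apply: le_trans (hC m n) _; rewrite ler_pM2r// ler_pM2l// ler_expR.
by rewrite distrC opprK -[X in _ <= _ * X + _]opprB mulrN mulNr.
Qed.

Lemma powR_expR_ln (x s : R) : 0 < x -> x `^ s = expR (s * ln x).
Proof. by move=> x0; rewrite -{1}[x]lnK ?posrE// -expRM mulrC. Qed.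

Lemma ln_ratio (n m : nat) : ln (n.+1%:R) - ln (m.+1%:R) <= ln (1 + `|n%:R - m%:R|) :> R.
Proof.
rewrite lerBlDr -lnM ?posrE ?ltr_pwDl//.
rewrite ler_ln ?posrE ?mulr_gt0 ?ltr_pwDl//.
rewrite -!natr1 mulrDl mul1r mulrDr mulr1.
have h1 := ler_norm (n%:R - m%:R : R); have h2 : 0 <= `|n%:R - m%:R| * m%:R :> R by rewrite mulr_ge0.
lra.
Qed.

Lemma ln1D_le (a : R) : 0 < a -> exists2 K : R, 0 <= K &
  forall x, 0 <= x -> ln (1 + x) <= a * x + K.
Proof.
(* [ln z <= z - 1] at [z = b (1 + x)] gives slope [b <= a] and intercept at most [- ln b]; the cap
   at 1 makes [- ln b] non-negative. *)
move=> a0; pose b := Num.min a 1.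
have b0 : 0 < b by rewrite lt_min a0 ltr01.
have b1 : b <= 1 by rewrite ge_min lexx orbT.
have ba : b <= a by rewrite ge_min lexx.
exists (- ln b); first by rewrite oppr_ge0 ln_le0.
move=> x x0; have x1 : 0 < 1 + x by rewrite ltr_pwDl.
have h : ln (b * (1 + x)) <= b * (1 + x) - 1.
  rewrite -[X in ln X](subrK 1) addrC; apply: le_ln1Dx.
  by rewrite ltrBrDr addNr mulr_gt0.
rewrite lnM ?posrE// in h.
have h2 : b * x <= a * x by rewrite ler_wpM2r.
lra.
Qed.

(** [ln (n+1)] and [ln (m+1)] differ by at most [ln (1 + |n - m|)], which lies below a line of
    arbitrarily small slope. *)
Lemma regvar_wt s : regvar 0 (wt s).
Proof.
split=> [n|eps e0]; first exact: wt_gt0.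
have a0 : 0 < eps / (`|s| + 1) by rewrite divr_gt0// ltr_wpDl.
have [K K0 hK] := ln1D_le a0.
exists (expR (`|s| * K)); first exact: expR_gt0.
move=> n m; rewrite /wt !powR_expR_ln// -!expRD ler_expR oppr0 mul0r add0r.
rewrite -lerBlDr -mulrBr.
have h : `|ln n.+1%:R - ln m.+1%:R| <= ln (1 + `|n%:R - m%:R|) :> R.
  by rewrite ler_norml lerNl opprB ln_ratio distrC ln_ratio.
apply: le_trans (ler_norm _) _; rewrite normrM.
apply: le_trans (ler_wpM2l (normr_ge0 s) (le_trans h (hK _ (normr_ge0 _)))) _.
rewrite mulrDr addrC lerD2l mulrA ler_wpM2r//.
rewrite mulrCA -[leRHS]mulr1 ler_pM2l// ler_pdivrMr ?mul1r ?lerDl// ltr_wpDl//.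
Qed.

Lemma regvar_ewwt c s : regvar c (fun n => ew c n * wt s n).
Proof. by have := regvar_mul (regvar_ew c) (regvar_wt s); rewrite addr0. Qed.

(** Giving up half of the exponent, [eps = c/2], leaves the ratio [q = e^(-c/2)]. *)
Lemma regvar_decay c v : regvar c v -> 0 < c -> exists2 q : R, 0 < q < 1 &
  exists2 C : R, 0 < C & forall m n, (m <= n)%N -> v n <= C * q ^+ (n - m) * v m.
Proof.
move=> [v0 hv] c0; exists (expR (- (c / 2))).
  by rewrite expR_gt0/= expR_lt1 oppr_lt0 divr_gt0.
have [C C0 hC] := hv (c / 2) (divr_gt0 c0 (ltr0n _ 2)).
exists C => // m n mn; apply: le_trans (hC n m) _.
rewrite ler_pM2r// ler_pM2l// -expRM_natl ler_expR natrB// ger0_norm ?subr_ge0 ?ler_nat//.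
by rewrite le_eqVlt; apply/orP; left; apply/eqP; field.
Qed.

Lemma regvar_grow c v : regvar c v -> c < 0 -> exists2 q : R, 0 < q < 1 &
  exists2 C : R, 0 < C & forall m n, (m <= n)%N -> v m <= C * q ^+ (n - m) * v n.
Proof.
move=> hv c0; have c1 : 0 < - c by rewrite oppr_gt0.
have [q q01 [C C0 hC]] := regvar_decay (regvar_inv hv) c1.
exists q => //; exists C => // m n mn; have := hC _ _ mn.
have [v0 _] := hv.
by rewrite -[leLHS]mul1r ler_pdivrMr// mulrAC ler_pdivlMr// mul1r.
Qed.

(** This absorbs the shifts by one or two cells that the lower bounds of the discretisation lose. *)
Lemma regvar_near c v d : regvar c v -> exists2 C : R, 0 < C &
  forall n m, (n <= m + d)%N -> (m <= n + d)%N -> v n <= C * v m.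
Proof.
move=> [v0 hv]; have [C C0 hC] := hv 1 ltr01.
exists (C * expR ((`|c| + 1) * d%:R)); first by rewrite mulr_gt0// expR_gt0.
move=> n m nm mn; apply: le_trans (hC n m) _.
rewrite ler_pM2r// ler_pM2l// ler_expR.
have h : `|n%:R - m%:R| <= d%:R :> R.
  rewrite ler_norml lerBrDl lerBlDl addrC -!natrD !ler_nat lerBlDr -natrD ler_nat; lia.
rewrite mul1r mulrDl mul1r lerD//.
by apply: le_trans (ler_norm _) _; rewrite normrM normrN ler_wpM2l.
Qed.

(** Young's inequality for the product of [x^a] and 1, with exponents [1/a] and [1/(1-a)]. *)
Lemma powR_concave (a x : R) : 0 < a -> a <= 1 -> 0 <= x -> x `^ a <= 1 + a * (x - 1).
Proof.
move=> a0 a1 x0; have [->|an1] := eqVneq a 1.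
  by rewrite powRr1// mul1r addrC subrK.
have a1' : 0 < 1 - a by rewrite subr_gt0 lt_neqAle an1.
have := @conjugate_powR R (x `^ a) 1 a^-1 (1 - a)^-1 (powR_ge0 _ _) ler01.
rewrite !invr_gt0 => /(_ a0 a1'); rewrite !invrK addrC subrK => /(_ erefl).
rewrite mulr1 -powRrM mulfV ?gt_eqF// powRr1// powR1 mul1r => h.
by apply: le_trans h _; lra.
Qed.

Lemma powR_convex (a x : R) : 1 <= a -> 0 <= x -> 1 + a * (x - 1) <= x `^ a.
Proof.
move=> a1 x0; have a0 : 0 < a by exact: lt_le_trans a1.
have := @powR_concave a^-1 (x `^ a); rewrite invr_gt0 invf_le1// powR_ge0 => /(_ a0 a1 isT).
rewrite -powRrM mulfV ?gt_eqF// powRr1// => h.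
have := ler_wpM2l (ltW a0) h; rewrite mulrDr mulrA mulfV ?gt_eqF//; lra.
Qed.

Lemma powR_incr (a x : R) : 0 < a -> 0 <= x <= 1 ->
  Num.min a 1 * (1 - x) <= 1 - x `^ a <= Num.max a 1 * (1 - x).
Proof.
move=> a0 /andP[x0 x1]; have [a1|a1] := leP a 1.
  have := powR_concave a0 a1 x0.
  have := @ger1_powR _ x a; move: x0; rewrite le_eqVlt => /predU1P[<-|x0].
    by move=> _; rewrite powR0 ?gt_eqF//; lra.
  by rewrite x0 x1 => /(_ isT a1); lra.
have := powR_convex (ltW a1) x0.
have := @ge1r_powR _ x a; move: x0; rewrite le_eqVlt => /predU1P[<-|x0].
  by move=> _; rewrite powR0 ?gt_eqF//; lra.
by rewrite x0 x1 => /(_ isT (ltW a1)); lra.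
Qed.

(** A discrete derivative of [n^a]: [powR_incr] at [x = n/(n+1)], multiplied by [(n+1)^a], holds
    uniformly down to [n = 0]. *)
Lemma wt_incr (a : R) n : 0 < a ->
  Num.min a 1 * wt (a - 1) n <= n.+1%:R `^ a - n%:R `^ a <= Num.max a 1 * wt (a - 1) n.
Proof.
move=> a0; have n0 : 0 < n.+1%:R :> R by [].
have x01 : 0 <= (n%:R / n.+1%:R : R) <= 1.
  by rewrite divr_ge0//= ler_pdivrMr// mul1r ler_nat.
have := powR_incr a0 x01.
have -> : 1 - n%:R / n.+1%:R = n.+1%:R^-1 :> R.
  by rewrite -[X in X - _](@divff _ n.+1%:R) ?gt_eqF// -mulrBl -natr1 addrAC subrr add0r mul1r.
rewrite powRM ?invr_ge0// => /andP[h1 h2].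
have w0 : 0 < n.+1%:R `^ a :> R by rewrite powR_gt0.
have wE : wt (a - 1) n = n.+1%:R^-1 * n.+1%:R `^ a.
  by rewrite -(mulr_powRB1 (ltW n0) a0) mulrA mulVf ?gt_eqF// mul1r.
have iE : (n.+1%:R^-1 `^ a) * n.+1%:R `^ a = 1 :> R.
  by rewrite -powRM ?invr_ge0// mulVf ?gt_eqF// powR1.
have E : n.+1%:R `^ a - n%:R `^ a = (1 - n%:R `^ a * n.+1%:R^-1 `^ a) * n.+1%:R `^ a :> R.
  by rewrite mulrBl mul1r -mulrA iE mulr1.
by rewrite wE E !mulrA !ler_pM2r// h1 h2.
Qed.

(** Telescoping of [wt_incr]. This turns the exponent [a - 1] of the small Lebesgue norm into the
    exponent [a] of the [Q] term. *)
Lemma wt_sum (a : R) k : 0 < a ->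
  Num.min a 1 * \sum_(n < k.+1) wt (a - 1) n <= wt a k <= Num.max a 1 * \sum_(n < k.+1) wt (a - 1) n.
Proof.
move=> a0; have E : wt a k = \sum_(n < k.+1) (n.+1%:R `^ a - n%:R `^ a).
  elim: k => [|k IH]; first by rewrite big_ord1 powR0 ?subr0// gt_eqF.
  by rewrite big_ord_recr/= -IH /wt addrC subrK.
by rewrite E !mulr_sumr; apply/andP; split; apply: ler_sum => n _;
  have /andP[] := wt_incr n a0.
Qed.

End Weights.

(** * Sums of regularly varying weights *)

Section WeightSeries.
Local Open Scope ereal_scope.
Context {R : realType}.
Implicit Types (c s : R) (v w : nat -> R).

Lemma wt_ser_le (a : R) : (0 < a)%R -> exists2 C : R, (0 < C)%R &
  forall k, \sum_(n <oo) (if (n <= k)%N then (wt (a - 1) n)%:E else 0) <= (C * wt a k)%:E.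
Proof.
move=> a0; have m0 : (0 < Num.min a 1)%R by rewrite lt_min a0 ltr01.
exists (Num.min a 1)^-1%R; first by rewrite invr_gt0.
move=> k; rewrite (@ser_trunc _ (fun n => (wt (a - 1) n)%:E)); last first.
  by move=> n; rewrite lee_fin ltW// wt_gt0.
have /andP[h _] := wt_sum k a0.
by rewrite sumEFin lee_fin mulrC ler_pdivlMr// mulrC.
Qed.

Lemma wt_ser_ge (a : R) : (0 < a)%R -> exists2 C : R, (0 < C)%R &
  forall k, (wt a k)%:E <= C%:E * \sum_(n <oo) (if (n <= k)%N then (wt (a - 1) n)%:E else 0).
Proof.
move=> a0; have m0 : (0 < Num.max a 1)%R by rewrite lt_max a0.
exists (Num.max a 1)%R => // k.
rewrite (@ser_trunc _ (fun n => (wt (a - 1) n)%:E)); last first.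
  by move=> n; rewrite lee_fin ltW// wt_gt0.
have /andP[_ h] := wt_sum k a0.
by rewrite sumEFin -EFinM lee_fin.
Qed.

Lemma regvar_ser_up c v : regvar c v -> (0 < c)%R -> exists2 C : R, (0 < C)%R &
  forall k, \sum_(n <oo) (if (k <= n)%N then (v n)%:E else 0) <= (C * v k)%:E.
Proof.
move=> hv c0; have [q /andP[q0 q1] [C C0 hC]] := regvar_decay hv c0.
have v0 n : (0 < v n)%R by case: hv.
exists (C * (1 - q)^-1)%R; first by rewrite mulr_gt0// invr_gt0 subr_gt0.
move=> k; rewrite (@ser_shift _ (fun n => (v n)%:E)); last first.
  by move=> n; rewrite lee_fin ltW.
apply: (@le_trans _ _ (\sum_(d <oo) (C * v k)%:E * (q ^+ d)%:E)).
  apply: le_ser => d; first by rewrite lee_fin ltW.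
  rewrite -EFinM lee_fin; apply: le_trans (hC k _ (leq_addl _ _)) _.
  by rewrite addnK mulrAC.
have Cv : (0 <= C * v k)%R by rewrite ltW// mulr_gt0.
rewrite ser_scale//; last by move=> n; rewrite lee_fin exprn_ge0// ltW.
have -> : (C * (1 - q)^-1 * v k)%:E = (C * v k)%:E * ((1 - q)^-1)%:E.
  by rewrite -EFinM mulrAC.
by rewrite lee_wpmul2l// geometric_ser_le// q1 ltW.
Qed.

Lemma regvar_ser_down c v : regvar c v -> (c < 0)%R -> exists2 C : R, (0 < C)%R &
  forall k, \sum_(n <oo) (if (n <= k)%N then (v n)%:E else 0) <= (C * v k)%:E.
Proof.
move=> hv c0; have [q /andP[q0 q1] [C C0 hC]] := regvar_grow hv c0.
have v0 n : (0 < v n)%R by case: hv.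
exists (C * (1 - q)^-1)%R; first by rewrite mulr_gt0// invr_gt0 subr_gt0.
move=> k; rewrite (@ser_trunc _ (fun n => (v n)%:E)); last first.
  by move=> n; rewrite lee_fin ltW.
rewrite sumEFin lee_fin (reindex_inj rev_ord_inj)/=.
apply: (@le_trans _ _ (\sum_(d < k.+1) (C * v k) * q ^+ d))%R.
  apply: ler_sum => d _; have dk : (d <= k)%N by rewrite -ltnS.
  apply: le_trans (hC _ k _) _; first by rewrite subSS leq_subr.
  by rewrite subSS subKn// mulrAC.
rewrite -mulr_sumr [(C / _ * _)%R]mulrAC ler_pM2l ?mulr_gt0//.
by rewrite geometric_sum_le// q1 ltW.
Qed.

End WeightSeries.

(** * The l_p norms of non-negative extended sequences *)

Section LpSequences.
Local Open Scope ereal_scope.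
Context {R : realType}.
Implicit Types (x y h : nat -> \bar R) (p a : R).

Lemma poweR_mono (s : R) (x y : \bar R) : (0 <= s)%R -> 0 <= x -> x <= y ->
  x `^ s <= y `^ s.
Proof.
move=> s0 x0 xy; apply: gt0_ler_poweR => //; rewrite in_itv/= leey andbT//.
exact: le_trans xy.
Qed.

Lemma poweR_add (s : R) (x y : \bar R) : (0 <= s)%R -> 0 <= x -> 0 <= y ->
  (x + y) `^ s <= (2 `^ s)%:E * (x `^ s + y `^ s).
Proof.
move=> s0; wlog xy : x y / x <= y.
  move=> H x0 y0; case: (leP x y) => [|/ltW] xy; first exact: H.
  by rewrite addeC [in leRHS]addeC; exact: H.
move=> x0 y0; apply: (@le_trans _ _ ((2%:E * y) `^ s)).
  apply: poweR_mono => //; first exact: adde_ge0.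
  by rewrite mule_natl mule2n leeD2r.
rewrite poweRM// poweR_EFin lee_wpmul2l ?lee_fin ?powR_ge0//.
by rewrite leeDr// poweR_ge0.
Qed.

Lemma ser_mulr (f : nat -> \bar R) (X : \bar R) : (forall n, 0 <= f n) -> 0 <= X ->
  \sum_(n <oo) (f n * X) = (\sum_(n <oo) f n) * X.
Proof.
move=> f0; case: X => [r r0|_|//].
  under eq_eseriesr do rewrite muleC.
  by rewrite ser_scale// muleC.
have [f0'|/existsNP[n fn]] := pselect (forall n, f n = 0).
  rewrite eseries0; last by move=> n _ _; rewrite f0' mul0e.
  by rewrite [X in _ = X * _]eseries0 ?mul0e//; move=> n _ _; exact: f0'.
have fn0 : 0 < f n by rewrite lt_def f0 andbT; exact/eqP.
rewrite [RHS]gt0_muley; last exact: lt_le_trans (ser_term n f0).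
apply/eqP; rewrite -leye_eq; apply: le_trans (ser_term n _).
  by rewrite gt0_muley.
by move=> k; rewrite mule_ge0.
Qed.

Definition Lp p x : \bar R := (\sum_(k <oo) x k `^ p) `^ p^-1.

Lemma Lp_ge0 p x : 0 <= Lp p x. Proof. exact: poweR_ge0. Qed.

Lemma Lp_mono p x y : (0 < p)%R -> (forall k, 0 <= x k) -> (forall k, x k <= y k) ->
  Lp p x <= Lp p y.
Proof.
move=> p0 x0 xy; apply: poweR_mono; first by rewrite invr_ge0 ltW.
  by apply: ser_ge0 => k; exact: poweR_ge0.
by apply: le_ser => k; [exact: poweR_ge0|apply: poweR_mono => //; exact: ltW].
Qed.

Lemma Lp_scale p (c : R) x : (0 < p)%R -> (0 <= c)%R -> (forall k, 0 <= x k) ->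
  Lp p (fun k => c%:E * x k) = c%:E * Lp p x.
Proof.
move=> p0 c0 x0; rewrite /Lp.
under eq_eseriesr do rewrite poweRM// poweR_EFin.
rewrite ser_scale ?powR_ge0//; last by move=> n; exact: poweR_ge0.
rewrite poweRM ?lee_fin ?powR_ge0//; last by apply: ser_ge0 => n; exact: poweR_ge0.
by rewrite poweR_EFin -powRrM mulfV ?gt_eqF// powRr1.
Qed.

Lemma poweRK p (x : \bar R) : (0 < p)%R -> 0 <= x -> (x `^ p) `^ p^-1 = x.
Proof. by move=> p0 x0; rewrite -poweRrM mulfV ?gt_eqF// poweRe1. Qed.

Lemma Lp_term p x k : (0 < p)%R -> (forall k, 0 <= x k) -> x k <= Lp p x.
Proof.
move=> p0 x0; rewrite -[leLHS](poweRK p0)//; apply: poweR_mono.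
- by rewrite invr_ge0 ltW.
- exact: poweR_ge0.
- by apply: (ser_term (f := fun k => x k `^ p)) => n; exact: poweR_ge0.
Qed.

(** With [s] the sum, [x k <= s] gives [x k ^ p <= x k * s^(p-1)], and these add up to [s^p].
    Against geometric weights the loss from [l_p] to [l_1] is harmless, so this takes the place of
    Hölder's inequality. *)
Lemma Lp_le_sum p x : (1 <= p)%R -> (forall k, 0 <= x k) ->
  Lp p x <= \sum_(k <oo) x k.
Proof.
move=> p1 x0; have p0 : (0 < p)%R by exact: lt_le_trans p1.
set s := \sum_(k <oo) x k; have s0 : 0 <= s by exact: ser_ge0.
rewrite -[leRHS](poweRK p0)//; apply: poweR_mono.
- by rewrite invr_ge0 ltW.
- by apply: ser_ge0 => n; exact: poweR_ge0.
have p10 : (0 <= p - 1)%R by rewrite subr_ge0.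
have pE (z : \bar R) : 0 <= z -> z `^ p = z * z `^ (p - 1).
  move=> z0; have [->|z_neq0] := eqVneq z 0; first by rewrite poweR0r ?gt_eqF// mul0e.
  rewrite -{2}[z]poweRe1// -poweRD; first by rewrite addrC subrK.
  by apply: nneg_neq0_poweRD_def.
apply: (@le_trans _ _ (\sum_(k <oo) (x k * s `^ (p - 1)))).
  apply: le_ser => k; first exact: poweR_ge0.
  by rewrite pE// lee_wpmul2l// poweR_mono// ser_term.
by rewrite ser_mulr ?poweR_ge0// -pE.
Qed.

(** A quasi-triangle inequality with a crude constant is enough, all norms being compared up to
    equivalence. *)
Lemma Lp_add p x y : (0 < p)%R -> (forall k, 0 <= x k) -> (forall k, 0 <= y k) ->
  Lp p (fun k => x k + y k) <= (2 * 2 `^ p^-1)%:E * (Lp p x + Lp p y).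
Proof.
move=> p0 x0 y0; have pi0 : (0 <= p^-1)%R by rewrite invr_ge0 ltW.
have sx z : 0 <= \sum_(k <oo) (z k : \bar R) `^ p.
  by apply: ser_ge0 => k; exact: poweR_ge0.
apply: (@le_trans _ _ (((2 `^ p)%:E *
    (\sum_(k <oo) x k `^ p + \sum_(k <oo) y k `^ p)) `^ p^-1)).
  apply: poweR_mono => //.
  rewrite -ser_add; [|by move=> n; exact: poweR_ge0..].
  rewrite -ser_scale ?powR_ge0//; last by move=> n; rewrite adde_ge0 ?poweR_ge0.
  apply: le_ser => n; first exact: poweR_ge0.
  by apply: poweR_add => //; exact: ltW.
rewrite poweRM ?adde_ge0 ?lee_fin ?powR_ge0//.
rewrite poweR_EFin -powRrM mulfV ?gt_eqF// powRr1// EFinM -muleA.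
by rewrite lee_wpmul2l// poweR_add.
Qed.

Lemma Lp_shift p x : (0 < p)%R -> (forall k, 0 <= x k) ->
  Lp p (fun k => x k.+1) <= Lp p x.
Proof.
move=> p0 x0; apply: poweR_mono; first by rewrite invr_ge0 ltW.
  by apply: ser_ge0 => n; exact: poweR_ge0.
have F0 n : 0 <= x n `^ p by exact: poweR_ge0.
rewrite [leRHS](nneseries_split 0 1); last by move=> k _; exact: F0.
rewrite add0n -(nneseries_addn 1 F0).
apply: (@le_trans _ _ (\sum_(i <oo) x (i + 1)%N `^ p)).
  by apply: le_ser => // n; rewrite addn1.
by rewrite leeDr// sume_ge0.
Qed.

End LpSequences.

(** * The Holmstedt type formula for sequences *)

Section Functionals.
Local Open Scope ereal_scope.
Context {R : realType}.
Implicit Types (x y h : nat -> \bar R) (p a : R).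

(* For [h k = f*(e^-(k+1))], [Gf] and [Gm] discretise the [L_p(ds/s)] norms of
   [s^(1/p) f*(s)] over [(0, e^-k)] and over the cells [n, ..., k], and [Sf] is
   the small Lebesgue norm of [f] when [a = alpha/p']. *)
Definition Gf p h k : \bar R :=
  Lp p (fun j => if (k <= j)%N then (ew p^-1 j)%:E * h j else 0).
Definition Gm p h n k : \bar R :=
  Lp p (fun j => if (n <= j <= k)%N then (ew p^-1 j)%:E * h j else 0).
Definition Sf a p h : \bar R := \sum_(n <oo) ((wt (a - 1) n)%:E * Gf p h n).
Definition Pf a p h k : \bar R :=
  \sum_(n <oo) (if (k <= n)%N then (wt (a - 1) n)%:E * Gf p h n else 0).
Definition Qf a p h k : \bar R := (wt a k)%:E * Gf p h k.
Definition Rf a p h k : \bar R :=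
  \sum_(n <oo) (if (n <= k)%N then (wt (a - 1) n)%:E * Gm p h n k else 0).

Lemma wtE_ge0 a n : 0 <= (wt a n)%:E :> \bar R.
Proof. by rewrite lee_fin ltW// wt_gt0. Qed.

Lemma ewE_ge0 a n : 0 <= (ew a n)%:E :> \bar R.
Proof. by rewrite lee_fin ltW// ew_gt0. Qed.

Lemma mask_ge0 (b : bool) (x : \bar R) : 0 <= x -> 0 <= (if b then x else 0).
Proof. by case: b. Qed.

Lemma Gf_ge0 p h k : 0 <= Gf p h k. Proof. exact: Lp_ge0. Qed.
Lemma Gm_ge0 p h n k : 0 <= Gm p h n k. Proof. exact: Lp_ge0. Qed.

Lemma wGf_ge0 a p h n k : 0 <= (wt a n)%:E * Gf p h k.
Proof. by rewrite mule_ge0 ?wtE_ge0 ?Gf_ge0. Qed.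

Lemma wGm_ge0 a p h n i k : 0 <= (wt a n)%:E * Gm p h i k.
Proof. by rewrite mule_ge0 ?wtE_ge0 ?Gm_ge0. Qed.

Lemma Sf_ge0 a p h : 0 <= Sf a p h.
Proof. by apply: ser_ge0 => n; exact: wGf_ge0. Qed.
Lemma Pf_ge0 a p h k : 0 <= Pf a p h k.
Proof. by apply: ser_ge0 => n; apply: mask_ge0; exact: wGf_ge0. Qed.
Lemma Qf_ge0 a p h k : 0 <= Qf a p h k. Proof. exact: wGf_ge0. Qed.
Lemma Rf_ge0 a p h k : 0 <= Rf a p h k.
Proof. by apply: ser_ge0 => n; apply: mask_ge0; exact: wGm_ge0. Qed.

Lemma eh_ge0 p h j : 0 <= h j -> 0 <= (ew p^-1 j)%:E * h j.
Proof. by move=> h0; rewrite mule_ge0// ewE_ge0. Qed.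

Section Fixed.
Variables (p : R) (h : nat -> \bar R).
Hypotheses (p0 : (0 < p)%R) (h0 : forall n, 0 <= h n).

Let mh0 (b : bool) j : 0 <= (if b then (ew p^-1 j)%:E * h j else 0).
Proof. by apply: mask_ge0; exact: eh_ge0. Qed.

Lemma Gf_decr k n : (k <= n)%N -> Gf p h n <= Gf p h k.
Proof.
move=> kn; apply: Lp_mono => // j.
by case: leqP => [nj|_]; [rewrite (leq_trans kn nj)|exact: mh0].
Qed.

Lemma Gm_le_Gf n k : Gm p h n k <= Gf p h n.
Proof.
apply: Lp_mono => // j.
by case: (leqP n j) => //= _; case: ifP => // _; exact: eh_ge0.
Qed.

Lemma Gf_term k j : (k <= j)%N -> (ew p^-1 j)%:E * h j <= Gf p h k.
Proof.
move=> kj; apply: (le_trans _ (Lp_term j p0 _)) => [|i]; last exact: mh0.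
by rewrite kj.
Qed.

Lemma Gm_term n k : (n <= k)%N -> (ew p^-1 k)%:E * h k <= Gm p h n k.
Proof.
move=> nk; apply: (le_trans _ (Lp_term k p0 _)) => [|i]; last exact: mh0.
by rewrite nk leqnn.
Qed.

Lemma Gf_le_sum k : (1 <= p)%R ->
  Gf p h k <= \sum_(j <oo) (if (k <= j)%N then (ew p^-1 j)%:E * h j else 0).
Proof. by move=> p1; apply: Lp_le_sum => // j; exact: mh0. Qed.

Lemma Gm_le_sum n k : (1 <= p)%R ->
  Gm p h n k <= \sum_(j <oo) (if (j <= k)%N then (ew p^-1 j)%:E * h j else 0).
Proof.
move=> p1; apply: le_trans (Lp_le_sum p1 _) _ => [j|]; first exact: mh0.
apply: le_ser => j; first exact: mh0.
by case: (leqP n j) => //= _; exact: mh0.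
Qed.

Lemma Gf_shift k : Gf p (fun j => h j.+1) k <= (expR p^-1)%:E * Gf p h k.
Proof.
rewrite -Lp_scale ?expR_ge0//.
apply: (@le_trans _ _ (Lp p (fun j => (expR p^-1)%:E *
   (if (k <= j.+1)%N then (ew p^-1 j.+1)%:E * h j.+1 else 0)))).
  apply: Lp_mono => // j; first by apply: mask_ge0; rewrite mule_ge0 ?ewE_ge0.
  case: leqP => [kj|_]; last by rewrite mule_ge0 ?lee_fin ?expR_ge0//; exact: mh0.
  by rewrite leqW// muleA -EFinM -ewS.
apply: (Lp_shift (x := fun j => (expR p^-1)%:E *
   (if (k <= j)%N then (ew p^-1 j)%:E * h j else 0))) => // j.
by rewrite mule_ge0 ?lee_fin ?expR_ge0.
Qed.

End Fixed.

Lemma Gf_add p : (0 < p)%R -> exists2 C : R, (0 < C)%R & forall x y k,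
  (forall n, 0 <= x n) -> (forall n, 0 <= y n) ->
  Gf p (fun j => x j + y j) k <= C%:E * (Gf p x k + Gf p y k).
Proof.
move=> p0; exists (2 * 2 `^ p^-1)%R; first by rewrite mulr_gt0// powR_gt0.
move=> x y k x0 y0; apply: le_trans (Lp_add p0 _ _); last 2 first.
- by move=> j; apply: mask_ge0; exact: eh_ge0.
- by move=> j; apply: mask_ge0; exact: eh_ge0.
apply: Lp_mono => // j.
  by apply: mask_ge0; rewrite mule_ge0 ?ewE_ge0 ?adde_ge0.
by case: ifP => _; rewrite ?adde0// ge0_muleDr.
Qed.

Lemma Gm_add p : (0 < p)%R -> exists2 C : R, (0 < C)%R & forall x y n k,
  (forall n, 0 <= x n) -> (forall n, 0 <= y n) ->
  Gm p (fun j => x j + y j) n k <= C%:E * (Gm p x n k + Gm p y n k).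
Proof.
move=> p0; exists (2 * 2 `^ p^-1)%R; first by rewrite mulr_gt0// powR_gt0.
move=> x y n k x0 y0; apply: le_trans (Lp_add p0 _ _); last 2 first.
- by move=> j; apply: mask_ge0; exact: eh_ge0.
- by move=> j; apply: mask_ge0; exact: eh_ge0.
apply: Lp_mono => // j.
  by apply: mask_ge0; rewrite mule_ge0 ?ewE_ge0 ?adde_ge0.
by case: ifP => _; rewrite ?adde0// ge0_muleDr.
Qed.

(** [Gf] is non-increasing in its index, so the first [k+1] terms of [Sf] together dominate
    [(1+k)^a G_k]. *)
Lemma Qf_le_Sf a p : (0 < a)%R -> (0 < p)%R -> exists2 C : R, (0 < C)%R &
  forall h k, (forall n, 0 <= h n) -> Qf a p h k <= C%:E * Sf a p h.
Proof.
move=> a0 p0; have [C C0 hC] := @wt_ser_ge R a a0; exists C => // h k h0.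
apply: (@le_trans _ _ (C%:E * ((\sum_(n <oo) (if (n <= k)%N then (wt (a - 1) n)%:E else 0)) * Gf p h k))).
  by rewrite muleA lee_wpmul2r ?Gf_ge0.
rewrite lee_wpmul2l ?lee_fin ?(ltW C0)// -ser_mulr ?Gf_ge0//; last first.
  by move=> n; apply: mask_ge0; exact: wtE_ge0.
apply: le_ser => n; first by rewrite mule_ge0 ?Gf_ge0//; apply: mask_ge0; exact: wtE_ge0.
case: leqP => nk; last by rewrite mul0e wGf_ge0.
by rewrite lee_wpmul2l ?wtE_ge0// Gf_decr.
Qed.

Lemma Rf_le_sum a p : (0 < a)%R -> (1 <= p)%R -> exists2 C : R, (0 < C)%R &
  forall h k, (forall n, 0 <= h n) -> Rf a p h k <=
    (C * wt a k)%:E * \sum_(j <oo) (if (j <= k)%N then (ew p^-1 j)%:E * h j else 0).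
Proof.
move=> a0 p1; have p0 : (0 < p)%R by exact: lt_le_trans p1.
have [C C0 hC] := @wt_ser_le R a a0; exists C => // h k h0.
set X := \sum_(j <oo) _; have X0 : 0 <= X.
  by apply: ser_ge0 => n; apply: mask_ge0; exact: eh_ge0.
apply: le_trans (lee_wpmul2r X0 (hC k)).
rewrite -ser_mulr//; last by move=> n; apply: mask_ge0; exact: wtE_ge0.
apply: le_ser => n; first by apply: mask_ge0; exact: wGm_ge0.
case: leqP => nk; last by rewrite mul0e.
by rewrite lee_wpmul2l ?wtE_ge0// Gm_le_sum.
Qed.

(** Each [Gm p h n k] with [n <= k] contains the entry [j = k], and the weights up to [k] sum to
    about [(1+k)^a]. *)
Lemma Rf_ge_term a p : (0 < a)%R -> (0 < p)%R -> exists2 C : R, (0 < C)%R &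
  forall h k, (forall n, 0 <= h n) ->
    (wt a k)%:E * ((ew p^-1 k)%:E * h k) <= C%:E * Rf a p h k.
Proof.
move=> a0 p0; have [C C0 hC] := @wt_ser_ge R a a0; exists C => // h k h0.
have X0 : 0 <= (ew p^-1 k)%:E * h k by exact: eh_ge0.
apply: le_trans (lee_wpmul2r X0 (hC k)) _.
rewrite -muleA lee_wpmul2l ?lee_fin ?(ltW C0)// -ser_mulr//; last first.
  by move=> n; apply: mask_ge0; exact: wtE_ge0.
apply: le_ser => n; first by rewrite mule_ge0//; apply: mask_ge0; exact: wtE_ge0.
case: leqP => nk; last by rewrite mul0e.
by rewrite lee_wpmul2l ?wtE_ge0// Gm_term.
Qed.

Lemma Sf_shift a p h : (0 < p)%R -> (forall n, 0 <= h n) ->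
  Sf a p (fun j => h j.+1) <= (expR p^-1)%:E * Sf a p h.
Proof.
move=> p0 h0; rewrite -ser_scale ?expR_ge0//; last by move=> n; exact: wGf_ge0.
apply: le_ser => n; first exact: wGf_ge0.
by rewrite muleCA lee_wpmul2l ?wtE_ge0// Gf_shift.
Qed.

End Functionals.

Section Constants.
Local Open Scope ereal_scope.
Context {R : realType}.
Implicit Types (C D : R) (a b c : \bar R).

Lemma lec_trans C D a b c : (0 <= C)%R -> a <= C%:E * b -> b <= D%:E * c ->
  a <= (C * D)%:E * c.
Proof.
move=> C0 ab bc; apply: le_trans ab _; rewrite EFinM -muleA.
by rewrite lee_wpmul2l.
Qed.

Lemma lec_add C D a b c : (0 <= C)%R -> (0 <= D)%R ->
  a <= C%:E * c -> b <= D%:E * c -> a + b <= (C + D)%:E * c.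
Proof. by move=> C0 D0 ac bc; rewrite EFinD ge0_muleDl// leeD. Qed.

Lemma lec_add2 C a b c d : (0 <= C)%R -> 0 <= c -> 0 <= d ->
  a <= C%:E * c -> b <= C%:E * d -> a + b <= C%:E * (c + d).
Proof. by move=> C0 c0 d0 ac bd; rewrite ge0_muleDr// leeD. Qed.

Lemma lec_weak C D a c : 0 <= c -> (C <= D)%R -> a <= C%:E * c -> a <= D%:E * c.
Proof. by move=> c0 CD /le_trans; apply; rewrite lee_wpmul2r// lee_fin. Qed.

End Constants.

(** * The sequence functional Phi against decompositions *)

Section Couple.
Local Open Scope ereal_scope.
Context {R : realType}.
Implicit Types (x y h : nat -> \bar R).
Variables p0 p1 a0 a1 : R.
Hypotheses (hp0 : (1 < p0)%R) (hp01 : (p0 < p1)%R) (ha0 : (0 < a0)%R) (ha1 : (0 < a1)%R).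

Definition gap : R := (p0^-1 - p1^-1)%R.

(* [rho(e^-n)]. *)
Definition rw (n : nat) : R := (ew gap n * wt (a0 - a1) n)%R.

Definition Phi h k : \bar R :=
  Pf a0 p0 h k + Qf a0 p0 h k + (rw k)%:E * Rf a1 p1 h k.

Let p0_gt0 : (0 < p0)%R. Proof. exact: lt_trans hp0. Qed.
Let p1_gt1 : (1 < p1)%R. Proof. exact: lt_trans hp01. Qed.
Let p1_gt0 : (0 < p1)%R. Proof. exact: lt_trans p1_gt1. Qed.
Let p0_ge1 : (1 <= p0)%R. Proof. exact: ltW. Qed.
Let p1_ge1 : (1 <= p1)%R. Proof. exact: ltW. Qed.

Lemma gap_gt0 : (0 < gap)%R.
Proof. by rewrite subr_gt0 ltf_pV2 ?posrE. Qed.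

Lemma rw_gt0 n : (0 < rw n)%R.
Proof. by rewrite mulr_gt0// ?ew_gt0 ?wt_gt0. Qed.

Let rwE_ge0 n : 0 <= (rw n)%:E :> \bar R.
Proof. by rewrite lee_fin ltW// rw_gt0. Qed.

Lemma regvar_rw : regvar gap rw. Proof. exact: regvar_ewwt. Qed.

Lemma ew_gap n : ew p0^-1 n = (ew gap n * ew p1^-1 n)%R.
Proof. by rewrite -ewD /gap subrK. Qed.

(** The balance identity behind the choice of [rho]: multiplied by [e^(-n/p1)], it equates [r_n]
    times the weight of the second space with the weight of the first. *)
Lemma rw_wt n : (rw n * wt a1 n = ew gap n * wt a0 n)%R.
Proof. by rewrite /rw -mulrA -wtD subrK. Qed.

(** Replace [l_p1] by [l_1] and use [e^(-j/p0) h_j <= G_j <= D (1+j)^(-a0) Sf]. What remains is a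
    sum of [v j = e^(gap j) (1+j)^(-a0)] over [j <= k], of the order of its last term, and [v k] is
    the inverse of [r_k (1+k)^a1]. *)
Let Rf_le_Sf0 : exists2 C : R, (0 < C)%R & forall h k, (forall n, 0 <= h n) ->
  (rw k)%:E * Rf a1 p1 h k <= C%:E * Sf a0 p0 h.
Proof.
have [C C0 hC] := @Rf_le_sum R a1 p1 ha1 p1_ge1.
have [D D0 hD] := @Qf_le_Sf R a0 p0 ha0 p0_gt0.
have c0 : (- gap < 0)%R by rewrite oppr_lt0 gap_gt0.
have [F F0 hF] := regvar_ser_down (regvar_ewwt (- gap) (- a0)) c0.
exists (C * F * D)%R; first by rewrite !mulr_gt0.
move=> h k h0; pose v n := (ew (- gap) n * wt (- a0) n)%R.
have v0 n : 0 <= (v n)%:E by rewrite lee_fin ltW// mulr_gt0// ?ew_gt0 ?wt_gt0.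
have S0 : 0 <= D%:E * Sf a0 p0 h by rewrite mule_ge0 ?Sf_ge0// lee_fin ltW.
have hsum : \sum_(j <oo) (if (j <= k)%N then (ew p1^-1 j)%:E * h j else 0) <=
    (F * v k)%:E * (D%:E * Sf a0 p0 h).
  apply: le_trans (lee_wpmul2r S0 (hF k)).
  rewrite -ser_mulr//; last by move=> n; apply: mask_ge0; exact: v0.
  apply: le_ser => j; first by apply: mask_ge0; rewrite mule_ge0// ewE_ge0.
  case: leqP => jk; last by rewrite mul0e.
  apply: (@le_trans _ _ ((v j)%:E * Qf a0 p0 h j)); last first.
    by rewrite lee_wpmul2l// hD.
  rewrite /Qf muleA -EFinM /v -mulrA -wtD addNr wt0 mulr1.
  have -> : ew p1^-1 j = (ew (- gap) j * ew p0^-1 j)%R.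
    by rewrite ew_gap mulrA -ewD addNr ew0 mul1r.
  by rewrite EFinM -muleA lee_wpmul2l ?ewE_ge0// Gf_term.
apply: le_trans (lee_wpmul2l (rwE_ge0 k) (hC h k h0)) _.
have Cw : 0 <= (C * wt a1 k)%:E by rewrite lee_fin ltW// mulr_gt0// wt_gt0.
apply: le_trans (lee_wpmul2l (rwE_ge0 k) (lee_wpmul2l Cw hsum)) _.
rewrite !muleA -!EFinM.
rewrite (_ : (rw k * (C * wt a1 k) * (F * v k) * D = C * F * D)%R)//.
have vE : (rw k * wt a1 k * v k = 1)%R.
  rewrite rw_wt /v mulrACA -ewD -wtD !subrr ew0 wt0 mulr1//.
rewrite (_ : (_ * _ = (C * F * D) * (rw k * wt a1 k * v k))%R); last by ring.
by rewrite vE mulr1.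
Qed.

(** With [Phi_le_S1], this is the counterpart for [Phi] of [K(t, f) <= |f|_0] and
    [K(t, f) <= t |f|_1]. Together with [Phi_add] they bound [Phi] by the cost of any
    decomposition. *)
Lemma Phi_le_S0 : exists2 C : R, (0 < C)%R & forall h k, (forall n, 0 <= h n) ->
  Phi h k <= C%:E * Sf a0 p0 h.
Proof.
have [C C0 hC] := Rf_le_Sf0; have [D D0 hD] := @Qf_le_Sf R a0 p0 ha0 p0_gt0.
exists (1 + D + C)%R; first by rewrite !addr_gt0.
move=> h k h0; rewrite /Phi.
apply: lec_add; [by rewrite addr_ge0 ?ltW|exact: ltW| |exact: hC].
apply: lec_add; [exact: ler01|exact: ltW| |exact: hD].
rewrite mul1e; apply: le_ser => n; first by apply: mask_ge0; exact: wGf_ge0.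
by case: ifP => // _; exact: wGf_ge0.
Qed.

(** After [l_p0 <= l_1], write [e^(-j/p0) = e^(-gap j) e^(-j/p1)]: the second factor times [h_j] is
    at most the [l_p1] tail, and the first sums geometrically. *)
Let Gf_gap_le : exists2 C : R, (0 < C)%R & forall h k, (forall n, 0 <= h n) ->
  Gf p0 h k <= (C * ew gap k)%:E * Gf p1 h k.
Proof.
have [C C0 hC] := regvar_ser_up (regvar_ew gap) gap_gt0.
exists C => // h k h0.
apply: le_trans (Gf_le_sum h0 _ p0_ge1) _.
apply: le_trans (lee_wpmul2r (Gf_ge0 _ _ _) (hC k)).
rewrite -ser_mulr ?Gf_ge0//; last by move=> n; apply: mask_ge0; exact: ewE_ge0.
apply: le_ser => j; first by apply: mask_ge0; rewrite mule_ge0// ewE_ge0.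
case: leqP => kj; last by rewrite mul0e.
by rewrite ew_gap EFinM -muleA lee_wpmul2l ?ewE_ge0// Gf_term.
Qed.

Let Qf_gap_le_Sf1 : exists2 C : R, (0 < C)%R & forall h k, (forall n, 0 <= h n) ->
  (wt a0 k * ew gap k)%:E * Gf p1 h k <= (C * rw k)%:E * Sf a1 p1 h.
Proof.
have [C C0 hC] := @Qf_le_Sf R a1 p1 ha1 p1_gt0.
exists C => // h k h0.
have := lee_wpmul2l (rwE_ge0 k) (hC h k h0).
by rewrite /Qf !muleA -!EFinM rw_wt mulrC (mulrC C).
Qed.

(** Passing from [l_p0] to [l_p1] tails gains [e^(-gap k)], and
    [e^(-gap k) (1+k)^a0 = r_k (1+k)^a1], so [P] and [Q] are controlled by [r_k] times a [Q] term of
    the second space. For [R] it suffices that [Gm <= Gf]. *)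
Lemma Phi_le_S1 : exists2 C : R, (0 < C)%R & forall h k, (forall n, 0 <= h n) ->
  Phi h k <= C%:E * ((rw k)%:E * Sf a1 p1 h).
Proof.
have [C C0 hC] := Qf_gap_le_Sf1; have [D D0 hD] := Gf_gap_le.
have [F F0 hF] := regvar_ser_up (regvar_ewwt gap (a0 - 1)) gap_gt0.
exists (D * F * C + D * C + 1)%R; first by rewrite !addr_gt0// !mulr_gt0.
move=> h k h0; rewrite /Phi.
have DC0 : (0 <= D * C)%R by rewrite mulr_ge0// ltW.
have DFC0 : (0 <= D * F * C)%R by rewrite !mulr_ge0// ltW.
have hCk : (wt a0 k * ew gap k)%:E * Gf p1 h k <= C%:E * ((rw k)%:E * Sf a1 p1 h).
  by rewrite muleA -EFinM; exact: hC.
apply: lec_add => //; first by rewrite addr_ge0.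
  apply: lec_add => //.
    apply: (lec_trans _ _ hCk); first by rewrite mulr_ge0 ?ltW.
    apply: (@le_trans _ _ ((D%:E * Gf p1 h k) *
        (F * (ew gap k * wt (a0 - 1) k))%:E)); last first.
      rewrite (EFinM D F) (EFinM F) -!muleA [X in D%:E * X <= _]muleCA.
      rewrite !lee_wpmul2l ?lee_fin ?(ltW D0) ?(ltW F0)// muleC.
      rewrite lee_wpmul2r ?Gf_ge0// lee_fin mulrC ler_wpM2r ?(ltW (ew_gt0 _ _))//.
      by apply: wt_le; rewrite gerBl.
    rewrite muleC; apply: le_trans (lee_wpmul2r _ (hF k)); last first.
      by rewrite mule_ge0 ?Gf_ge0// lee_fin ltW.
    rewrite -ser_mulr; last 2 first.
    - by move=> n; apply: mask_ge0; rewrite lee_fin mulr_ge0 ?(ltW (ew_gt0 _ _)) ?(ltW (wt_gt0 _ _)).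
    - by rewrite mule_ge0 ?Gf_ge0// lee_fin ltW.
    apply: le_ser => n; first by apply: mask_ge0; exact: wGf_ge0.
    case: leqP => kn; last by rewrite mul0e.
    rewrite mulrC EFinM -muleA lee_wpmul2l ?wtE_ge0//.
    apply: le_trans (hD h n h0) _.
    rewrite mulrC EFinM -muleA lee_wpmul2l ?ewE_ge0//.
    by rewrite lee_wpmul2l ?lee_fin ?(ltW D0)// Gf_decr.
  apply: (lec_trans _ _ hCk); first exact: ltW.
  rewrite /Qf EFinM -!muleA [leRHS]muleCA lee_wpmul2l ?wtE_ge0//.
  by rewrite muleA -EFinM; exact: hD.
rewrite mul1e lee_wpmul2l//; apply: le_ser => n.
  by apply: mask_ge0; exact: wGm_ge0.
case: leqP => nk; last exact: wGf_ge0.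
by rewrite lee_wpmul2l ?wtE_ge0// Gm_le_Gf.
Qed.

Lemma Gf_mono p x y k : (0 < p)%R -> (forall n, 0 <= x n) -> (forall n, x n <= y n) ->
  Gf p x k <= Gf p y k.
Proof.
move=> p00 x0 xy; apply: Lp_mono => // j.
  by apply: mask_ge0; rewrite mule_ge0// ewE_ge0.
by case: ifP => // _; rewrite lee_wpmul2l ?ewE_ge0.
Qed.

Lemma Gm_mono p x y n k : (0 < p)%R -> (forall n, 0 <= x n) -> (forall n, x n <= y n) ->
  Gm p x n k <= Gm p y n k.
Proof.
move=> p00 x0 xy; apply: Lp_mono => // j.
  by apply: mask_ge0; rewrite mule_ge0// ewE_ge0.
by case: ifP => // _; rewrite lee_wpmul2l ?ewE_ge0.
Qed.

Lemma Phi_ge0 h k : 0 <= Phi h k.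
Proof. by rewrite !adde_ge0 ?Pf_ge0 ?Qf_ge0// mule_ge0 ?Rf_ge0. Qed.

Lemma Phi_mono x y k : (forall n, 0 <= x n) -> (forall n, x n <= y n) ->
  Phi x k <= Phi y k.
Proof.
move=> x0 xy; apply: leeD; first apply: leeD.
- apply: le_ser => n; first by apply: mask_ge0; exact: wGf_ge0.
  by case: ifP => // _; rewrite lee_wpmul2l ?wtE_ge0// Gf_mono.
- by rewrite lee_wpmul2l ?wtE_ge0// Gf_mono.
- rewrite lee_wpmul2l//; apply: le_ser => n; first by apply: mask_ge0; exact: wGm_ge0.
  by case: ifP => // _; rewrite lee_wpmul2l ?wtE_ge0// Gm_mono.
Qed.

Lemma Phi_add : exists2 C : R, (0 < C)%R & forall x y k,
  (forall n, 0 <= x n) -> (forall n, 0 <= y n) ->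
  Phi (fun j => x j + y j) k <= C%:E * (Phi x k + Phi y k).
Proof.
have [C C0 hC] := @Gf_add R p0 p0_gt0; have [D D0 hD] := @Gm_add R p1 p1_gt0.
exists (C + D)%R; first by rewrite addr_gt0.
move=> x y k x0 y0.
have CD0 : (0 <= C + D)%R by rewrite addr_ge0 ?ltW.
have hG n : Gf p0 (fun j => x j + y j) n <= (C + D)%:E * (Gf p0 x n + Gf p0 y n).
  by apply: lec_weak (hC _ _ _ x0 y0); [rewrite adde_ge0 ?Gf_ge0|rewrite lerDl ltW].
have hM n : Gm p1 (fun j => x j + y j) n k <= (C + D)%:E * (Gm p1 x n k + Gm p1 y n k).
  by apply: lec_weak (hD _ _ _ _ x0 y0); [rewrite adde_ge0 ?Gm_ge0|rewrite lerDr ltW].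
have wG (w : R) n : (0 <= w)%R -> w%:E * Gf p0 (fun j => x j + y j) n <=
    (C + D)%:E * (w%:E * Gf p0 x n + w%:E * Gf p0 y n).
  move=> w0; apply: le_trans (lee_wpmul2l _ (hG n)) _ => //.
  by rewrite -ge0_muleDr ?Gf_ge0// muleCA.
have wM (w : R) n : (0 <= w)%R -> w%:E * Gm p1 (fun j => x j + y j) n k <=
    (C + D)%:E * (w%:E * Gm p1 x n k + w%:E * Gm p1 y n k).
  move=> w0; apply: le_trans (lee_wpmul2l _ (hM n)) _ => //.
  by rewrite -ge0_muleDr ?Gm_ge0// muleCA.
have w0 a n : (0 <= wt a n)%R by rewrite ltW// wt_gt0.
have -> : Phi x k + Phi y k = (Pf a0 p0 x k + Pf a0 p0 y k) + (Qf a0 p0 x k + Qf a0 p0 y k)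
    + ((rw k)%:E * Rf a1 p1 x k + (rw k)%:E * Rf a1 p1 y k).
  by rewrite /Phi addeACA; congr (_ + _); rewrite addeACA.
have PP z : 0 <= Pf a0 p0 z k by exact: Pf_ge0.
have QQ z : 0 <= Qf a0 p0 z k by exact: Qf_ge0.
have RR z : 0 <= Rf a1 p1 z k by exact: Rf_ge0.
have rRR z : 0 <= (rw k)%:E * Rf a1 p1 z k by rewrite mule_ge0.
apply: lec_add2; rewrite ?adde_ge0//; first apply: lec_add2; rewrite ?adde_ge0//.
- rewrite -ser_add; [|by move=> n; apply: mask_ge0; exact: wGf_ge0..].
  rewrite -ser_scale//; last by move=> n; rewrite adde_ge0//; apply: mask_ge0; exact: wGf_ge0.
  apply: le_ser => n; first by apply: mask_ge0; exact: wGf_ge0.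
  by case: ifP => _; [exact: wG|rewrite adde0 mule0].
- exact: wG.
rewrite -ge0_muleDr// muleCA lee_wpmul2l//.
rewrite -ser_add; [|by move=> n; apply: mask_ge0; exact: wGm_ge0..].
rewrite -ser_scale//; last by move=> n; rewrite adde_ge0//; apply: mask_ge0; exact: wGm_ge0.
apply: le_ser => n; first by apply: mask_ge0; exact: wGm_ge0.
by case: ifP => _; [exact: wM|rewrite adde0 mule0].
Qed.

(* The shifted index comes from [f*(s + t) <= f0*(s) + f1*(t)] and [2 <= e]. *)
Lemma Phi_le_decomposition : exists2 C : R, (0 < C)%R & forall h x y k,
  (forall n, 0 <= h n) -> (forall n, 0 <= x n) -> (forall n, 0 <= y n) ->
  (forall j, h j <= x j.+1 + y j.+1) ->
  Phi h k <= C%:E * (Sf a0 p0 x + (rw k)%:E * Sf a1 p1 y).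
Proof.
have [A A0 hA] := Phi_add; have [C C0 hC] := Phi_le_S0; have [D D0 hD] := Phi_le_S1.
pose e0 : R := expR p0^-1; pose e1 : R := expR p1^-1.
have e00 : (0 < e0)%R by exact: expR_gt0.
have e10 : (0 < e1)%R by exact: expR_gt0.
exists (A * (C * e0 + D * e1))%R; first by rewrite mulr_gt0// addr_gt0// mulr_gt0.
move=> h x y k h0 x0 y0 hxy.
apply: le_trans (Phi_mono _ h0 hxy) _.
apply: (lec_trans (ltW A0) (hA _ _ _ _ _)) => //.
have Ce0 : (0 < C * e0)%R by rewrite mulr_gt0.
have De0 : (0 < D * e1)%R by rewrite mulr_gt0.
apply: lec_add2; rewrite ?Sf_ge0 ?addr_ge0 ?(ltW Ce0) ?(ltW De0)//.
- by rewrite mule_ge0 ?Sf_ge0.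
- apply: (@lec_weak _ (C * e0)); rewrite ?Sf_ge0 ?lerDl ?(ltW De0)//.
  by apply: (lec_trans (ltW C0) (hC _ _ _)) => //; exact: Sf_shift.
- apply: (@lec_weak _ (D * e1)); rewrite ?mule_ge0 ?Sf_ge0 ?lerDr ?(ltW Ce0)//.
  apply: (lec_trans (ltW D0) (hD _ _ _)) => //.
  by rewrite muleCA lee_wpmul2l// Sf_shift.
Qed.

(** Here [x] and [y] are the parts of [h] above and below the height [h k]. As [x] lives on
    [j >= k], its norm splits into [P] for [n > k] and, for [n <= k], weights times the fixed tail
    [G_k], that is [Q]. The sequence [y] is at most [h] up to [k], which gives [R], and at most the
    constant [h k] afterwards. *)
Lemma decomposition_le_Phi : exists2 C : R, (0 < C)%R & forall h x y k,
  (forall n, 0 <= h n) -> (forall n, 0 <= x n) -> (forall n, 0 <= y n) ->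
  (forall j, x j <= if (k <= j)%N then h j else 0) ->
  (forall j, y j <= h j) -> (forall j, y j <= h k) ->
  Sf a0 p0 x + (rw k)%:E * Sf a1 p1 y <= C%:E * Phi h k.
Proof.
have [A A0 hA] := @Gf_add R p1 p1_gt0.
have [B B0 hB] := @wt_ser_le R a0 ha0.
have [B' B'0 hB'] := @wt_ser_le R a1 ha1.
have ip1 : (0 < p1^-1)%R by rewrite invr_gt0.
have [D D0 hD] := regvar_ser_up (regvar_ew p1^-1) ip1.
have [F F0 hF] := regvar_ser_up (regvar_ewwt p1^-1 (a1 - 1)) ip1.
exists ((1 + B) + (A + A * D * B' + D * F))%R; first by rewrite !addr_gt0// !mulr_gt0.
move=> h x y k h0 x0 y0 hx hyj hyk.
have eh0 j : 0 <= (ew p1^-1 j)%:E * h j by rewrite mule_ge0// ewE_ge0.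
have P0 := Pf_ge0 a0 p0 h k; have Q0 := Qf_ge0 a0 p0 h k; have R0 := Rf_ge0 a1 p1 h k.
have rR0 : 0 <= (rw k)%:E * Rf a1 p1 h k by rewrite mule_ge0.
have xh j : x j <= h j by apply: (le_trans (hx j)); case: ifP.
have hPhi0 := Phi_ge0 h k.
apply: lec_add; rewrite ?addr_ge0 ?mulr_ge0 ?(ltW A0) ?(ltW B0) ?(ltW B'0) ?(ltW D0) ?(ltW F0)//.
  apply: (@le_trans _ _ (Pf a0 p0 h k + B%:E * Qf a0 p0 h k)).
    have -> : B%:E * Qf a0 p0 h k = (B * wt a0 k)%:E * Gf p0 h k by rewrite /Qf muleA.
    apply: le_trans (leeD2l _ (lee_wpmul2r (Gf_ge0 _ _ _) (hB k))).
    rewrite -ser_mulr ?Gf_ge0//; last by move=> n; apply: mask_ge0; exact: wtE_ge0.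
    rewrite -ser_add; last 2 first.
    - by move=> n; apply: mask_ge0; exact: wGf_ge0.
    - by move=> n; rewrite mule_ge0 ?Gf_ge0//; apply: mask_ge0; exact: wtE_ge0.
    apply: le_ser => n; first exact: wGf_ge0.
    case: (leqP n k) => nk; last first.
      by rewrite (ltnW nk) mul0e adde0 lee_wpmul2l ?wtE_ge0// Gf_mono.
    have : (wt (a0 - 1) n)%:E * Gf p0 x n <= (wt (a0 - 1) n)%:E * Gf p0 h k.
      rewrite lee_wpmul2l ?wtE_ge0//; apply: Lp_mono => // j.
        by apply: mask_ge0; rewrite mule_ge0// ewE_ge0.
      case: (leqP n j) => nj; last by apply: mask_ge0; rewrite mule_ge0// ewE_ge0.
      apply: le_trans (lee_wpmul2l (ewE_ge0 _ _) (hx j)) _.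
      by case: ifP => _; rewrite ?mule0.
    by move=> /le_trans; apply; rewrite leeDr//; apply: mask_ge0; exact: wGf_ge0.
  rewrite EFinD ge0_muleDl ?lee_fin ?(ltW B0)// mul1e /Phi.
  apply: leeD; first by rewrite -addeA leeDl// adde_ge0.
  rewrite lee_wpmul2l ?lee_fin ?(ltW B0)//.
  exact: le_trans (leeDr _ P0) (leeDl _ rR0).
(* The constant tail of [y] beyond [k], summed against [e^(-j/p1)], costs a multiple of [K]. *)
pose K := (ew p1^-1 k)%:E * h k.
have K0 : 0 <= K by exact: eh0.
have tail n : \sum_(j <oo) (if (n <= j)%N then (ew p1^-1 j)%:E * h k else 0) <=
    (D * ew p1^-1 n)%:E * h k.
  apply: le_trans (lee_wpmul2r (h0 k) (hD n)).
  rewrite -ser_mulr//; last by move=> j; apply: mask_ge0; exact: ewE_ge0.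
  apply: le_ser => j; first by apply: mask_ge0; rewrite mule_ge0// ewE_ge0.
  by case: ifP => _; rewrite ?mul0e.
have yG1 n : (n <= k)%N -> Gf p1 y n <= A%:E * (Gm p1 h n k + D%:E * K).
  move=> nk; pose y1 j := if (j <= k)%N then h j else 0; pose y2 j := if (k <= j)%N then h k else 0.
  have y10 j : 0 <= y1 j by apply: mask_ge0.
  have y20 j : 0 <= y2 j by apply: mask_ge0.
  have yy j : y j <= y1 j + y2 j.
    by rewrite /y1 /y2; case: (leqP j k) => jk; [apply: (le_trans (hyj j)); rewrite leeDl//; exact: mask_ge0|rewrite (ltnW jk) add0e].
  apply: le_trans (Gf_mono _ p1_gt0 y0 yy) _.
  apply: le_trans (hA _ _ _ y10 y20) _; rewrite lee_wpmul2l ?lee_fin ?(ltW A0)//.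
  apply: leeD.
    apply: Lp_mono => // j; first by apply: mask_ge0; rewrite mule_ge0// ewE_ge0.
    by rewrite /y1; case: (leqP n j) => //= _; case: ifP => _; rewrite ?mule0.
  apply: le_trans (Gf_le_sum y20 _ p1_ge1) _.
  apply: (@le_trans _ _ ((D * ew p1^-1 k)%:E * h k)); last by rewrite /K EFinM muleA.
  apply: le_trans (tail k); apply: le_ser => j.
    by apply: mask_ge0; rewrite mule_ge0// ewE_ge0.
  by rewrite /y2; case: ifP => _; case: ifP => _; rewrite ?mule0// mule_ge0// ewE_ge0.
have yG2 n : (k <= n)%N -> Gf p1 y n <= (D * ew p1^-1 n)%:E * h k.
  move=> kn; apply: le_trans (Gf_le_sum y0 _ p1_ge1) _.
  apply: le_trans (tail n); apply: le_ser => j.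
    by apply: mask_ge0; rewrite mule_ge0// ewE_ge0.
  by case: ifP => // _; rewrite lee_wpmul2l ?ewE_ge0.
have DK0 : 0 <= D%:E * K by rewrite mule_ge0// lee_fin ltW.
have hS : Sf a1 p1 y <= A%:E * Rf a1 p1 h k + ((A * D * B') * wt a1 k)%:E * K
    + ((D * F) * wt a1 k)%:E * K.
  have -> : ((A * D * B') * wt a1 k)%:E * K = A%:E * ((B' * wt a1 k)%:E * (D%:E * K)).
    by rewrite !muleA -!EFinM; congr (_%:E * _); ring.
  have h3 : (F * (ew p1^-1 k * wt (a1 - 1) k))%:E * (D%:E * h k) <= ((D * F) * wt a1 k)%:E * K.
    rewrite /K !muleA -!EFinM lee_wpmul2r// lee_fin.
    rewrite (_ : (F * _ * D = (D * F * ew p1^-1 k) * wt (a1 - 1) k)%R); last by ring.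
    rewrite (_ : (D * F * wt a1 k * _ = (D * F * ew p1^-1 k) * wt a1 k)%R); last by ring.
    rewrite ler_wpM2l ?mulr_ge0 ?(ltW D0) ?(ltW F0) ?(ltW (ew_gt0 _ _))//.
    by apply: wt_le; rewrite gerBl.
  apply: le_trans (leeD2l _ h3).
  have Dh0 : 0 <= D%:E * h k by rewrite mule_ge0// lee_fin ltW.
  apply: le_trans (leeD2l _ (lee_wpmul2r Dh0 (hF k))).
  have AA : 0 <= A%:E :> \bar R by rewrite lee_fin ltW.
  apply: le_trans (leeD2r _ (leeD2l _ (lee_wpmul2l AA (lee_wpmul2r DK0 (hB' k))))).
  have m1 n : 0 <= (if (n <= k)%N then (wt (a1 - 1) n)%:E else 0) :> \bar R.
    by apply: mask_ge0; exact: wtE_ge0.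
  have m2 n : 0 <= (if (k <= n)%N then (ew p1^-1 n * wt (a1 - 1) n)%:E else 0) :> \bar R.
    by apply: mask_ge0; rewrite lee_fin mulr_ge0 ?(ltW (ew_gt0 _ _)) ?(ltW (wt_gt0 _ _)).
  have m3 n : 0 <= (if (n <= k)%N then (wt (a1 - 1) n)%:E * Gm p1 h n k else 0).
    by apply: mask_ge0; exact: wGm_ge0.
  rewrite -!ser_mulr// -ge0_muleDr//; last by apply: ser_ge0 => n; rewrite mule_ge0.
  rewrite -ser_add//; last by move=> n; rewrite mule_ge0.
  rewrite -ser_scale ?(ltW A0)//; last by move=> n; rewrite adde_ge0// mule_ge0.
  rewrite -ser_add; last 2 first.
  - by move=> n; rewrite mule_ge0// adde_ge0// mule_ge0.
  - by move=> n; rewrite mule_ge0.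
  apply: le_ser => n; first exact: wGf_ge0.
  case: (leqP n k) => nk.
    apply: le_trans (lee_wpmul2l (wtE_ge0 _ _) (yG1 n nk)) _.
    rewrite muleCA ge0_muleDr ?Gm_ge0//.
    by rewrite leeDl// mule_ge0.
  rewrite (ltnW nk) mul0e adde0 mule0 add0e.
  apply: le_trans (lee_wpmul2l (wtE_ge0 _ _) (yG2 n (ltnW nk))) _.
  rewrite !muleA -!EFinM lee_wpmul2r// lee_fin le_eqVlt; apply/orP; left.
  by apply/eqP; ring.
(* By [rw_wt] and [ew_gap] the left-hand side is [(1+k)^a0 e^(-k/p0) h_k], a single entry of [Q]; so
   the constant tail adds nothing new. *)
have rK : (rw k * wt a1 k)%:E * K <= Phi h k.
  have -> : (rw k * wt a1 k)%:E * K = (wt a0 k)%:E * ((ew p0^-1 k)%:E * h k).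
    by rewrite /K !muleA -!EFinM rw_wt ew_gap; congr (_%:E * _); ring.
  apply: le_trans (lee_wpmul2l (wtE_ge0 _ _) (Gf_term p0_gt0 h0 (leqnn k))) _.
  exact: le_trans (leeDr _ P0) (leeDl _ rR0).
have rRP : (rw k)%:E * Rf a1 p1 h k <= Phi h k by exact: leeDr (adde_ge0 P0 Q0).
apply: le_trans (lee_wpmul2l (rwE_ge0 k) hS) _.
have cc (c : R) : (0 <= c)%R -> (rw k)%:E * ((c * wt a1 k)%:E * K) <= c%:E * Phi h k.
  move=> c0; rewrite (_ : _ * _ = c%:E * ((rw k * wt a1 k)%:E * K)).
    by rewrite lee_wpmul2l.
  by rewrite !muleA -!EFinM; congr (_%:E * _); ring.
have cK0 (c : R) : (0 <= c)%R -> 0 <= (c * wt a1 k)%:E * K.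
  by move=> c0; rewrite mule_ge0// lee_fin mulr_ge0// ltW// wt_gt0.
have AD : (0 <= A * D * B')%R by rewrite !mulr_ge0 ?ltW.
have DF : (0 <= D * F)%R by rewrite mulr_ge0 ?ltW.
have AR : 0 <= A%:E * Rf a1 p1 h k by rewrite mule_ge0// lee_fin ltW.
rewrite (ge0_muleDr _ (adde_ge0 AR (cK0 _ AD)) (cK0 _ DF)) (ge0_muleDr _ AR (cK0 _ AD)).
apply: lec_add; rewrite ?addr_ge0 ?(ltW A0)//; last exact: cc.
apply: lec_add; rewrite ?(ltW A0)//; last exact: cc.
by rewrite muleCA lee_wpmul2l// lee_fin ltW.
Qed.

End Couple.

(** * Discretisation of the function space norms *)

Section Discretization.
Local Open Scope ereal_scope.
Context {R : realType} {d} {T : measurableType d} (mu : probability T R).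
Implicit Types (f : T -> R) (p a : R).

(** Sampling at the left end of [cell k] bounds the rearrangement from above on [cell k], but from
    below only on [cell k.+1]. The index shifts in the lower bounds come from this. *)
Definition fstar f (k : nat) : \bar R := rearrangement mu (EFin \o f) (expR (- k.+1%:R)).

Lemma fstar_ge0 f k : 0 <= fstar f k. Proof. exact: rearrangement_ge0. Qed.

Lemma rearr_le_fstar f k t : cell k t -> rearrangement mu (EFin \o f) t <= fstar f k.
Proof.
by rewrite /cell/= in_itv/= => /andP[kt _]; apply: rearrangement_nincr.
Qed.

Lemma fstar_le_rearr f k t : cell k.+1 t -> fstar f k <= rearrangement mu (EFin \o f) t.
Proof.
by rewrite /cell/= in_itv/= => /andP[_ /ltW kt]; apply: rearrangement_nincr.
Qed.

Lemma cell_mono (i j : nat) (s t : R) : cell i s -> cell j t -> (s <= t)%R -> (j <= i)%N.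
Proof.
rewrite /cell/= !in_itv/= => /andP[si _] /andP[_ tj] st.
rewrite leqNgt; apply/negP => ij.
have : (expR (- j%:R) <= expR (- i.+1%:R) :> R)%R by rewrite ler_expR lerN2 ler_nat.
by rewrite leNgt (le_lt_trans si)// (le_lt_trans st).
Qed.

Lemma cell_lt (i j : nat) (s t : R) : cell i s -> cell j t -> (j < i)%N -> (s < t)%R.
Proof.
rewrite /cell/= !in_itv/= => /andP[_ si] /andP[tj _] ji.
apply: (lt_le_trans si); apply: le_trans tj.
by rewrite ler_expR lerN2 ler_nat.
Qed.

Lemma cell_powR_le p k (t : R) : (0 < p)%R -> cell k t -> (t `^ p^-1 <= ew p^-1 k)%R.
Proof.
move=> p0 kt; have t0 := cell_gt0 kt; rewrite powR_expR_ln// ler_expR.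
have /andP[kt1 _] : (k%:R < - ln t <= k.+1%:R)%R by exact/cellP.
by rewrite -mulrN ler_pM2l ?invr_gt0// lerNr ltW.
Qed.

Lemma cell_powR_ge p k (t : R) : (0 < p)%R -> cell k t -> (ew p^-1 k.+1 <= t `^ p^-1)%R.
Proof.
move=> p0 kt; have t0 := cell_gt0 kt; rewrite powR_expR_ln// ler_expR.
have /andP[_ kt1] : (k%:R < - ln t <= k.+1%:R)%R by exact/cellP.
by rewrite -mulrN ler_pM2l ?invr_gt0// lerNl.
Qed.

Lemma Lq_stepE p (x : nat -> \bar R) : (0 < p)%R -> (forall k, 0 <= x k) ->
  Lq p (step x) = Lp p x.
Proof. exact: Lq_step. Qed.

Lemma L1_stepE (x : nat -> \bar R) : (forall k, 0 <= x k) ->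
  Lq 1 (step x) = \sum_(k <oo) x k.
Proof.
move=> x0; rewrite Lq_step// invr1 poweRe1; last first.
  by apply: ser_ge0 => n; exact: poweR_ge0.
by apply: eq_eseriesr => n _; rewrite poweRe1.
Qed.

Lemma tnorm_Lq_ge0 p (I : interval R) (g : R -> \bar R) : 0 <= tnorm (Lq p) I g.
Proof. exact: Lnorm_ge0. Qed.

Definition pf p f (s : R) : \bar R := (s `^ p^-1)%:E * rearrangement mu (EFin \o f) s.

Lemma pf_ge0 p f s : 0 <= pf p f s.
Proof. by rewrite mule_ge0 ?rearrangement_ge0// lee_fin powR_ge0. Qed.

Lemma pf_le p f k t : (0 < p)%R -> cell k t -> pf p f t <= (ew p^-1 k)%:E * fstar f k.
Proof.
move=> p0 kt; apply: lee_pmul; rewrite ?rearrangement_ge0 ?lee_fin ?powR_ge0//.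
  exact: cell_powR_le.
exact: rearr_le_fstar.
Qed.

(** On [cell k.+1] one has [t >= e^-(k+2)], two steps away from the [e^-k] in the weight; hence
    [e^(-2/p)]. *)
Lemma pf_ge p f k t : (0 < p)%R -> cell k.+1 t ->
  (expR (- (2 / p)))%:E * ((ew p^-1 k)%:E * fstar f k) <= pf p f t.
Proof.
move=> p0 kt; rewrite muleA; apply: lee_pmul; rewrite ?fstar_ge0//.
- by rewrite -EFinM lee_fin mulr_ge0 ?expR_ge0// ltW// ew_gt0.
- rewrite -EFinM lee_fin; apply: le_trans (cell_powR_ge p0 kt).
  by rewrite /ew -expRD ler_expR -!natr1; lra.
exact: fstar_le_rearr.
Qed.

Lemma inner_Gf_le p f k (t : R) : (0 < p)%R -> cell k t ->
  tnorm (Lq p) `]0%R, t[ (pf p f) <= Gf p (fstar f) k.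
Proof.
move=> p0 kt; rewrite /Gf -Lq_stepE//; last first.
  by move=> j; apply: mask_ge0; rewrite mule_ge0 ?ewE_ge0 ?fstar_ge0.
apply: tnorm_le; first exact: Lq_rearr_norm.
- by move=> j; apply: mask_ge0; rewrite mule_ge0 ?ewE_ge0 ?fstar_ge0.
- move=> s; rewrite in_itv/= => /andP[-> st]/=.
  by apply: lt_trans st _; exact: cell_lt1 kt.
- move=> j s js; rewrite in_itv/= => /andP[_ /ltW st].
  by rewrite gee0_abs ?pf_ge0// (cell_mono js kt st) pf_le.
Qed.

Lemma inner_Gm_le p f n k (u t : R) : (0 < p)%R -> cell k u -> cell n t ->
  tnorm (Lq p) `]u, t[ (pf p f) <= Gm p (fstar f) n k.
Proof.
move=> p0 ku nt; rewrite /Gm -Lq_stepE//; last first.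
  by move=> j; apply: mask_ge0; rewrite mule_ge0 ?ewE_ge0 ?fstar_ge0.
apply: tnorm_le; first exact: Lq_rearr_norm.
- by move=> j; apply: mask_ge0; rewrite mule_ge0 ?ewE_ge0 ?fstar_ge0.
- move=> s; rewrite in_itv/= => /andP[us st].
  by rewrite (lt_trans (cell_gt0 ku) us) (lt_trans st (cell_lt1 nt)).
- move=> j s js; rewrite in_itv/= => /andP[/ltW us /ltW st].
  by rewrite gee0_abs ?pf_ge0// (cell_mono js nt st) (cell_mono ku js us) pf_le.
Qed.

(** The mask [b] treats the tails [Gf] and the blocks [Gm] at once; the entry [j] is detected on
    [cell j.+1]. *)
Lemma inner_ge p f (I : interval R) (b : nat -> bool) : (0 < p)%R ->
  (forall j s, cell j.+1 s -> b j -> s \in I) ->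
  Lp p (fun j => if b j then (ew p^-1 j)%:E * fstar f j else 0) <=
    (expR (2 / p))%:E * tnorm (Lq p) I (pf p f).
Proof.
move=> p0 bI; pose c : R := expR (- (2 / p)).
have c0 : (0 <= c)%R by exact: expR_ge0.
pose y j := if b j then (ew p^-1 j)%:E * fstar f j else 0.
have y0 j : 0 <= y j by apply: mask_ge0; rewrite mule_ge0 ?ewE_ge0 ?fstar_ge0.
(* The entries are moved one place to the right, to the cells where [pf_ge] applies, and brought
   back by [Lp_shift]. *)
pose x j := if j is i.+1 then c%:E * y i else 0.
have x0 j : 0 <= x j by case: j => //= i; rewrite mule_ge0.
have h : Lp p x <= tnorm (Lq p) I (pf p f).
  rewrite -Lq_stepE//; apply: tnorm_ge => //; first exact: Lq_rearr_norm.
  move=> [|j] s js /=; first by rewrite ltxx.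
  rewrite /y; case: ifPn => bj; last by rewrite mule0 ltxx.
  by move=> _; split; [exact: bI js bj|rewrite gee0_abs ?pf_ge0// pf_ge].
have h2 : c%:E * Lp p y <= Lp p x by rewrite -Lp_scale//; exact: (Lp_shift p0 x0).
have cE : (expR (2 / p))%:E * c%:E = 1 :> \bar R.
  by rewrite -EFinM -expRD subrr expR0.
apply: (@le_trans _ _ ((expR (2 / p))%:E * (c%:E * Lp p y))).
  by rewrite muleA cE mul1e.
by rewrite lee_wpmul2l ?lee_fin ?expR_ge0// (le_trans h2).
Qed.

Lemma inner_Gf_ge p f k (t : R) : (0 < p)%R -> cell k t ->
  Gf p (fstar f) k <= (expR (2 / p))%:E * tnorm (Lq p) `]0%R, t[ (pf p f).
Proof.
move=> p0 kt; apply: inner_ge => // j s js kj; rewrite in_itv/= (cell_gt0 js)/=.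
exact: cell_lt js kt _.
Qed.

(** The entries [j <= k] are detected on cells up to [k+1]. These lie to the right of [u] once [u]
    is in the next cell, hence [k.+2]. *)
Lemma inner_Gm_ge p f n k (u t : R) : (0 < p)%R -> cell k.+2 u -> cell n t ->
  Gm p (fstar f) n k <= (expR (2 / p))%:E * tnorm (Lq p) `]u, t[ (pf p f).
Proof.
move=> p0 ku nt; apply: inner_ge => // j s js /andP[nj jk]; rewrite in_itv/=.
by rewrite (cell_lt ku js)//= (cell_lt js nt).
Qed.

Lemma ell_wt s : exists2 C : R, (0 < C)%R & forall k (t : R), cell k t ->
  (wt s k <= C * ell s t)%R /\ (ell s t <= C * wt s k)%R.
Proof.
(* On [cell k] the quantity [1 - ln t] lies between [k+1] and [k+2 <= 2 (k+1)]. *)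
exists (2 `^ `|s|)%R; first by rewrite powR_gt0.
move=> k t kt; have t0 := cell_gt0 kt.
have /andP[kt1 kt2] : (k%:R < - ln t <= k.+1%:R)%R by exact/cellP.
have lt0 : (`|ln t| = - ln t)%R by rewrite ler0_norm// ln_le0// ltW// (cell_lt1 kt).
rewrite /ell /wt lt0 !powR_expR_ln//; last by rewrite ltr_pwDl// (le_trans _ (ltW kt1)).
rewrite -!expRD !ler_expR.
have k0 : (0 < k.+1%:R :> R)%R by [].
have x0 : (0 < 1 - ln t)%R by rewrite ltr_pwDl// (le_trans _ (ltW kt1)).
have h1 : (ln (k.+1%:R) <= ln (1 - ln t))%R.
  by rewrite ler_ln ?posrE// -natr1 addrC lerD2l ltW.
have h2 : (ln (1 - ln t) <= ln 2 + ln k.+1%:R)%R.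
  rewrite -lnM ?posrE// ler_ln ?posrE ?mulr_gt0//.
  have : (1 <= k.+1%:R :> R)%R by rewrite ler1n.
  lra.
set x := ln (1 - ln t) in h1 h2 *; set y := ln k.+1%:R in h1 h2 *.
have h : (`|s * (x - y)| <= `|s| * ln 2)%R.
  by rewrite normrM ler_wpM2l// ger0_norm ?subr_ge0// lerBlDr.
by move: h; rewrite ler_norml mulrBr => /andP[h3 h4]; split; lra.
Qed.

Lemma ell_ge0 s (t : R) : 0 <= (ell s t)%:E :> \bar R.
Proof. by rewrite lee_fin powR_ge0. Qed.

(** The interval [I t] is [(0, t)] for [smallL] and [LLL], and [(u, t)] with fixed [u] for [LLR]. *)
Definition midf a p f (I : R -> interval R) (t : R) : \bar R :=
  (ell (a - 1) t)%:E * tnorm (Lq p) (I t) (pf p f).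

Lemma midf_ge0 a p f I t : 0 <= midf a p f I t.
Proof. by rewrite mule_ge0 ?ell_ge0 ?tnorm_Lq_ge0. Qed.

Lemma mid_Pf_le a p : (0 < p)%R -> exists2 C : R, (0 < C)%R & forall f k (u : R),
  cell k u -> tnorm (Lq 1) `]0%R, u[ (midf a p f (fun t => `]0%R, t[)) <= C%:E * Pf a p (fstar f) k.
Proof.
move=> p0; have [C C0 hC] := ell_wt (a - 1); exists C => // f k u ku.
have m0 j : 0 <= (if (k <= j)%N then (wt (a - 1) j)%:E * Gf p (fstar f) j else 0).
  by apply: mask_ge0; exact: wGf_ge0.
rewrite -ser_scale ?(ltW C0)// -L1_stepE; last by move=> j; rewrite mule_ge0// lee_fin ltW.
apply: tnorm_le; first exact: Lq_rearr_norm.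
- by move=> j; rewrite mule_ge0// lee_fin ltW.
- move=> s; rewrite in_itv/= => /andP[-> st]/=.
  by apply: lt_trans st _; exact: cell_lt1 ku.
- move=> j s js; rewrite in_itv/= => /andP[_ /ltW su].
  rewrite gee0_abs ?midf_ge0// (cell_mono js ku su) muleA.
  apply: lee_pmul; rewrite ?ell_ge0 ?tnorm_Lq_ge0 ?inner_Gf_le//.
  by rewrite -EFinM lee_fin; have [] := hC _ _ js.
Qed.

(** The interval is left free for two uses: (0,1) with [k = 0] for the small Lebesgue norm, and
    (0,u) with [k] one more than the index of the cell of [u], which itself need not lie below
    [u]. *)
Lemma mid_Pf_ge a p : (0 < p)%R -> exists2 C : R, (0 < C)%R & forall f k (I : interval R),
  (forall j t, cell j t -> (k <= j)%N -> t \in I) ->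
  Pf a p (fstar f) k <= C%:E * tnorm (Lq 1) I (midf a p f (fun t => `]0%R, t[)).
Proof.
move=> p0; have [C C0 hC] := ell_wt (a - 1).
pose D := (C * expR (2 / p))%R; have D0 : (0 < D)%R by rewrite mulr_gt0// expR_gt0.
exists D => // f k I hI.
pose y j := if (k <= j)%N then (wt (a - 1) j)%:E * Gf p (fstar f) j else 0.
have y0 j : 0 <= y j by apply: mask_ge0; exact: wGf_ge0.
have Di : 0 <= D^-1%:E :> \bar R by rewrite lee_fin invr_ge0 ltW.
have h : D^-1%:E * Pf a p (fstar f) k <= tnorm (Lq 1) I (midf a p f (fun t => `]0%R, t[)).
  rewrite -ser_scale ?invr_ge0 ?(ltW D0)// -L1_stepE; last by move=> j; exact: mule_ge0 Di (y0 j).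
  apply: tnorm_ge; first exact: Lq_rearr_norm.
    by move=> j; exact: mule_ge0 Di (y0 j).
  move=> j t jt; case: ifPn => kj; last by rewrite mule0 ltxx.
  move=> _; split; first exact: hI jt kj.
  rewrite gee0_abs ?midf_ge0// /midf.
  apply: (@le_trans _ _ (D^-1%:E * ((C * ell (a - 1) t)%:E * ((expR (2 / p))%:E * tnorm (Lq p) `]0%R, t[ (pf p f))))).
    rewrite lee_wpmul2l//; apply: lee_pmul; rewrite ?wtE_ge0 ?Gf_ge0//; last exact: inner_Gf_ge.
    by rewrite lee_fin; have [] := hC _ _ jt.
  rewrite !muleA -!EFinM lee_wpmul2r ?tnorm_Lq_ge0// lee_fin.
  rewrite (_ : (D^-1 * _ * _ = (D^-1 * D) * ell (a - 1) t)%R); last by rewrite /D; ring.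
  by rewrite mulVf ?gt_eqF// mul1r.
have := lee_wpmul2l (ltW (_ : 0 < D%:E)) h; rewrite lte_fin => /(_ D0).
by rewrite muleA -EFinM mulfV ?gt_eqF// mul1e.
Qed.

Lemma mid_Rf_le a p : (0 < p)%R -> exists2 C : R, (0 < C)%R & forall f k (u : R),
  cell k u -> tnorm (Lq 1) `]u, 1%R[ (midf a p f (fun t => `]u, t[)) <= C%:E * Rf a p (fstar f) k.
Proof.
move=> p0; have [C C0 hC] := ell_wt (a - 1); exists C => // f k u ku.
have m0 j : 0 <= (if (j <= k)%N then (wt (a - 1) j)%:E * Gm p (fstar f) j k else 0).
  by apply: mask_ge0; exact: wGm_ge0.
rewrite -ser_scale ?(ltW C0)// -L1_stepE; last by move=> j; rewrite mule_ge0// lee_fin ltW.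
apply: tnorm_le; first exact: Lq_rearr_norm.
- by move=> j; rewrite mule_ge0// lee_fin ltW.
- move=> s; rewrite in_itv/= => /andP[us ->]; rewrite andbT.
  by apply: lt_trans us; exact: cell_gt0 ku.
- move=> j s js; rewrite in_itv/= => /andP[/ltW us _].
  rewrite gee0_abs ?midf_ge0// (cell_mono ku js us) muleA.
  apply: lee_pmul; rewrite ?ell_ge0 ?tnorm_Lq_ge0 ?inner_Gm_le//.
  by rewrite -EFinM lee_fin; have [] := hC _ _ js.
Qed.

Lemma mid_Rf_ge a p : (0 < p)%R -> exists2 C : R, (0 < C)%R & forall f k (u : R),
  cell k.+2 u ->
  Rf a p (fstar f) k <= C%:E * tnorm (Lq 1) `]u, 1%R[ (midf a p f (fun t => `]u, t[)).
Proof.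
move=> p0; have [C C0 hC] := ell_wt (a - 1).
pose D := (C * expR (2 / p))%R; have D0 : (0 < D)%R by rewrite mulr_gt0// expR_gt0.
exists D => // f k u ku.
pose y j := if (j <= k)%N then (wt (a - 1) j)%:E * Gm p (fstar f) j k else 0.
have y0 j : 0 <= y j by apply: mask_ge0; exact: wGm_ge0.
have Di : 0 <= D^-1%:E :> \bar R by rewrite lee_fin invr_ge0 ltW.
have h : D^-1%:E * Rf a p (fstar f) k <= tnorm (Lq 1) `]u, 1%R[ (midf a p f (fun t => `]u, t[)).
  rewrite -ser_scale ?invr_ge0 ?(ltW D0)// -L1_stepE; last by move=> j; exact: mule_ge0 Di (y0 j).
  apply: tnorm_ge; first exact: Lq_rearr_norm.
    by move=> j; exact: mule_ge0 Di (y0 j).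
  move=> j t jt; case: ifPn => kj; last by rewrite mule0 ltxx.
  move=> _; split.
    by rewrite in_itv/= (cell_lt1 jt) (cell_lt ku jt)//= ltnS (leqW kj).
  rewrite gee0_abs ?midf_ge0// /midf.
  apply: (@le_trans _ _ (D^-1%:E * ((C * ell (a - 1) t)%:E * ((expR (2 / p))%:E * tnorm (Lq p) `]u, t[ (pf p f))))).
    rewrite lee_wpmul2l//; apply: lee_pmul; rewrite ?wtE_ge0 ?Gm_ge0//; last exact: inner_Gm_ge.
    by rewrite lee_fin; have [] := hC _ _ jt.
  rewrite !muleA -!EFinM lee_wpmul2r ?tnorm_Lq_ge0// lee_fin.
  rewrite (_ : (D^-1 * _ * _ = (D^-1 * D) * ell (a - 1) t)%R); last by rewrite /D; ring.
  by rewrite mulVf ?gt_eqF// mul1r.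
have := lee_wpmul2l (ltW (_ : 0 < D%:E)) h; rewrite lte_fin => /(_ D0).
by rewrite muleA -EFinM mulfV ?gt_eqF// mul1e.
Qed.

Lemma smallL_fnormE p alpha f : fnorm (smallL mu p alpha) f =
  tnorm (Lq 1) `]0%R, 1%R[ (midf (alpha / conjexp p) p f (fun t => `]0%R, t[)).
Proof. by []. Qed.

Lemma smallL_Sf p alpha : (0 < p)%R -> exists2 C : R, (0 < C)%R & forall f,
  fnorm (smallL mu p alpha) f <= C%:E * Sf (alpha / conjexp p) p (fstar f) /\
  Sf (alpha / conjexp p) p (fstar f) <= C%:E * fnorm (smallL mu p alpha) f.
Proof.
move=> p0; set a := (alpha / conjexp p)%R.
have SP f : Sf a p (fstar f) = Pf a p (fstar f) 0 by [].
have [D D0 hD] := mid_Pf_ge a p0.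
have [C C0 hC] := ell_wt (a - 1).
exists (C + D)%R; first by rewrite addr_gt0.
move=> f; rewrite smallL_fnormE -/a; split; last first.
  apply: (@lec_weak _ D); rewrite ?tnorm_Lq_ge0 ?lerDr ?(ltW C0)//.
  rewrite SP; apply: hD => j t jt _.
  by rewrite in_itv/= (cell_gt0 jt) (cell_lt1 jt).
apply: (@lec_weak _ C); rewrite ?Sf_ge0 ?lerDl ?(ltW D0)//.
have m0 j : 0 <= (wt (a - 1) j)%:E * Gf p (fstar f) j by exact: wGf_ge0.
rewrite -ser_scale ?(ltW C0)// -L1_stepE; last by move=> j; rewrite mule_ge0// lee_fin ltW.
apply: tnorm_le; first exact: Lq_rearr_norm.
- by move=> j; rewrite mule_ge0// lee_fin ltW.
- by move=> s; rewrite in_itv.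
- move=> j s js _; rewrite gee0_abs ?midf_ge0// muleA.
  apply: lee_pmul; rewrite ?ell_ge0 ?tnorm_Lq_ge0 ?inner_Gf_le//.
  by rewrite -EFinM lee_fin; have [] := hC _ _ js.
Qed.

End Discretization.

(** * Rearrangements of sums and of truncations *)

Section TruncatedRearrangement.
Local Open Scope ereal_scope.
Context {R : realType} {d} {T : measurableType d} (mu : probability T R).
Implicit Types (f g : T -> R).

Let mEf f : measurable_fun setT f -> measurable_fun setT (EFin \o f).
Proof. by move=> mf; exact/measurable_EFinP. Qed.

Let mgt f (y : R) : measurable_fun setT f -> measurable [set x | y%:E < `|(EFin \o f) x|].
Proof.
move=> mf; rewrite -[X in measurable X]setTI; apply: emeasurable_fun_o_infty => //.
by apply: measurableT_comp => //; exact: mEf.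
Qed.

(** [f] is real-valued and [mu] is finite, so the measure of the sets [|f| > n] tends to 0 and
    eventually drops below [e^-(k+1)]. *)
Lemma fstar_lty f k : measurable_fun setT f -> fstar mu f k < +oo.
Proof.
move=> mf; pose F (n : nat) := [set x | n%:R%:E < `|(EFin \o f) x|].
have mF n : measurable (F n) by exact: mgt.
have F0 : \bigcap_n F n = set0.
  apply/seteqP; split => x //= /(_ (Num.truncn `|f x|).+1 I).
  by rewrite /F/= lte_fin ltNge ltW// truncnS_gt.
have cv : mu \o F @ \oo --> mu (\bigcap_n F n).
  apply: (nonincreasing_cvg_mu (mu := mu)) => //.
  - by apply: le_lt_trans (probability_le1 _ (mF 0%N)) _; rewrite ltry.
  - by rewrite F0.
  - move=> m n mn; apply/subsetPset => x; rewrite /F /=; apply: le_lt_trans.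
    by rewrite lee_fin ler_nat.
rewrite F0 measure0 in cv.
have t0 : (0 : \bar R) < (expR (- k.+1%:R))%:E by rewrite lte_fin expR_gt0.
have [n _ hn] : \forall n \near \oo, (mu \o F) n < (expR (- k.+1%:R))%:E.
  by move/fine_cvgP: cv => [fin cv]; near=> n;
    rewrite -[ltLHS]fineK; [rewrite lte_fin; near: n; exact: (cvgr_lt 0 cv _ (expR_gt0 _))|near: n].
have := hn n (leqnn n) => /ltW hle.
have : fstar mu f k <= n%:R%:E.
  by apply/rearrangement_le => //; exact: mEf.
by move=> /le_lt_trans; apply; rewrite ltry.
Unshelve. all: by end_near. Qed.

Lemma fstar_sub f f0 f1 k : measurable_fun setT f0 -> measurable_fun setT f1 ->
  f = (f0 \+ f1)%R -> fstar mu f k <= fstar mu f0 k.+1 + fstar mu f1 k.+1.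
Proof.
move=> mf0 mf1 ->.
have f0n : fstar mu f0 k.+1 \is a fin_num by rewrite ge0_fin_numE ?fstar_lty ?fstar_ge0.
have f1n : fstar mu f1 k.+1 \is a fin_num by rewrite ge0_fin_numE ?fstar_lty ?fstar_ge0.
pose y0 := fine (fstar mu f0 k.+1); pose y1 := fine (fstar mu f1 k.+1).
have y00 : (0 <= y0)%R by rewrite fine_ge0// fstar_ge0.
have y10 : (0 <= y1)%R by rewrite fine_ge0// fstar_ge0.
have h0 : fstar mu f0 k.+1 <= y0%:E by rewrite fineK.
have h1 : fstar mu f1 k.+1 <= y1%:E by rewrite fineK.
rewrite -(fineK f0n) -(fineK f1n) -/y0 -/y1 -EFinD.
apply/rearrangement_le; [by apply: mEf; exact: measurable_funD|exact: addr_ge0|].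
move/(rearrangement_le _ _ (mEf mf0) y00): h0 => h0.
move/(rearrangement_le _ _ (mEf mf1) y10): h1 => h1.
apply: (@le_trans _ _ (mu ([set x | y0%:E < `|(EFin \o f0) x|] `|` [set x | y1%:E < `|(EFin \o f1) x|]))).
  apply: le_measure; rewrite ?inE; [|by apply: measurableU; exact: mgt|].
    by apply: mgt; exact: measurable_funD.
  move=> x /=; rewrite !lte_fin => h.
  case: (ltP y0 `|f0 x|%R) => hx0; first by left.
  right; rewrite ltNge; apply/negP => hx1.
  have := le_lt_trans (le_trans (ler_normD _ _) (lerD hx0 hx1)) h.
  by rewrite ltxx.
apply: le_trans (measureU2 _ (mgt _ mf0) (mgt _ mf1)) _.
apply: le_trans (leeD h0 h1) _; rewrite -EFinD lee_fin.
have e1 : (2 <= expR 1 :> R)%R by have := @expR_ge1Dx R 1; lra.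
have -> : (- k.+1%:R = 1 + (- k.+2%:R) :> R)%R by rewrite -[in RHS]natr1; ring.
rewrite expRD; apply: le_trans (ler_wpM2r _ e1); last exact: expR_ge0.
by rewrite mulr2n mulrDl mul1r.
Qed.

Lemma fstar_mono f g k : (forall x, `|f x| <= `|g x|)%R -> measurable_fun setT f ->
  measurable_fun setT g -> fstar mu f k <= fstar mu g k.
Proof.
move=> fg mf mg; apply: le_rearrangement => y y0.
apply: le_measure; rewrite ?inE; [exact: mgt|exact: mgt|].
by move=> x /=; rewrite !lte_fin => /lt_le_trans; apply.
Qed.

Definition trunc_at (c : R) f (x : T) : R := Num.max (- c)%R (Num.min c (f x)).

Lemma trunc_at_measurable c f : measurable_fun setT f -> measurable_fun setT (trunc_at c f).
Proof. by move=> mf; apply: measurable_maxr => //; exact: measurable_minr. Qed.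

(** [f1] cuts [f] at the height [c = f*(e^-(k+1))], and [f0] is the excess. Since [f0] lives on
    [|f| > c], of measure at most [e^-(k+1)], its samples with [j < k] vanish. Both parts are
    dominated by [|f|]. *)
Lemma fstar_truncation f k : measurable_fun setT f -> exists f0 f1 : T -> R,
  [/\ measurable_fun setT f0, measurable_fun setT f1, f = (f0 \+ f1)%R,
    (forall j, fstar mu f0 j <= if (k <= j)%N then fstar mu f j else 0) &
    (forall j, fstar mu f1 j <= fstar mu f j) /\ (forall j, fstar mu f1 j <= fstar mu f k)].
Proof.
move=> mf; have fn : fstar mu f k \is a fin_num by rewrite ge0_fin_numE ?fstar_lty ?fstar_ge0.
pose c := fine (fstar mu f k); have c0 : (0 <= c)%R by rewrite fine_ge0// fstar_ge0.
have cE : c%:E = fstar mu f k by rewrite fineK.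
pose f1 := trunc_at c f; pose f0 x := (f x - f1 x)%R.
have mf1 : measurable_fun setT f1 by exact: trunc_at_measurable.
have mf0 : measurable_fun setT f0 by exact: measurable_funB.
have f1E x : [\/ (f1 x = f x /\ `|f x| <= c)%R, (f1 x = c /\ c < f x)%R | (f1 x = - c /\ f x < - c)%R].
  rewrite /f1 /trunc_at; case: (ltP c (f x)) => h.
    by apply: Or32; split => //; apply/max_idPr; lra.
  case: (ltP (f x) (- c)%R) => h2; [apply: Or33|apply: Or31]; split => //.
  by rewrite ler_norml h2.
have f1c x : (`|f1 x| <= c)%R.
  by have [[->]|[-> _]|[-> _]] := f1E x; rewrite ?normrN ?(ger0_norm c0).
have f1f x : (`|f1 x| <= `|f x|)%R.
  have [[->]//|[-> h]|[-> h]] := f1E x; rewrite ?normrN (ger0_norm c0).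
    by apply: le_trans (ler_norm _); exact: ltW.
  by rewrite -normrN; apply: le_trans (ler_norm _); lra.
have f0f x : (`|f0 x| <= `|f x|)%R.
  rewrite /f0; have [[-> _]|[-> h]|[-> h]] := f1E x; first by rewrite subrr normr0.
    by rewrite !ger0_norm; lra.
  by rewrite !ler0_norm; lra.
have f00 x : f0 x != 0%R -> (c < `|f x|)%R.
  rewrite /f0; have [[-> _]|[-> h] _|[-> h] _] := f1E x; first by rewrite subrr eqxx.
    by apply: lt_le_trans (ler_norm _).
  by rewrite -normrN; apply: lt_le_trans (ler_norm _); lra.
exists f0, f1; split => //.
- by apply/funext => x; rewrite /f0/= subrK.
- move=> j; case: (leqP k j) => kj; first exact: fstar_mono.
  apply/rearrangement_le => //; first exact: mEf.
  have : fstar mu f k <= c%:E by rewrite cE.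
  move/(rearrangement_le _ _ (mEf mf) c0) => hc.
  apply: (@le_trans _ _ (expR (- k.+1%:R))%:E); last first.
    by rewrite lee_fin ler_expR lerN2 ler_nat ltnW.
  apply: le_trans hc; apply: le_measure; rewrite ?inE; [exact: mgt|exact: mgt|].
  by move=> x /=; rewrite !lte_fin normr_gt0 => /f00.
- split => j; first exact: fstar_mono.
  rewrite -cE; apply/rearrangement_le => //; first exact: mEf.
  rewrite (_ : [set x | _] = set0) ?measure0 ?lee_fin ?expR_ge0//.
  by apply/seteqP; split => x //=; rewrite lte_fin ltNge f1c.
Qed.

End TruncatedRearrangement.

Lemma lec_lty {R : realType} (C : R) (x : \bar R) :
  (0 < C)%R -> (x < +oo -> C%:E * x < +oo)%E.
Proof. by move=> C0 xoo; rewrite lte_mul_pinfty// lee_fin ltW. Qed.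

(** * The K-functional *)

Section Kfunctional.
Local Open Scope ereal_scope.
Context {R : realType} {T : Type}.
Variables (Y0 Y1 : @funspace R T).
Hypotheses (n0 : forall f, 0 <= fnorm Y0 f) (n1 : forall f, 0 <= fnorm Y1 f).

Lemma Kfun_ge0 t f : (0 <= t)%R -> 0 <= Kfun Y0 Y1 t f.
Proof.
move=> t0; apply/ereal_infP => _ [f0 [f1 [_ _ _ ->]]].
by rewrite adde_ge0// mule_ge0// lee_fin.
Qed.

(** A form of [K(s) <= max(1, s/t) K(t)], checked on each decomposition. *)
Lemma Kfun_le s t f (c : R) : (1 <= c)%R -> (0 <= t)%R -> (s <= c * t)%R ->
  Kfun Y0 Y1 s f <= c%:E * Kfun Y0 Y1 t f.
Proof.
move=> c1 t0 st; have c0 : (0 < c)%R by exact: lt_le_trans c1.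
have h : c^-1%:E * Kfun Y0 Y1 s f <= Kfun Y0 Y1 t f.
  apply/ereal_infP => _ [f0 [f1 [h0 h1 fE ->]]].
  have : Kfun Y0 Y1 s f <= fnorm Y0 f0 + s%:E * fnorm Y1 f1.
    by apply: ereal_inf_lbound; exists f0, f1.
  have ci : 0 <= c^-1%:E :> \bar R by rewrite lee_fin invr_ge0 ltW.
  move=> /(lee_wpmul2l ci) /le_trans; apply.
  apply: (@le_trans _ _ (c^-1%:E * (c%:E * fnorm Y0 f0 + (c * t)%:E * fnorm Y1 f1))).
    rewrite lee_wpmul2l// leeD//.
      by rewrite -[leLHS]mul1e lee_wpmul2r// lee_fin.
    by rewrite lee_wpmul2r// lee_fin.
  have cA : 0 <= c%:E * fnorm Y0 f0 by rewrite mule_ge0// lee_fin ltW.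
  have cB : 0 <= (c * t)%:E * fnorm Y1 f1 by rewrite mule_ge0// lee_fin mulr_ge0// ltW.
  rewrite ge0_muleDr// [X in X + _]muleA [X in _ + X]muleA -!EFinM.
  by rewrite mulrA mulVf ?gt_eqF// mul1r mul1e.
have := lee_wpmul2l (ltW (_ : 0 < c%:E)) h; rewrite lte_fin => /(_ c0).
by rewrite muleA -EFinM mulfV ?gt_eqF// mul1e.
Qed.

End Kfunctional.

Section KfunctionalSmall.
Local Open Scope ereal_scope.
Context {R : realType} {d} {T : measurableType d} (mu : probability T R).
Variables p0 p1 alpha beta : R.
Hypotheses (hp0 : (1 < p0)%R) (hp01 : (p0 < p1)%R) (halpha : (0 < alpha)%R) (hbeta : (0 < beta)%R).
Implicit Types (f : T -> R).

Let a0 := (alpha / conjexp p0)%R.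
Let a1 := (beta / conjexp p1)%R.
Let Y0 := smallL mu p0 alpha.
Let Y1 := smallL mu p1 beta.
Let r := rw p0 p1 a0 a1.
Let PhiT := Phi p0 p1 a0 a1.

Lemma conjexp_gt0 (p : R) : (1 < p)%R -> (0 < conjexp p)%R.
Proof.
move=> p1'; rewrite invr_gt0 subr_gt0 invf_lt1//.
exact: lt_trans p1'.
Qed.

Let ha0 : (0 < a0)%R. Proof. by rewrite divr_gt0// conjexp_gt0. Qed.
Let ha1 : (0 < a1)%R. Proof. by rewrite divr_gt0// conjexp_gt0// (lt_trans hp0). Qed.
Let p00 : (0 < p0)%R. Proof. exact: lt_trans hp0. Qed.
Let p10 : (0 < p1)%R. Proof. exact: lt_trans hp01. Qed.

Lemma smallL_ge0 p al f : 0 <= fnorm (smallL mu p al) f.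
Proof. exact: tnorm_Lq_ge0. Qed.

Lemma Phi_le_Kfun : exists2 C : R, (0 < C)%R & forall f k,
  PhiT (fstar mu f) k <= C%:E * Kfun Y0 Y1 (r k) f.
Proof.
have [C C0 hC] := @Phi_le_decomposition R p0 p1 a0 a1 hp0 hp01 ha0 ha1.
have [A A0 hA] := smallL_Sf mu alpha p00.
have [B B0 hB] := smallL_Sf mu beta p10.
pose D := (C * (A + B))%R; have D0 : (0 < D)%R by rewrite mulr_gt0// addr_gt0.
exists D => // f k.
have h : D^-1%:E * PhiT (fstar mu f) k <= Kfun Y0 Y1 (r k) f.
  apply/ereal_infP => _ [f0 [f1 [[mf0 _] [mf1 _] fE ->]]].
  have h1 : PhiT (fstar mu f) k <= D%:E * (fnorm Y0 f0 + (r k)%:E * fnorm Y1 f1).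
    apply: lec_trans (ltW C0) (hC _ (fstar mu f0) (fstar mu f1) _ _ _ _ _) _;
      try by move=> n; exact: fstar_ge0.
      by move=> j; exact: fstar_sub.
    have rk0 : 0 <= (r k)%:E by rewrite lee_fin ltW// rw_gt0.
    apply: lec_add2; rewrite ?addr_ge0 ?(ltW A0) ?(ltW B0) ?smallL_ge0 ?mule_ge0 ?smallL_ge0//.
      apply: lec_weak (hA f0).2; first exact: smallL_ge0.
      by rewrite lerDl ltW.
    rewrite muleCA lee_wpmul2l//.
    apply: lec_weak (hB f1).2; first exact: smallL_ge0.
    by rewrite lerDr ltW.
  have Di : 0 <= D^-1%:E :> \bar R by rewrite lee_fin invr_ge0 ltW.
  move/(lee_wpmul2l Di): h1 => /le_trans; apply.
  by rewrite muleA -EFinM mulVf ?gt_eqF// mul1e.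
have := lee_wpmul2l (ltW (_ : 0 < D%:E)) h; rewrite lte_fin => /(_ D0).
by rewrite muleA -EFinM mulfV ?gt_eqF// mul1e.
Qed.

(** The infimum in [K] ranges over pieces in the two carriers. Finiteness of [Sf] makes [Phi]
    finite, which places both truncations there and so makes their cost admissible. *)
Lemma Kfun_le_Phi : exists2 C : R, (0 < C)%R & forall f k,
  measurable_fun setT f -> Sf a0 p0 (fstar mu f) < +oo ->
  Kfun Y0 Y1 (r k) f <= C%:E * PhiT (fstar mu f) k.
Proof.
have [C C0 hC] := @decomposition_le_Phi R p0 p1 a0 a1 hp0 hp01 ha0 ha1.
have [D D0 hD] := @Phi_le_S0 R p0 p1 a0 a1 hp0 hp01 ha0 ha1.
have [A A0 hA] := smallL_Sf mu alpha p00.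
have [B B0 hB] := smallL_Sf mu beta p10.
exists ((A + B) * C)%R; first by rewrite mulr_gt0// addr_gt0.
move=> f k mf Sfin.
have [f0 [f1 [mf0 mf1 fE hf0 [hf1 hf1']]]] := fstar_truncation mu k mf.
have f_ge0 g n : 0 <= fstar mu g n by exact: fstar_ge0.
have hS := hC (fstar mu f) (fstar mu f0) (fstar mu f1) k (f_ge0 f) (f_ge0 f0) (f_ge0 f1) hf0 hf1 hf1'.
have Phifin : C%:E * PhiT (fstar mu f) k < +oo.
  apply: (lec_lty C0); apply: le_lt_trans (hD _ k (f_ge0 f)) _.
  exact: lec_lty D0 Sfin.
have rk0 : (0 < r k)%R by exact: rw_gt0.
have S0 := Sf_ge0 a0 p0 (fstar mu f0); have S1 := Sf_ge0 a1 p1 (fstar mu f1).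
have rS1 : 0 <= (r k)%:E * Sf a1 p1 (fstar mu f1) by rewrite mule_ge0// lee_fin ltW.
have S0fin : Sf a0 p0 (fstar mu f0) < +oo.
  exact: le_lt_trans (le_trans (leeDl _ rS1) hS) Phifin.
have S1fin : Sf a1 p1 (fstar mu f1) < +oo.
  have h1 : (r k)%:E * Sf a1 p1 (fstar mu f1) < +oo.
    exact: le_lt_trans (le_trans (leeDr _ S0) hS) Phifin.
  rewrite ltey; apply/negP => /eqP e; move: h1.
  by rewrite e gt0_muley ?lte_fin// ltxx.
have K1 : Kfun Y0 Y1 (r k) f <= fnorm Y0 f0 + (r k)%:E * fnorm Y1 f1.
  apply: ereal_inf_lbound; exists f0, f1; split => //; split => //.
    exact: le_lt_trans (hA f0).1 (lec_lty A0 S0fin).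
  exact: le_lt_trans (hB f1).1 (lec_lty B0 S1fin).
apply: le_trans K1 _.
apply: (lec_trans _ _ hS); first by rewrite addr_ge0 ?ltW.
have AAB : (A <= A + B)%R by rewrite lerDl ltW.
have BAB : (B <= A + B)%R by rewrite lerDr ltW.
apply: (lec_add2 (le_trans (ltW A0) AAB) S0 rS1).
  exact: lec_weak S0 AAB (hA f0).1.
rewrite muleCA; apply: lee_wpmul2l; first by rewrite lee_fin ltW.
exact: lec_weak S1 BAB (hB f1).1.
Qed.

End KfunctionalSmall.

(** * Slow variation of b and of its composition with rho *)

Section SlowVariation.
Context {R : realType}.
Variable b : R -> R.
Hypothesis hb : slowly_varying b.

Let b_gt0 (t : R) : 0 < t < 1 -> 0 < b t. Proof. by have [_ h _] := hb; exact: h. Qed.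

(** If [s <= t], the almost increasing [t^eps b(t)] gives the bound; otherwise the almost decreasing
    [t^(-eps) b(t)] does. *)
Let slow01 (eps : R) : 0 < eps -> exists2 C : R, 0 < C & forall s t,
  0 < s < 1 -> 0 < t < 1 -> b s <= C * expR (eps * `|ln s - ln t|) * b t.
Proof.
move=> e0; have [_ _ /(_ _ e0) [[phi [[c [C [c0 C0 h1]]] hphi]] [psi [[c' [C' [c'0 C'0 h2]]] hpsi]]]] := hb.
exists (C / c + C' / c'); first by rewrite addr_gt0// divr_gt0.
move=> s t s01 t01.
have bs0 := b_gt0 s01; have bt0 := b_gt0 t01.
have /andP[s0 s1] := s01; have /andP[t0 t1] := t01.
case: (leP s t) => st.
  have lst : ln s <= ln t by rewrite ler_ln ?posrE.
  have h : s `^ eps * b s <= C / c * (t `^ eps * b t).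
    have /andP[_ a1] := h1 _ s01; have /andP[a2 _] := h1 _ t01.
    apply: (le_trans a1); rewrite -mulrA ler_pM2l// -[leLHS](mulKf (lt0r_neq0 c0)).
    rewrite ler_pM2l ?invr_gt0//; apply: le_trans a2.
    by rewrite ler_pM2l// hphi.
  rewrite !powR_expR_ln// in h.
  apply: (@le_trans _ _ (C / c * expR (eps * `|ln s - ln t|) * b t)).
    rewrite distrC ger0_norm ?subr_ge0// mulrBr expRB.
    rewrite -(ler_pM2l (expR_gt0 (eps * ln s))); apply: (le_trans h).
    rewrite [leRHS](_ : _ = C / c * (expR (eps * ln t) * b t) * (expR (eps * ln s) / expR (eps * ln s))).
      by rewrite divff ?mulr1// gt_eqF// expR_gt0.
    by rewrite !mulrA; ring.
  by rewrite ler_pM2r// ler_pM2r ?expR_gt0// lerDl divr_ge0// ltW.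
have lst : ln t <= ln s by rewrite ler_ln ?posrE// ltW.
have h : s `^ (- eps) * b s <= C' / c' * (t `^ (- eps) * b t).
  have /andP[_ a1] := h2 _ s01; have /andP[a2 _] := h2 _ t01.
  apply: (le_trans a1); rewrite -mulrA ler_pM2l// -[leLHS](mulKf (lt0r_neq0 c'0)).
  rewrite ler_pM2l ?invr_gt0//; apply: le_trans a2.
  by rewrite ler_pM2l// hpsi// ltW.
rewrite !powR_expR_ln// in h.
apply: (@le_trans _ _ (C' / c' * expR (eps * `|ln s - ln t|) * b t)).
  rewrite ger0_norm ?subr_ge0// mulrBr expRB.
  rewrite !mulNr !expRN in h.
  rewrite -[leLHS](mulVKf (lt0r_neq0 (expR_gt0 (eps * ln s)))).
  rewrite -[leRHS]mulrA [X in _ <= _ * X](_ : _ = expR (eps * ln s) * ((expR (eps * ln t))^-1 * b t)).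
    by rewrite [leRHS]mulrCA ler_pM2l ?expR_gt0.
  by rewrite mulrA.
by rewrite ler_pM2r// ler_pM2r ?expR_gt0// lerDr divr_ge0// ltW.
Qed.

Lemma sv_ext_gt0 t : 0 < t -> 0 < sv_ext b t.
Proof. by move=> t0; rewrite /sv_ext; case: (ltP t 1) => // t1; rewrite b_gt0// t0. Qed.

Lemma sv_ext_slow (eps : R) : 0 < eps -> exists2 C : R, 0 < C & forall s t,
  0 < s -> 0 < t -> sv_ext b s <= C * expR (eps * `|ln s - ln t|) * sv_ext b t.
Proof.
move=> e0; have [C C0 hC] := slow01 e0.
(* A reference point in (0,1): when [s] and [t] lie on different sides of 1, the value of [b] is
   compared with [b m] and the other value is 1. As [ln m = -1], the detour costs [e^eps]. *)
pose m : R := expR (-1); have m01 : 0 < m < 1 by rewrite expR_gt0 expR_lt1 oppr_lt0 ltr01.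
have bm0 := b_gt0 m01; have lm : ln m = -1 by rewrite expRK.
pose D := C * expR eps; have D0 : 0 < D by rewrite mulr_gt0// expR_gt0.
have P1 : 0 < D / b m by rewrite divr_gt0.
have P2 : 0 < D * b m by rewrite mulr_gt0.
exists (C + 1 + D / b m + D * b m); first by rewrite !addr_gt0.
move=> s t s0 t0; set K := _ + _ + _ + _.
have ex0 x : 0 < expR x :> R by exact: expR_gt0.
have ex1 : 1 <= expR (eps * `|ln s - ln t|).
  by rewrite -expR0 ler_expR mulr_ge0// ltW.
have aux c x y : c <= K -> 0 < y -> x <= c * expR (eps * `|ln s - ln t|) * y ->
    x <= K * expR (eps * `|ln s - ln t|) * y.
  by move=> cK y0 /le_trans; apply; rewrite ler_pM2r// ler_pM2r.
rewrite /sv_ext; case: (ltP s 1) => s1; case: (ltP t 1) => t1.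
- have t01 : 0 < t < 1 by rewrite t0.
  apply: (aux C); rewrite ?b_gt0//; first by rewrite /K; lra.
  by apply: hC => //; rewrite s0.
- apply: (aux (D * b m)) => //; first by rewrite /K; lra.
  have s01 : 0 < s < 1 by rewrite s0.
  apply: le_trans (hC _ _ s01 m01) _.
  rewrite mulr1 [leRHS]mulrAC ler_pM2r// /D -mulrA ler_pM2l// -expRD ler_expR.
  rewrite -[X in _ <= X + _]mulr1 -mulrDr ler_pM2l// lm.
  have ls : ln s <= 0 by rewrite ln_le0// ltW.
  have lt : 0 <= ln t by exact: ln_ge0.
  rewrite [X in _ <= 1 + X]distrC [X in _ <= 1 + X]ger0_norm ?subr_ge0 ?(le_trans ls)// opprK.
  by rewrite ler_norml; apply/andP; split; lra.
- have t01 : 0 < t < 1 by rewrite t0.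
  apply: (aux (D / b m)); rewrite ?b_gt0//; first by rewrite /K; lra.
  have h := hC _ _ m01 t01.
  rewrite -(ler_pM2l bm0) mulr1; apply: (le_trans h).
  rewrite [leRHS](_ : _ = (D * expR (eps * `|ln s - ln t|) * b t) * (b m / b m)); last by ring.
  rewrite divff ?gt_eqF// mulr1 ler_pM2r ?b_gt0// /D -mulrA ler_pM2l// -expRD ler_expR.
  rewrite -[X in _ <= X + _]mulr1 -mulrDr ler_pM2l// lm.
  have ls : 0 <= ln s by exact: ln_ge0.
  have lt : ln t <= 0 by rewrite ln_le0// ltW.
  rewrite [X in _ <= 1 + X]ger0_norm ?subr_ge0 ?(le_trans lt)//.
  by rewrite ler_norml; apply/andP; split; lra.
- rewrite mulr1 (le_trans ex1)// ler_peMl ?ltW//.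
  by rewrite -/K /K; lra.
Qed.

Variables (dl g : R).
Hypothesis dl0 : 0 < dl.

(** [rw] with free exponents; [rw p0 p1 a0 a1] is [rn (gap p0 p1) (a0 - a1)] by conversion, and
    later proofs identify the two without rewriting. *)
Definition rn (n : nat) : R := ew dl n * wt g n.

Lemma rn_gt0 n : 0 < rn n. Proof. by rewrite mulr_gt0// ?ew_gt0 ?wt_gt0. Qed.

Lemma ln_rn n : ln (rn n) = - (dl * n%:R) + g * ln n.+1%:R.
Proof. by rewrite lnM ?posrE ?ew_gt0 ?wt_gt0// expRK ln_powR. Qed.

Lemma ln_rn_lip n m : `|ln (rn n) - ln (rn m)| <= (dl + `|g|) * `|n%:R - m%:R|.
Proof.
rewrite !ln_rn (_ : _ - _ = - (dl * (n%:R - m%:R)) + g * (ln n.+1%:R - ln m.+1%:R)); last by ring.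
apply: le_trans (ler_normD _ _) _; rewrite mulrDl normrN !normrM (gtr0_norm dl0).
rewrite lerD2l ler_wpM2l//.
apply: (@le_trans _ _ (ln (1 + `|n%:R - m%:R|))).
  by rewrite ler_norml lerNl opprB ln_ratio distrC ln_ratio.
by apply: le_ln1Dx; apply: lt_le_trans (normr_ge0 _); rewrite oppr_lt0.
Qed.

Definition Bn (n : nat) : R := sv_ext b (rn n).

Lemma Bn_gt0 n : 0 < Bn n. Proof. by rewrite sv_ext_gt0// rn_gt0. Qed.

(** [ln r_n] is Lipschitz in [n] with constant [dl + |g|], so slope [eps / (dl + |g|)] in [ln r_n]
    becomes slope [eps] in [n]. *)
Lemma regvar_Bn : regvar 0 Bn.
Proof.
split=> [n|eps e0]; first exact: Bn_gt0.
pose K := dl + `|g|; have K0 : 0 < K by rewrite ltr_pwDl.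
have [C C0 hC] := sv_ext_slow (divr_gt0 e0 K0).
exists C => // n m; apply: le_trans (hC _ _ (rn_gt0 n) (rn_gt0 m)) _.
rewrite ler_pM2r ?Bn_gt0// ler_pM2l// ler_expR oppr0 mul0r add0r.
rewrite -mulrA ler_pM2l// mulrC ler_pdivrMr// mulrC.
exact: ln_rn_lip.
Qed.

Lemma regvar_rn : regvar dl rn. Proof. exact: regvar_ewwt. Qed.

Lemma brho_Bn : exists2 C : R, 0 < C & forall k u, cell k u ->
  sv_ext b (u `^ dl * ell g u) <= C * Bn k /\ Bn k <= C * sv_ext b (u `^ dl * ell g u).
Proof.
have [C C0 hC] := sv_ext_slow ltr01.
(* On [cell k], replacing [u] by [e^-k] changes [ln rho] by at most [dl] through the power and by at
   most [|g| ln 2] through [ell]. *)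
exists (C * expR (dl + `|g| * ln 2)); first by rewrite mulr_gt0// expR_gt0.
move=> k u ku; have u0 := cell_gt0 ku.
have /andP[ku1 ku2] : k%:R < - ln u <= k.+1%:R by exact/cellP.
have lu0 : `|ln u| = - ln u by rewrite ler0_norm// ln_le0// ltW// (cell_lt1 ku).
have x0 : 0 < 1 - ln u by rewrite ltr_pwDl// (le_trans _ (ltW ku1)).
have rho0 : 0 < u `^ dl * ell g u by rewrite mulr_gt0 ?powR_gt0// lu0.
have lrho : ln (u `^ dl * ell g u) = dl * ln u + g * ln (1 - ln u).
  by rewrite lnM ?posrE ?powR_gt0 ?lu0// !ln_powR lu0.
have k0 : (0 < k.+1%:R :> R) by [].
have h1 : ln (k.+1%:R) <= ln (1 - ln u).
  by rewrite ler_ln ?posrE// -natr1 addrC lerD2l ltW.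
have h2 : ln (1 - ln u) <= ln 2 + ln k.+1%:R.
  rewrite -lnM ?posrE// ler_ln ?posrE ?mulr_gt0//.
  have : (1 <= k.+1%:R :> R) by rewrite ler1n.
  lra.
have key : `|ln (u `^ dl * ell g u) - ln (rn k)| <= dl + `|g| * ln 2.
  rewrite lrho ln_rn.
  rewrite (_ : _ - _ = dl * (ln u + k%:R) + g * (ln (1 - ln u) - ln k.+1%:R)); last by ring.
  apply: le_trans (ler_normD _ _) _; rewrite !normrM (gtr0_norm dl0) lerD//.
    rewrite -(natr1 k) in ku2; rewrite -[leRHS]mulr1 ler_pM2l// ler_norml.
    by apply/andP; split; lra.
  by rewrite ler_wpM2l// ger0_norm ?subr_ge0// lerBlDr.
have aux s t : 0 < s -> 0 < t -> `|ln s - ln t| <= dl + `|g| * ln 2 ->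
    sv_ext b s <= C * expR (dl + `|g| * ln 2) * sv_ext b t.
  move=> s0 t0 st; apply: le_trans (hC _ _ s0 t0) _.
  by rewrite ler_pM2r ?sv_ext_gt0// ler_pM2l// ler_expR mul1r.
by split; apply: aux; rewrite ?rn_gt0// distrC.
Qed.

End SlowVariation.

(** * The change of variables t = rho(u) *)

Section ChangeOfVariables.
Local Open Scope ereal_scope.
Context {R : realType} {T : Type}.
Variables (b : R -> R) (dl g theta : R) (E : (R -> \bar R) -> \bar R).
Variables (Y0 Y1 : @funspace R T).
Hypotheses (hb : slowly_varying b) (dl0 : (0 < dl)%R) (hE : is_ri_norm E).
Hypotheses (n0 : forall f, 0 <= fnorm Y0 f) (n1 : forall f, 0 <= fnorm Y1 f).
Implicit Types (f : T -> R) (s t : R).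
Local Notation r := (rn dl g).

(** The extension of [b] enters because [r n] may exceed 1 for small [n], even though the
    interpolation norm lives on (0,1). *)
Let phi f t : \bar R := (t `^ (- theta) * sv_ext b t)%:E * Kfun Y0 Y1 t f.

Let phi_ge0 f t : (0 < t)%R -> 0 <= phi f t.
Proof.
move=> t0; rewrite mule_ge0 ?Kfun_ge0 ?(ltW t0)//.
by rewrite lee_fin mulr_ge0 ?powR_ge0// ltW// sv_ext_gt0.
Qed.

Let phi_near (D : R) : (0 <= D)%R -> exists2 C : R, (0 < C)%R & forall f s t,
  (0 < s)%R -> (0 < t)%R -> (`|ln s - ln t| <= D)%R -> phi f s <= C%:E * phi f t.
Proof.
move=> D0; have [C C0 hC] := sv_ext_slow hb ltr01.
exists (expR (`|theta| * D) * (C * expR D) * expR D)%R.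
  by rewrite !mulr_gt0// expR_gt0.
move=> f s t s0 t0 st.
have hK : Kfun Y0 Y1 s f <= (expR D)%:E * Kfun Y0 Y1 t f.
  apply: Kfun_le => //; [by rewrite -expR0 ler_expR|exact: ltW|].
  rewrite -{1}(@lnK _ s) ?posrE// -{1}(@lnK _ t) ?posrE// -expRD ler_expR.
  by rewrite -lerBlDr; apply: le_trans (ler_norm _) st.
have hB : (sv_ext b s <= C * expR D * sv_ext b t)%R.
  apply: le_trans (hC _ _ s0 t0) _; rewrite ler_pM2r ?sv_ext_gt0// ler_pM2l//.
  by rewrite ler_expR mul1r.
have hP : (s `^ (- theta) <= expR (`|theta| * D) * t `^ (- theta))%R.
  rewrite !powR_expR_ln// -expRD ler_expR -lerBlDr -mulrBr.
  apply: le_trans (ler_norm _) _; rewrite normrM normrN.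
  by rewrite ler_wpM2l.
have s1 : (0 <= s `^ (- theta) * sv_ext b s)%R.
  by rewrite mulr_ge0 ?powR_ge0// ltW// sv_ext_gt0.
apply: (@le_trans _ _ ((expR (`|theta| * D) * t `^ (- theta) * (C * expR D * sv_ext b t))%:E
    * ((expR D)%:E * Kfun Y0 Y1 t f))).
  apply: lee_pmul; rewrite ?Kfun_ge0 ?(ltW s0)//.
  by rewrite lee_fin ler_pM ?powR_ge0// ltW// sv_ext_gt0.
rewrite /phi !muleA -!EFinM lee_wpmul2r ?Kfun_ge0 ?(ltW t0)// lee_fin.
by rewrite le_eqVlt; apply/orP; left; apply/eqP; ring.
Qed.

Let A f (k : nat) := phi f (expR (- k%:R)).

Let A_ge0 f k : 0 <= A f k. Proof. exact: phi_ge0 (expR_gt0 _). Qed.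

Let interp_normE f : interp_norm Y0 Y1 theta b E f = tnorm E `]0%R, 1%R[ (phi f).
Proof.
rewrite /interp_norm /tnorm; congr (E (rearrangement _ _)); apply/funext => t.
rewrite !patchE; case: ifPn => // /set_mem /=; rewrite in_itv/= => /andP[_ t1].
by rewrite /phi /sv_ext t1.
Qed.

Let interp_A : exists2 C : R, (0 < C)%R & forall f,
  interp_norm Y0 Y1 theta b E f <= C%:E * E (step (A f)) /\
  E (step (A f)) <= C%:E * interp_norm Y0 Y1 theta b E f.
Proof.
have [C C0 hC] := phi_near ler01; exists C => // f.
have cl k t : cell k t -> (`|ln t - ln (expR (- k%:R))| <= 1)%R.
  move=> kt; have t0 := cell_gt0 kt.
  have /andP[ku1 ku2] : (k%:R < - ln t <= k.+1%:R)%R by exact/cellP.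
  rewrite -(natr1 k) in ku2; rewrite expRK ler_norml.
  by apply/andP; split; lra.
have hr := ri_rearr_norm hE.
rewrite interp_normE; split.
  rewrite -(M_scale hE (ltW C0))//; apply: tnorm_le => //.
  - by move=> k; rewrite mule_ge0// lee_fin ltW.
  - move=> k t kt _; have t0 := cell_gt0 kt.
    rewrite gee0_abs ?phi_ge0//; apply: hC => //; exact: cl.
have Ci : (0 < C^-1)%R by rewrite invr_gt0.
have h : C^-1%:E * E (step (A f)) <= tnorm E `]0%R, 1%R[ (phi f).
  rewrite -(M_scale hE (ltW Ci))//; apply: tnorm_ge => //.
    by move=> k; rewrite mule_ge0// lee_fin ltW.
  move=> k t kt _; have t0 := cell_gt0 kt.
  split; first by rewrite in_itv/= t0 (cell_lt1 kt).
  rewrite gee0_abs ?phi_ge0//.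
  have : A f k <= C%:E * phi f t.
    by apply: hC => //; rewrite distrC; exact: cl.
  have Ci' : 0 <= C^-1%:E :> \bar R by rewrite lee_fin ltW.
  move=> /(lee_wpmul2l Ci') /le_trans; apply.
  by rewrite [leLHS]muleA -EFinM mulVf ?gt_eqF// mul1e.
have C0' : 0 <= C%:E :> \bar R by rewrite lee_fin ltW.
by have := lee_wpmul2l C0' h; rewrite muleA -EFinM mulfV ?gt_eqF// mul1e.
Qed.

Let y (n : nat) : R := (- ln (r n))%R.

Let y0E : y 0 = 0%R.
Proof. by rewrite /y ln_rn mulr0 ln1 mulr0 oppr0 addr0 oppr0. Qed.

Let K1 : R := (dl + `|g|)%R.

Let y_step n : (`|y n.+1 - y n| <= K1)%R.
Proof.
rewrite /y -opprD normrN; apply: le_trans (ln_rn_lip _ dl0 _ _) _.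
by rewrite -natr1 addrAC subrr add0r normr1 mulr1.
Qed.

(** Half of the slope [dl] survives the logarithmic term; the additive constant allows for an
    initial stretch where [y] may decrease. *)
Let y_grow : exists2 K : R, (0 <= K)%R & forall m n : nat, (m <= n)%N ->
  (dl / 2 * (n%:R - m%:R) - K <= y n - y m)%R.
Proof.
have [_ h] := regvar_rn dl g; have [C C0 hC] := h _ (divr_gt0 dl0 (ltr0n _ 2)).
exists `|ln C|%R => // m n mn.
have h3 := hC n m; rewrite -(@lnK _ C) ?posrE// -(@lnK _ (r n)) ?posrE ?rn_gt0// in h3.
rewrite -(@lnK _ (r m)) ?posrE ?rn_gt0// -!expRD ler_expR in h3.
rewrite ger0_norm ?subr_ge0 ?ler_nat// in h3.
have h2 := ler_norm (ln C).
by rewrite /y; lra.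
Qed.

(** Each [r n] is within bounded logarithmic distance of some [e^-(j n)], and each [e^-k] of some
    [r (nk k)]. Both index maps have fibres of bounded diameter, so [phi_near] and [M_finite_mult]
    give both inequalities without inverting [rho]. *)
Let phir_A : exists2 C : R, (0 < C)%R & forall f,
  E (step (fun n => phi f (r n))) <= C%:E * E (step (A f)) /\
  E (step (A f)) <= C%:E * E (step (fun n => phi f (r n))).
Proof.
have [K2 K20 hK2] := y_grow.
have K1_ge0 : (0 <= K1)%R by rewrite addr_ge0// ltW.
(* [D] covers all discrepancies: [K2] where [y n] is negative, [K1] for the overshoot of [nk], and 1
   for rounding down. *)
pose D := (K2 + K1 + 1)%R; have D0 : (0 <= D)%R by rewrite addr_ge0// addr_ge0.
have [C C0 hC] := phi_near D0.
have r0 n : (0 < r n)%R by exact: rn_gt0.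
have e0 (k : nat) : (0 < expR (- k%:R) :> R)%R by exact: expR_gt0.
pose j n := Num.truncn (y n).
have jy n : (`|(j n)%:R - y n| <= D)%R.
  case: (leP 0%R (y n)) => yn.
    have /andP[h1 h2] := truncn_itv yn.
    rewrite -(natr1 (Num.truncn _)) in h2; rewrite ler_norml /j /D.
    by apply/andP; split; lra.
  have -> : j n = 0%N by apply/truncn0Pn; rewrite -ltNge (lt_trans yn).
  have := hK2 0%N n (leq0n n); rewrite y0E !subr0.
  have : (0 <= dl / 2 * n%:R)%R by rewrite mulr_ge0// divr_ge0// ltW.
  by rewrite add0r normrN ltr0_norm// /D; lra.
(* If [j n = j n'], then [y n] and [y n'] differ by at most [2 D], and [y_grow] bounds [n' - n]. *)
pose m0 := (Num.truncn ((2 * D + K2) * (2 / dl))).+1.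
have jm n n' : j n = j n' -> (n' <= n + m0)%N.
  move=> jj; case: (leqP n' n) => nn'; first exact: leq_trans nn' (leq_addr _ _).
  have h1 := hK2 _ _ (ltnW nn'); have h2 := jy n; have h3 := jy n'.
  rewrite jj in h2; rewrite !ler_norml in h2 h3.
  have h4 : (dl / 2 * (n'%:R - n%:R) <= 2 * D + K2)%R by move: h1 h2 h3; lra.
  have h5 : (n'%:R - n%:R <= (2 * D + K2) * (2 / dl))%R.
    rewrite -(@ler_pM2l _ (dl / 2)) ?divr_gt0//; apply: (le_trans h4).
    rewrite le_eqVlt; apply/orP; left; apply/eqP; field; exact: lt0r_neq0.
  have := le_lt_trans h5 (truncnS_gt _).
  by rewrite ltrBlDl -natrD ltr_nat => /ltnW.
have yex k : exists n, (k%:R <= y n)%R.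
  exists (Num.truncn ((k%:R + K2) * (2 / dl))).+1.
  have := truncnS_gt ((k%:R + K2) * (2 / dl)).
  set N := (Num.truncn _).+1 => hN.
  have := hK2 0%N N (leq0n N); rewrite y0E !subr0.
  have : (k%:R + K2 <= dl / 2 * N%:R)%R.
    rewrite -(@ler_pM2r _ (2 / dl)) ?divr_gt0//.
    rewrite [leRHS](_ : _ = N%:R)%R ?ltW//; field; exact: lt0r_neq0.
  lra.
(* At the first index where [y] reaches [k], the bound on its steps keeps it below [k + K1]. *)
pose nk k := ex_minn (yex k).
have nky k : (k%:R <= y (nk k) <= k%:R + K1)%R.
  rewrite /nk; case: ex_minnP => n kn hmin; rewrite kn/=.
  case: n kn hmin => [|n] kn hmin.
    by rewrite y0E addr_ge0.
  have : (y n < k%:R)%R by rewrite ltNge; apply/negP => /hmin; rewrite ltnn.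
  by have := y_step n; rewrite ler_norml; lra.
pose m1 := (Num.truncn K1).+1.
have nm k k' : nk k = nk k' -> (k' <= k + m1)%N.
  move=> e; have := nky k; have := nky k'; rewrite e => /andP[h1 _] /andP[_ h2].
  have : (k'%:R < k%:R + (Num.truncn K1).+1%:R :> R)%R.
    by apply: le_lt_trans (le_trans h1 h2) _; rewrite ltrD2l truncnS_gt.
  by rewrite -natrD ltr_nat => /ltnW.
exists (C * m0.+1%:R + C * m1.+1%:R)%R.
  by rewrite addr_gt0// mulr_gt0.
move=> f; have phir0 n : 0 <= phi f (r n) by exact: phi_ge0.
have C0' : (0 <= C)%R by exact: ltW.
split.
  apply: (@lec_weak _ (C * m0.+1%:R)); first exact: M_ge0.
    by rewrite lerDl mulr_ge0.
  apply: (lec_trans C0' _ (M_finite_mult hE (A_ge0 f) jm)).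
  rewrite -(M_scale hE C0'); last by move=> n; exact: A_ge0.
  apply: M_mono => // n; apply: hC => //.
  by rewrite expRK opprK -[X in (X + _)%R]opprK -/(y n) addrC.
apply: (@lec_weak _ (C * m1.+1%:R)); first exact: M_ge0.
  by rewrite lerDr mulr_ge0.
apply: (lec_trans C0' _ (M_finite_mult hE phir0 nm)).
rewrite -(M_scale hE C0'); last by move=> n; exact: phir0.
apply: M_mono => // k; apply: hC => //.
rewrite expRK -/(y _) addrC.
have /andP[h1 h2] := nky k.
by rewrite -/(y (nk k)) /D ler_norml; apply/andP; split; lra.
Qed.

Lemma interp_norm_change : exists2 C : R, (0 < C)%R & forall f,
  interp_norm Y0 Y1 theta b E f <=
    C%:E * E (step (fun n => (r n `^ (- theta) * Bn b dl g n)%:E * Kfun Y0 Y1 (r n) f)) /\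
  E (step (fun n => (r n `^ (- theta) * Bn b dl g n)%:E * Kfun Y0 Y1 (r n) f)) <=
    C%:E * interp_norm Y0 Y1 theta b E f.
Proof.
have [C C0 hC] := interp_A; have [D D0 hD] := phir_A.
exists (C * D + D * C)%R; first by rewrite addr_gt0// mulr_gt0.
have CD : (0 < C * D)%R by rewrite mulr_gt0.
have DC : (0 < D * C)%R by rewrite mulr_gt0.
move=> f; have [c1 c2] := hC f; have [d1 d2] := hD f; split.
  apply: (@lec_weak _ (C * D)); rewrite ?lerDl ?(ltW DC)//.
    by apply: M_ge0 => // n; exact: phi_ge0 (rn_gt0 _ _ _).
  exact: lec_trans (ltW C0) c1 d2.
apply: (@lec_weak _ (D * C)); rewrite ?lerDr ?(ltW CD)//.
  by apply: (ri_ge0 hE); exact: rearrangement_nneg.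
exact: lec_trans (ltW D0) d1 c2.
Qed.

End ChangeOfVariables.

(** * Weighted Hardy inequalities *)

Section WeightedInequalities.
Local Open Scope ereal_scope.
Context {R : realType}.
Variables (b : R -> R) (p0 p1 a0 a1 theta : R) (E : (R -> \bar R) -> \bar R).
Hypotheses (hb : slowly_varying b) (hE : is_ri_norm E).
Hypotheses (hp0 : (1 < p0)%R) (hp01 : (p0 < p1)%R) (ha0 : (0 < a0)%R) (ha1 : (0 < a1)%R).
Implicit Types (h : nat -> \bar R).

Let dl := gap p0 p1.
Let r := rw p0 p1 a0 a1.
Let B := Bn b dl (a0 - a1).

(* The weight [t^(-theta) b(t)] at [t = rho(e^-n)]. *)
Definition vw (n : nat) : R := (r n `^ (- theta) * B n)%R.

Definition Ww (n : nat) : R := (vw n * wt a0 n * ew p0^-1 n)%R.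

Let dl0 : (0 < dl)%R. Proof. exact: gap_gt0. Qed.
Let p0_gt0 : (0 < p0)%R. Proof. exact: lt_trans hp0. Qed.
Let p1_gt1 : (1 < p1)%R. Proof. exact: lt_trans hp01. Qed.
Let p1_gt0 : (0 < p1)%R. Proof. exact: lt_trans p1_gt1. Qed.

Lemma rn_powR (c s t : R) n : (rn c s n `^ t = ew (t * c) n * wt (t * s) n)%R.
Proof.
rewrite /rn powRM ?(ltW (ew_gt0 _ _)) ?(ltW (wt_gt0 _ _))//; congr (_ * _)%R.
  by rewrite /ew -expRM; congr expR; ring.
by rewrite /wt -powRrM mulrC.
Qed.

Lemma vw_gt0 n : (0 < vw n)%R.
Proof. by rewrite mulr_gt0 ?powR_gt0 ?rw_gt0// Bn_gt0. Qed.

Lemma Ww_gt0 n : (0 < Ww n)%R.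
Proof. by rewrite mulr_gt0 ?ew_gt0// mulr_gt0 ?wt_gt0 ?vw_gt0. Qed.

(** The exponent governs the case distinction: for [theta > 0] the weight [vw] grows, at [theta = 0]
    it is only slowly varying, and [vw * r], with exponent [(1 - theta) dl], decays as long as
    [theta < 1]. *)
Let regvar_vw : regvar (- theta * dl)%R vw.
Proof.
have h := regvar_mul (regvar_ewwt (- theta * dl) (- theta * (a0 - a1))) (regvar_Bn hb (a0 - a1) dl0).
rewrite addr0 in h; rewrite (_ : vw = (fun n => ew (- theta * dl) n * wt (- theta * (a0 - a1)) n * Bn b dl (a0 - a1) n)%R)//.
by apply/funext => n; rewrite /vw -rn_powR.
Qed.

Let vE_ge0 n : 0 <= (vw n)%:E :> \bar R. Proof. by rewrite lee_fin ltW// vw_gt0. Qed.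
Let WE_ge0 n : 0 <= (Ww n)%:E :> \bar R. Proof. by rewrite lee_fin ltW// Ww_gt0. Qed.
Let rE_ge0 n : 0 <= (r n)%:E :> \bar R. Proof. by rewrite lee_fin ltW// rw_gt0. Qed.

Lemma Wh_le_vQ h n : (forall k, 0 <= h k) ->
  (Ww n)%:E * h n <= (vw n)%:E * Qf a0 p0 h n.
Proof.
move=> h0; rewrite /Ww /Qf; move: (vw n) (vE_ge0 n) => v v0.
by rewrite !EFinM -!muleA lee_wpmul2l// lee_wpmul2l ?wtE_ge0// Gf_term.
Qed.

Lemma Wh_le_vR : exists2 C : R, (0 < C)%R & forall h n, (forall k, 0 <= h k) ->
  (Ww n)%:E * h n <= C%:E * ((vw n * r n)%:E * Rf a1 p1 h n).
Proof.
have [C C0 hC] := Rf_ge_term ha1 p1_gt0; exists C => // h n h0.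
have vr0 : 0 <= (vw n * r n)%:E :> \bar R by rewrite EFinM mule_ge0.
have hh := lee_wpmul2l vr0 (hC h n h0).
rewrite [leRHS]muleCA; apply: le_trans hh; rewrite !muleA -!EFinM.
rewrite (_ : (vw n * r n * wt a1 n * ew p1^-1 n)%R = Ww n)//.
rewrite -[in LHS](mulrA (vw n)) rw_wt /Ww (ew_gap p0 p1); ring.
Qed.

(** Bounding [l_p0] by [l_1] turns [Q_k] into a sum over [j >= k] of [W_j h_j] with kernel
    [z_k / z_j], where [z = vw * wt a0]. It is geometric because [z] grows, so [Hardy_up]
    applies. *)
Lemma vQ_le_Wh : (0 < theta)%R -> exists2 C : R, (0 < C)%R &
  forall h, (forall k, 0 <= h k) ->
  E (step (fun n => (vw n)%:E * Qf a0 p0 h n)) <=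
    C%:E * E (step (fun n => (Ww n)%:E * h n)).
Proof.
move=> th0; have hz : regvar (- theta * dl)%R (fun n => vw n * wt a0 n)%R.
  by have := regvar_mul regvar_vw (regvar_wt a0); rewrite addr0.
have c0 : (- theta * dl < 0)%R by rewrite mulNr oppr_lt0 mulr_gt0.
have [q /andP[q0 q1] [C C0 hC]] := regvar_grow hz c0.
exists (C * (1 - q)^-1)%R; first by rewrite mulr_gt0// invr_gt0 subr_gt0.
move=> h h0; have q01 : (0 <= q < 1)%R by rewrite ltW.
have x0 k : 0 <= (Ww k)%:E * h k by rewrite mule_ge0.
apply: (lec_trans (ltW C0) _ (Hardy_up hE q01 x0)).
have m0 k j : 0 <= (if (k <= j)%N then (q ^+ (j - k))%:E * ((Ww j)%:E * h j) else 0).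
  by apply: mask_ge0; rewrite mule_ge0// lee_fin exprn_ge0// ltW.
rewrite -(M_scale hE (ltW C0)); last by move=> k; exact: ser_ge0.
apply: (M_mono hE) => k; first by rewrite mule_ge0// Qf_ge0.
rewrite /Qf muleA -EFinM.
have zk0 : 0 <= (vw k * wt a0 k)%:E :> \bar R by rewrite EFinM mule_ge0// wtE_ge0.
apply: le_trans (lee_wpmul2l zk0 (Gf_le_sum h0 _ (ltW hp0))) _.
rewrite -!ser_scale ?(ltW C0)//; last first.
  by move=> j; apply: mask_ge0; rewrite mule_ge0// ewE_ge0.
apply: le_ser => j; first by rewrite mule_ge0//; apply: mask_ge0; rewrite mule_ge0// ewE_ge0.
case: leqP => kj; last by rewrite !mule0.
rewrite !muleA -!EFinM lee_wpmul2r// lee_fin /Ww mulrA.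
by rewrite ler_pM2r ?ew_gt0//; exact: hC.
Qed.

(** [(1+n)^(a0-1) <= (1+n)^a0] bounds [P_k] by the sum of [Q_n] over [n >= k], and the growth of
    [vw] makes the kernel geometric. *)
Lemma vP_le_vQ : (0 < theta)%R -> exists2 C : R, (0 < C)%R &
  forall h, (forall k, 0 <= h k) ->
  E (step (fun n => (vw n)%:E * Pf a0 p0 h n)) <=
    C%:E * E (step (fun n => (vw n)%:E * Qf a0 p0 h n)).
Proof.
move=> th0; have c0 : (- theta * dl < 0)%R by rewrite mulNr oppr_lt0 mulr_gt0.
have [q /andP[q0 q1] [C C0 hC]] := regvar_grow regvar_vw c0.
exists (C * (1 - q)^-1)%R; first by rewrite mulr_gt0// invr_gt0 subr_gt0.
move=> h h0; have q01 : (0 <= q < 1)%R by rewrite ltW.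
have x0 k : 0 <= (vw k)%:E * Qf a0 p0 h k by rewrite mule_ge0// Qf_ge0.
apply: (lec_trans (ltW C0) _ (Hardy_up hE q01 x0)).
have m0 k j : 0 <= (if (k <= j)%N then (q ^+ (j - k))%:E * ((vw j)%:E * Qf a0 p0 h j) else 0).
  by apply: mask_ge0; rewrite mule_ge0// lee_fin exprn_ge0// ltW.
rewrite -(M_scale hE (ltW C0)); last by move=> k; exact: ser_ge0.
apply: (M_mono hE) => k; first by rewrite mule_ge0// Pf_ge0.
rewrite -!ser_scale ?(ltW C0) ?(ltW (vw_gt0 _))//; last first.
  by move=> j; apply: mask_ge0; exact: wGf_ge0.
apply: le_ser => j; first by rewrite mule_ge0//; apply: mask_ge0; exact: wGf_ge0.
case: leqP => kj; last by rewrite !mule0.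
apply: (@le_trans _ _ ((vw k)%:E * Qf a0 p0 h j)).
  rewrite lee_wpmul2l// lee_wpmul2r ?Gf_ge0// lee_fin; apply: wt_le.
  by rewrite gerBl.
move: (Qf a0 p0 h j) (Qf_ge0 a0 p0 h j) => X X0.
by rewrite !muleA -!EFinM lee_wpmul2r// lee_fin; exact: hC.
Qed.

(** With [z = vw * r * wt a1], [rw_wt] gives [W_j = z_j e^(-j/p1)]. By [Rf_le_sum] the kernel over
    [j <= k] is [z_k / z_j], geometric because [z] decays, so [Hardy_down] applies. *)
Lemma vR_le_Wh : (theta < 1)%R -> exists2 C : R, (0 < C)%R &
  forall h, (forall k, 0 <= h k) ->
  E (step (fun n => (vw n * r n)%:E * Rf a1 p1 h n)) <=
    C%:E * E (step (fun n => (Ww n)%:E * h n)).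
Proof.
move=> th1; pose z n := (vw n * (r n * wt a1 n))%R.
have hz : regvar ((1 - theta) * dl)%R z.
  have h1 := regvar_mul regvar_vw (regvar_mul (regvar_rw p0 p1 a0 a1) (regvar_wt a1)).
  by rewrite (_ : (1 - theta) * dl = - theta * dl + (gap p0 p1 + 0))%R//; rewrite /dl; ring.
have c0 : (0 < (1 - theta) * dl)%R by rewrite mulr_gt0// subr_gt0.
have [q /andP[q0 q1] [C C0 hC]] := regvar_decay hz c0.
have [D D0 hD] := Rf_le_sum ha1 (ltW p1_gt1).
exists (D * C * (1 - q)^-1)%R; first by rewrite !mulr_gt0// invr_gt0 subr_gt0.
move=> h h0; have q01 : (0 <= q < 1)%R by rewrite ltW.
have x0 k : 0 <= (Ww k)%:E * h k by rewrite mule_ge0.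
have DC0 : (0 <= D * C)%R by rewrite mulr_ge0 ?ltW.
apply: (lec_trans DC0 _ (Hardy_down hE q01 x0)).
have m0 k j : 0 <= (if (j <= k)%N then (q ^+ (k - j))%:E * ((Ww j)%:E * h j) else 0).
  by apply: mask_ge0; rewrite mule_ge0// lee_fin exprn_ge0// ltW.
rewrite -(M_scale hE DC0); last by move=> k; exact: ser_ge0.
have vr0 k : 0 <= (vw k * r k)%:E :> \bar R by rewrite EFinM mule_ge0.
apply: (M_mono hE) => k; first by rewrite mule_ge0// Rf_ge0.
apply: le_trans (lee_wpmul2l (vr0 k) (hD h k h0)) _.
have c00 : (0 <= vw k * r k * (D * wt a1 k))%R.
  apply: mulr_ge0; last by rewrite mulr_ge0 ?(ltW D0)// ltW// wt_gt0.
  by rewrite -lee_fin.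
rewrite muleA -EFinM -!ser_scale ?DC0//; last first.
  by move=> j; apply: mask_ge0; rewrite mule_ge0// ewE_ge0.
apply: le_ser => j.
  rewrite mule_ge0//; by apply: mask_ge0; rewrite mule_ge0// ewE_ge0.
case: leqP => jk; last by rewrite !mule0.
rewrite !muleA -!EFinM lee_wpmul2r// lee_fin.
rewrite (_ : Ww j = z j * ew p1^-1 j)%R; last first.
  by rewrite /z /r rw_wt /Ww (ew_gap p0 p1); ring.
rewrite (_ : (vw k * r k * (D * wt a1 k) = D * z k)%R); last by rewrite /z; ring.
move: (z j) (z k) (hC _ _ jk) => zj zk zjk.
rewrite (_ : D * C * _ * _ = D * (C * q ^+ (k - j) * zj) * ew p1^-1 j)%R; last by ring.
by rewrite ler_pM2r ?ew_gt0// ler_pM2l.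
Qed.

(** Supplies membership in the larger space. By [M_fin] the [W_j h_j] are bounded, so
    [e^(-j/p0) h_j] is at most a multiple of [1 / (vw_j (1+j)^a0)]. This decays geometrically for
    [theta > 0] and can be summed twice, over [j] in [Gf] and over [n] in [Sf]. *)
Lemma Sf_fin_of_Wh h : (0 < theta)%R -> (forall k, 0 <= h k) ->
  E (step (fun n => (Ww n)%:E * h n)) < +oo -> Sf a0 p0 h < +oo.
Proof.
move=> th0 h0 fin; have x0 k : 0 <= (Ww k)%:E * h k by rewrite mule_ge0.
have [X X0 hX] := M_fin hE x0 fin.
have hz : regvar (- theta * dl)%R (fun n => vw n * wt a0 n)%R.
  by have := regvar_mul regvar_vw (regvar_wt a0); rewrite addr0.
have hzi := regvar_inv hz.
have tdl : (- (- theta * dl) = theta * dl)%R by rewrite mulNr opprK.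
rewrite tdl in hzi.
have c0 : (0 < theta * dl)%R by rewrite mulr_gt0.
have [C C0 hC] := regvar_ser_up hzi c0.
have hw : regvar (theta * dl)%R (fun n => wt (a0 - 1) n * (vw n * wt a0 n)^-1)%R.
  by have := regvar_mul (regvar_wt (a0 - 1)) hzi; rewrite add0r.
have [D D0 hD] := regvar_ser_up hw c0.
have hG n : Gf p0 h n <= (X * (C * (vw n * wt a0 n)^-1))%:E.
  apply: le_trans (Gf_le_sum h0 _ (ltW hp0)) _.
  have XE0 : 0 <= X%:E by rewrite lee_fin.
  rewrite EFinM; apply: le_trans (lee_wpmul2l XE0 (hC n)).
  have z0 j : (0 < vw j * wt a0 j)%R by rewrite mulr_gt0 ?vw_gt0 ?wt_gt0.
  rewrite -ser_scale//; last by move=> j; apply: mask_ge0; rewrite lee_fin invr_ge0 ltW.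
  apply: le_ser => j; first by apply: mask_ge0; rewrite mule_ge0// ewE_ge0.
  case: leqP => nj; last by rewrite mule0.
  have := hX j; rewrite /Ww EFinM -muleA => hj.
  have zi0 : 0 <= ((vw j * wt a0 j)^-1)%:E :> \bar R by rewrite lee_fin invr_ge0 ltW.
  have := lee_wpmul2l zi0 hj; rewrite muleA -EFinM mulVf ?gt_eqF// mul1e.
  by move=> /le_trans; apply; rewrite muleC.
have XC : (0 <= X * C)%R by rewrite mulr_ge0// ltW.
have S1 : Sf a0 p0 h <= (X * C)%:E * \sum_(n <oo) (if (0 <= n)%N then (wt (a0 - 1) n * (vw n * wt a0 n)^-1)%:E else 0).
  rewrite -ser_scale//; last first.
    by move=> n; rewrite lee_fin mulr_ge0 ?(ltW (wt_gt0 _ _))// invr_ge0 mulr_ge0 ?(ltW (vw_gt0 _)) ?(ltW (wt_gt0 _ _)).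
  apply: le_ser => n; first exact: wGf_ge0.
  apply: le_trans (lee_wpmul2l (wtE_ge0 _ _) (hG n)) _.
  by rewrite /= -!EFinM lee_fin le_eqVlt; apply/orP; left; apply/eqP; ring.
apply: (le_lt_trans S1).
apply: (@le_lt_trans _ _ ((X * C)%:E * (D * (wt (a0 - 1) 0 * (vw 0 * wt a0 0)^-1))%:E)).
  by rewrite lee_wpmul2l ?lee_fin//; exact: hD.
by rewrite -EFinM ltry.
Qed.

(** Only part of the cell of [u] lies below [u], so an [LLL] norm sees [P] from the next index on;
    the lost term is at most [Q]. *)
Lemma Pf_step h k : Pf a0 p0 h k <= Pf a0 p0 h k.+1 + Qf a0 p0 h k.
Proof.
have w0 n : 0 <= (wt (a0 - 1) n)%:E * Gf p0 h n by exact: wGf_ge0.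
pose X := (wt (a0 - 1) k)%:E * Gf p0 h k.
apply: (@le_trans _ _ (Pf a0 p0 h k.+1 + X)); last first.
  rewrite leeD2l// lee_wpmul2r ?Gf_ge0// lee_fin; apply: wt_le.
  by rewrite gerBl.
have Xser : \sum_(n <oo) (if n == k then X else 0) <= X.
  apply: ser_le_ub => n; first by apply: mask_ge0; exact: w0.
  case: (ltnP k n) => kn.
    rewrite (bigD1 (Ordinal kn))//= eqxx big1 ?adde0// => i ik.
    by rewrite -val_eqE/= in ik; rewrite (negbTE ik).
  rewrite big1 ?w0// => i _; case: eqP => // ik.
  by have := ltn_ord i; rewrite ik ltnNge kn.
apply: le_trans (leeD2l _ Xser).
rewrite -ser_add; [|by move=> n; apply: mask_ge0; exact: w0..].
apply: le_ser => n; first by apply: mask_ge0; exact: w0.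
by case: (ltngtP n k) => [nk|kn|->]; rewrite ?adde0 ?add0e.
Qed.

(** The interpolation norm after the change of variables, with [K] replaced by [Phi]. *)
Definition Ntheta h : \bar R := E (step (fun n => (vw n)%:E * Phi p0 p1 a0 a1 h n)).

Let P0 h n : 0 <= (vw n)%:E * Pf a0 p0 h n. Proof. by rewrite mule_ge0// Pf_ge0. Qed.
Let Q0 h n : 0 <= (vw n)%:E * Qf a0 p0 h n. Proof. by rewrite mule_ge0// Qf_ge0. Qed.
Let R0 h n : 0 <= (vw n * r n)%:E * Rf a1 p1 h n.
Proof. by rewrite mule_ge0 ?Rf_ge0// EFinM mule_ge0. Qed.

Let vPhiE h n : (vw n)%:E * Phi p0 p1 a0 a1 h n =
  (vw n)%:E * Pf a0 p0 h n + (vw n)%:E * Qf a0 p0 h n + (vw n * r n)%:E * Rf a1 p1 h n.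
Proof.
have pf0 := Pf_ge0 a0 p0 h n; have qf0 := Qf_ge0 a0 p0 h n.
have rf0 : 0 <= (r n)%:E * Rf a1 p1 h n by exact: mule_ge0 (rE_ge0 n) (Rf_ge0 _ _ _ _).
by rewrite /Phi (ge0_muleDr _ (adde_ge0 pf0 qf0) rf0) (ge0_muleDr _ pf0 qf0); congr (_ + _);
  rewrite (EFinM (vw n)); exact: muleA.
Qed.

Lemma Ntheta_le h : Ntheta h <= E (step (fun n => (vw n)%:E * Pf a0 p0 h n))
  + E (step (fun n => (vw n)%:E * Qf a0 p0 h n))
  + E (step (fun n => (vw n * r n)%:E * Rf a1 p1 h n)).
Proof.
rewrite /Ntheta; under eq_fun => n do rewrite vPhiE.
apply: (le_trans (M_add hE _ (R0 h))) => [n|]; first exact: adde_ge0.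
by rewrite leeD2r// (M_add hE (P0 h) (Q0 h)).
Qed.

Lemma vP_le_Ntheta h : E (step (fun n => (vw n)%:E * Pf a0 p0 h n)) <= Ntheta h.
Proof.
rewrite /Ntheta; apply: (M_mono hE (P0 h)) => n.
by rewrite vPhiE; apply: le_trans (leeDl _ (R0 h n)); exact: leeDl.
Qed.

Lemma vQ_le_Ntheta h : E (step (fun n => (vw n)%:E * Qf a0 p0 h n)) <= Ntheta h.
Proof.
rewrite /Ntheta; apply: (M_mono hE (Q0 h)) => n.
by rewrite vPhiE; apply: le_trans (leeDl _ (R0 h n)); exact: leeDr.
Qed.

Lemma vR_le_Ntheta h : E (step (fun n => (vw n * r n)%:E * Rf a1 p1 h n)) <= Ntheta h.
Proof.
rewrite /Ntheta; apply: (M_mono hE (R0 h)) => n.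
by rewrite vPhiE; apply: leeDr; exact: adde_ge0.
Qed.

Lemma Wh_le_vQ_norm h : (forall k, 0 <= h k) -> E (step (fun n => (Ww n)%:E * h n)) <=
  E (step (fun n => (vw n)%:E * Qf a0 p0 h n)).
Proof.
move=> h0; apply: (M_mono hE) => n; first by rewrite mule_ge0.
exact: Wh_le_vQ.
Qed.

Lemma Wh_le_vR_norm : exists2 C : R, (0 < C)%R & forall h, (forall k, 0 <= h k) ->
  E (step (fun n => (Ww n)%:E * h n)) <=
  C%:E * E (step (fun n => (vw n * r n)%:E * Rf a1 p1 h n)).
Proof.
have [C C0 hC] := Wh_le_vR; exists C => // h h0.
rewrite -(M_scale hE (ltW C0) (R0 h)); apply: (M_mono hE) => n.
  by rewrite mule_ge0.
exact: hC.
Qed.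

End WeightedInequalities.

(** * The interpolation spaces *)

Section FunctionSpaceNorms.
Local Open Scope ereal_scope.
Context {R : realType} {d} {T : measurableType d} (mu : probability T R).
Variables (E : (R -> \bar R) -> \bar R) (c : R -> R) (a p : R) (f : T -> R).

Let one_pf : (fun s : R => (s `^ p^-1 * 1)%:E * rearrangement mu (EFin \o f) s) = pf mu p f.
Proof. by apply/funext => s; rewrite mulr1. Qed.

Lemma LL_fnormE : fnorm (LL mu p c E (fun=> 1%R) (Lq p)) f =
  tnorm E `]0%R, 1%R[ (fun t => (c t)%:E * tnorm (Lq p) `]0%R, t[ (pf mu p f)).
Proof. by rewrite -one_pf. Qed.

Lemma LLL_fnormE : fnorm (LLL mu p c E (ell (a - 1)) (Lq 1) (fun=> 1%R) (Lq p)) f =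
  tnorm E `]0%R, 1%R[ (fun u => (c u)%:E *
    tnorm (Lq 1) `]0%R, u[ (midf mu a p f (fun t => `]0%R, t[))).
Proof. by rewrite /midf -one_pf. Qed.

Lemma LLR_fnormE : fnorm (LLR mu p c E (ell (a - 1)) (Lq 1) (fun=> 1%R) (Lq p)) f =
  tnorm E `]0%R, 1%R[ (fun u => (c u)%:E *
    tnorm (Lq 1) `]u, 1%R[ (midf mu a p f (fun t => `]u, t[))).
Proof. by rewrite /midf -one_pf. Qed.

End FunctionSpaceNorms.

Section Intersection.
Local Open Scope ereal_scope.
Context {R : realType} {T : Type} (X Y : @funspace R T) (f : T -> R).

Lemma fnorm_cap_lt z : (fnorm (space_cap X Y) f < z) = (fnorm X f < z) && (fnorm Y f < z).
Proof. exact: gt_max. Qed.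

Lemma fnorm_cap_le z : (fnorm (space_cap X Y) f <= z) = (fnorm X f <= z) && (fnorm Y f <= z).
Proof. exact: ge_max. Qed.

Lemma fnorm_capl : fnorm X f <= fnorm (space_cap X Y) f.
Proof. by have := lexx (fnorm (space_cap X Y) f); rewrite fnorm_cap_le => /andP[]. Qed.

Lemma fnorm_capr : fnorm Y f <= fnorm (space_cap X Y) f.
Proof. by have := lexx (fnorm (space_cap X Y) f); rewrite fnorm_cap_le => /andP[]. Qed.

Lemma carrier_cap (P : Prop) :
  (carrier X f <-> P /\ fnorm X f < +oo) -> (carrier Y f <-> P /\ fnorm Y f < +oo) ->
  carrier (space_cap X Y) f <-> P /\ fnorm (space_cap X Y) f < +oo.
Proof.
move=> hX hY; split=> [[/hX[h xf] /hY[_ yf]]|[h]].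
  by split=> //; rewrite fnorm_cap_lt xf yf.
by rewrite fnorm_cap_lt => /andP[xf yf]; split; [exact/hX|exact/hY].
Qed.

End Intersection.

(** * The three identities: interior theta, theta = 0 and theta = 1 *)

Section Interpolation.
Local Open Scope ereal_scope.
Context {R : realType} {d} {T : measurableType d} (mu : probability T R).
Variables (E : (R -> \bar R) -> \bar R) (b : R -> R) (p0 p1 alpha beta : R).
Hypotheses (hE : is_ri_norm E) (hb : slowly_varying b).
Hypotheses (hp0 : (1 < p0)%R) (hp01 : (p0 < p1)%R) (halpha : (0 < alpha)%R) (hbeta : (0 < beta)%R).
Implicit Types (f : T -> R) (g : R -> \bar R) (a : nat -> \bar R).

Let a0 := (alpha / conjexp p0)%R.
Let a1 := (beta / conjexp p1)%R.
Let Y0 := smallL mu p0 alpha.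
Let Y1 := smallL mu p1 beta.
Let dl := gap p0 p1.
Let r := rw p0 p1 a0 a1.
Let B := Bn b dl (a0 - a1).
Let brho (u : R) := sv_ext b (u `^ (p0^-1 - p1^-1) * ell (a0 - a1) u).

Let ha0 : (0 < a0)%R. Proof. by rewrite divr_gt0// conjexp_gt0. Qed.
Let ha1 : (0 < a1)%R. Proof. by rewrite divr_gt0// conjexp_gt0// (lt_trans hp0). Qed.
Let p0_gt0 : (0 < p0)%R. Proof. exact: lt_trans hp0. Qed.
Let p1_gt0 : (0 < p1)%R. Proof. exact: lt_trans hp01. Qed.
Let dl0 : (0 < dl)%R. Proof. exact: gap_gt0. Qed.

Let fs0 f k : 0 <= fstar mu f k. Proof. exact: fstar_ge0. Qed.

Lemma tnorm_le_step g a (C : R) : (0 < C)%R -> (forall k, 0 <= a k) ->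
  (forall k t, cell k t -> 0 <= g t /\ g t <= C%:E * a k) ->
  tnorm E `]0%R, 1%R[ g <= C%:E * E (step a).
Proof.
move=> C0 a_ge0 h; rewrite -(M_scale hE (ltW C0) a_ge0); apply: tnorm_le => //.
- exact: ri_rearr_norm.
- by move=> k; rewrite mule_ge0// lee_fin ltW.
- by move=> k t /h[g0 ga] _; rewrite gee0_abs.
Qed.

(** The offset [m] lets [a k] be tested on the later cell [m + k]; by [M_shift] moving a sequence to
    the right does not decrease its norm. *)
Lemma step_le_tnorm g a (C : R) (m : nat) : (0 < C)%R -> (forall k, 0 <= a k) ->
  (forall k t, cell (m + k) t -> 0 <= g t /\ a k <= C%:E * g t) ->
  E (step a) <= C%:E * tnorm E `]0%R, 1%R[ g.
Proof.
move=> C0 a_ge0 h; apply: (le_trans (M_shift hE m a_ge0)).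
pose a' k := if (m <= k)%N then a (k - m)%N else 0.
have a'0 k : 0 <= a' k by exact: mask_ge0.
have Ci : 0 <= C^-1%:E :> \bar R by rewrite lee_fin invr_ge0 ltW.
have h1 : C^-1%:E * E (step a') <= tnorm E `]0%R, 1%R[ g.
  rewrite -M_scale ?invr_ge0 ?(ltW C0)//; apply: tnorm_ge => //.
  - exact: ri_rearr_norm.
  - by move=> k; exact: mule_ge0.
  - move=> k t kt; rewrite /a'; case: leqP => [mk _|_]; last by rewrite mule0 ltxx.
    split; first by rewrite in_itv/= (cell_gt0 kt) (cell_lt1 kt).
    have [|g0 ga] := h (k - m)%N t; first by rewrite subnKC.
    rewrite gee0_abs//; apply: le_trans (lee_wpmul2l Ci ga) _.
    by rewrite muleA -EFinM mulVf ?gt_eqF// mul1e.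
have CE0 : 0 <= C%:E :> \bar R by rewrite lee_fin ltW.
by have := lee_wpmul2l CE0 h1; rewrite muleA -EFinM mulfV ?gt_eqF// mul1e.
Qed.

Let N theta f := Ntheta b p0 p1 a0 a1 theta E (fstar mu f).

Let v_ge0 theta n : 0 <= (vw b p0 p1 a0 a1 theta n)%:E.
Proof. by rewrite lee_fin ltW// vw_gt0. Qed.

Let vPhi_ge0 theta f n : 0 <= (vw b p0 p1 a0 a1 theta n)%:E * Phi p0 p1 a0 a1 (fstar mu f) n.
Proof. exact: mule_ge0 (v_ge0 _ _) (Phi_ge0 _ _ _ _ _ _). Qed.

Lemma interp_Ntheta theta : exists2 C : R, (0 < C)%R & forall f,
  (measurable_fun setT f -> Sf a0 p0 (fstar mu f) < +oo ->
    interp_norm Y0 Y1 theta b E f <= C%:E * N theta f) /\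
  N theta f <= C%:E * interp_norm Y0 Y1 theta b E f.
Proof.
have n0 f : 0 <= fnorm Y0 f by exact: smallL_ge0.
have n1 f : 0 <= fnorm Y1 f by exact: smallL_ge0.
have [C C0 hC] := interp_norm_change (a0 - a1) theta hb dl0 hE n0 n1.
have [D D0 hD] := Phi_le_Kfun mu hp0 hp01 halpha hbeta.
have [F F0 hF] := Kfun_le_Phi mu hp0 hp01 halpha hbeta.
exists (C * F + D * C)%R; first by rewrite addr_gt0// mulr_gt0.
have CF : (0 < C * F)%R by rewrite mulr_gt0.
have DC : (0 < D * C)%R by rewrite mulr_gt0.
move=> f; have [c1 c2] := hC f.
pose kf n := (vw b p0 p1 a0 a1 theta n)%:E * Kfun Y0 Y1 (r n) f.
have kf0 n : 0 <= kf n.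
  apply: mule_ge0 (v_ge0 _ _) _; apply: (Kfun_ge0 n0 n1).
  by apply: ltW; exact: rw_gt0.
have N0 : 0 <= N theta f by apply: (M_ge0 hE) => n; exact: vPhi_ge0.
split.
- move=> mf Sfin; apply: (@lec_weak _ (C * F)) => //; first by rewrite lerDl ltW.
  apply: (lec_trans (ltW C0) c1).
  rewrite -(M_scale hE (ltW F0) (vPhi_ge0 theta f)); apply: (M_mono hE kf0) => n.
  by rewrite muleCA; apply: (lee_wpmul2l (v_ge0 _ _)); exact: hF.
- apply: (@lec_weak _ (D * C)); rewrite ?lerDr ?(ltW CF)//.
    by apply: (ri_ge0 hE); exact: rearrangement_nneg.
  apply: lec_trans (ltW D0) _ c2.
  rewrite -(M_scale hE (ltW D0) kf0); apply: (M_mono hE (vPhi_ge0 theta f)) => n.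
  by rewrite muleCA; apply: (lee_wpmul2l (v_ge0 _ _)); exact: hD.
Qed.

(** The frame of all three cases. The bound of the interpolation norm by [N] holds inside the larger
    space: the last premise puts elements of [X] there, and elements of [interp] are there by
    definition. *)
Lemma interp_space_eq theta (X : @funspace R T) :
  (forall f, carrier X f <-> measurable_fun setT f /\ fnorm X f < +oo) ->
  (forall f, 0 <= fnorm X f) ->
  (exists2 C : R, (0 < C)%R & forall f, fnorm X f <= C%:E * N theta f) ->
  (exists2 C : R, (0 < C)%R & forall f, N theta f <= C%:E * fnorm X f) ->
  (forall f, fnorm X f < +oo -> Sf a0 p0 (fstar mu f) < +oo) ->
  space_eq (interp Y0 Y1 theta b E) X.
Proof.
move=> cX X0 [C C0 hC] [D D0 hD] hS.
have [F F0 hF] := interp_Ntheta theta; have [A A0 hA] := smallL_Sf mu alpha p0_gt0.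
have up f : fnorm X f <= (C * F)%:E * interp_norm Y0 Y1 theta b E f.
  exact: lec_trans (ltW C0) (hC f) (hF f).2.
have down f : measurable_fun setT f -> Sf a0 p0 (fstar mu f) < +oo ->
    interp_norm Y0 Y1 theta b E f <= (F * D)%:E * fnorm X f.
  by move=> mf Sfin; exact: lec_trans (ltW F0) ((hF f).1 mf Sfin) (hD f).
have CF : (0 < C * F)%R by rewrite mulr_gt0.
have FD : (0 < F * D)%R by rewrite mulr_gt0.
have carr f : carrier (interp Y0 Y1 theta b E) f -> measurable_fun setT f /\ Sf a0 p0 (fstar mu f) < +oo.
  move=> [[mf fin] _]; split => //.
  exact: le_lt_trans (hA f).2 (lec_lty A0 fin).
split.
  apply/seteqP; split => f hf.
    apply/cX; have [mf _] := carr f hf; split => //.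
    by case: hf => _ fin; exact: le_lt_trans (up f) (lec_lty CF fin).
  have [mf Xfin] := (cX f).1 hf; have Sfin := hS f Xfin; split.
    by split => //; exact: le_lt_trans (hA f).1 (lec_lty A0 Sfin).
  exact: le_lt_trans (down f mf Sfin) (lec_lty FD Xfin).
exists (C * F)^-1%R, (F * D)%R; split; [by rewrite invr_gt0|by []|].
move=> f hf; have [mf Sfin] := carr f hf; split; last exact: down.
have CFi : 0 <= ((C * F)^-1)%:E :> \bar R by rewrite lee_fin invr_ge0 ltW.
apply: le_trans (lee_wpmul2l CFi (up f)) _.
by rewrite muleA -EFinM mulVf ?gt_eqF// mul1e.
Qed.

Let brho_ge0 u : (0 < u)%R -> (0 <= brho u)%R.
Proof.
by move=> u0; rewrite ltW// sv_ext_gt0// mulr_gt0 ?powR_gt0// ltr_pwDl.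
Qed.

Let brho_B : exists2 C : R, (0 < C)%R & forall k u, cell k u ->
  (brho u <= C * B k)%R /\ (B k <= C * brho u)%R.
Proof. exact: brho_Bn. Qed.

Lemma interp_theta (theta p : R) : (0 < theta < 1)%R ->
  (p^-1 = (1 - theta) / p0 + theta / p1)%R ->
  space_eq (interp Y0 Y1 theta b E)
    (Lpb mu p (fun u => ell (alpha * (1 - theta) / conjexp p0 + beta * theta / conjexp p1) u * brho u)%R E).
Proof.
move=> /andP[th0 th1] pE; set s := (_ + _)%R.
have p_gt0 : (0 < p)%R.
  rewrite -invr_gt0 pE addr_gt0// divr_gt0// subr_gt0//.
have sE : (s = a0 - theta * (a0 - a1))%R by rewrite /s /a0 /a1; ring.
have pE' : (p^-1 = p0^-1 - theta * dl)%R by rewrite pE /dl /gap; ring.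
pose W := Ww b p0 p1 a0 a1 theta.
(* The factor [r^(-theta)] moves both exponents along the segment from the first space to the
   second, so [W] is exactly the [Lpb] weight at [e^-n], with [B] for the slowly varying part. *)
have WE n : W n = (ew p^-1 n * (wt s n * B n))%R.
  rewrite /W /Ww /vw (rn_powR _ _ (- theta)) sE pE' ewD wtD !mulNr.
  by rewrite -/dl -/B; ring.
have W0 n : 0 <= (W n)%:E by rewrite lee_fin ltW// Ww_gt0.
have Wh0 f n : 0 <= (W n)%:E * fstar mu f n by exact: mule_ge0.
have [A A0 hA] := @ell_wt R s; have [C C0 hC] := brho_B.
have hwB : regvar 0%R (fun n => wt s n * B n)%R.
  by have := regvar_mul (regvar_wt s) (regvar_Bn hb (a0 - a1) dl0); rewrite addr0.
have [D D0 hD] := regvar_near 1 hwB.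
have B0 n : (0 < B n)%R by exact: Bn_gt0.
set X := Lpb _ _ _ _.
have g0 f t : (0 < t)%R -> 0 <= (t `^ p^-1 * (ell s t * brho t))%:E * rearrangement mu (EFin \o f) t.
  move=> t0; rewrite mule_ge0 ?rearrangement_ge0// lee_fin.
  by rewrite mulr_ge0 ?powR_ge0// mulr_ge0 ?powR_ge0 ?brho_ge0.
have X0 f : 0 <= fnorm X f by apply: (ri_ge0 hE); exact: rearrangement_nneg.
have AC : (0 < A * C)%R by rewrite mulr_gt0.
have upX f : fnorm X f <= (A * C)%:E * E (step (fun n => (W n)%:E * fstar mu f n)).
  apply: tnorm_le_step => // k t kt; have t0 := cell_gt0 kt; split; first exact: g0.
  rewrite muleA -EFinM; apply: lee_pmul; rewrite ?rearrangement_ge0 ?rearr_le_fstar//.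
    by rewrite lee_fin mulr_ge0 ?powR_ge0// mulr_ge0 ?powR_ge0 ?brho_ge0.
  rewrite lee_fin WE [leRHS]mulrCA ler_pM ?powR_ge0 ?mulr_ge0 ?powR_ge0 ?brho_ge0//.
    exact: cell_powR_le.
  rewrite [leRHS]mulrACA ler_pM ?powR_ge0 ?brho_ge0//.
    by have [] := hA _ _ kt.
  by have [] := hC _ _ kt.
(* Lower bounds hold on [cell k.+1]: [e^(2/p)] and [D] carry the power and the slowly varying weight
   back to [k], while [A] and [C] compare [ell] and [brho] with their samples. *)
pose G := (expR (2 / p) * (D * (A * C)))%R.
have G0 : (0 < G)%R by rewrite !mulr_gt0// expR_gt0.
have downX f : E (step (fun n => (W n)%:E * fstar mu f n)) <= G%:E * fnorm X f.
  apply: (@step_le_tnorm _ _ _ 1) => // k t kt; have t0 := cell_gt0 kt; split; first exact: g0.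
  rewrite add1n in kt.
  rewrite muleA -EFinM; apply: lee_pmul; rewrite ?fstar_le_rearr//.
  rewrite lee_fin WE (_ : G * _ = (expR (2 / p) * t `^ p^-1) * (D * (A * ell s t * (C * brho t))))%R; last first.
    by rewrite /G; ring.
  rewrite ler_pM ?mulr_ge0 ?(ltW (ew_gt0 _ _)) ?(ltW (wt_gt0 _ _)) ?(ltW (B0 _))//.
    rewrite -ler_pdivrMl ?expR_gt0// -expRN; apply: le_trans (cell_powR_ge p_gt0 kt).
    by rewrite /ew -expRD ler_expR -!natr1; lra.
  apply: le_trans (hD k k.+1 (leq_trans (leqnSn k) (leq_addr 1 k.+1)) _) _; first by rewrite addn1.
  rewrite ler_pM2l// ler_pM ?(ltW (wt_gt0 _ _)) ?(ltW (B0 _))//.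
    by have [] := hA _ _ kt.
  by have [] := hC _ _ kt.
have [K1 K10 hK1] := vQ_le_Wh a0 a1 hb hE hp0 hp01 th0.
have [K2 K20 hK2] := vP_le_vQ a0 a1 hb hE hp0 hp01 th0.
have [K3 K30 hK3] := vR_le_Wh a0 hb hE hp0 hp01 ha1 th1.
apply: interp_space_eq => //.
- exists (A * C)%R => // f; apply: le_trans (upX f) _.
  rewrite lee_wpmul2l ?lee_fin ?(ltW AC)//.
  apply: le_trans (Wh_le_vQ_norm _ _ _ _ hb hE hp0 (fs0 f)) _ => //.
  exact: vQ_le_Ntheta.
- exists ((K2 * K1 + K1 + K3) * G)%R; first by rewrite mulr_gt0// !addr_gt0// mulr_gt0.
  move=> f; have K0 : (0 <= K2 * K1 + K1 + K3)%R by rewrite !addr_ge0 ?mulr_ge0 ?ltW.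
  apply: lec_trans K0 _ (downX f).
  apply: le_trans (Ntheta_le _ _ _ _ _ hb hE _) _.
  apply: lec_add; [by rewrite addr_ge0 ?mulr_ge0 ?ltW|exact: ltW| |exact: hK3].
  apply: lec_add; [by rewrite mulr_ge0 ?ltW|exact: ltW| |exact: hK1].
  exact: lec_trans (ltW K20) (hK2 _ (fs0 f)) (hK1 _ (fs0 f)).
- move=> f Xfin; apply: (Sf_fin_of_Wh hb hE hp0 hp01 th0 (fs0 f)).
  exact: le_lt_trans (downX f) (lec_lty G0 Xfin).
Qed.

Let vwE0 n : vw b p0 p1 a0 a1 0 n = B n.
Proof. by rewrite /vw oppr0 powRr0 mul1r. Qed.

Lemma interp_zero : space_eq (interp Y0 Y1 0%R b E)
  (space_cap (LL mu p0 (fun u => ell a0 u * brho u)%R E (fun=> 1%R) (Lq p0))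
     (LLL mu p0 brho E (ell (a0 - 1)) (Lq 1) (fun=> 1%R) (Lq p0))).
Proof.
have B0 n : (0 < B n)%R by exact: Bn_gt0.
have v0 n : 0 <= (B n)%:E :> \bar R by rewrite lee_fin ltW.
set X1 := LL _ _ _ _ _ _; set X2 := LLL _ _ _ _ _ _ _ _.
have X1E f : fnorm X1 f = tnorm E `]0%R, 1%R[ (fun t => (ell a0 t * brho t)%:E *
    tnorm (Lq p0) `]0%R, t[ (pf mu p0 f)).
  exact: LL_fnormE.
have X2E f : fnorm X2 f = tnorm E `]0%R, 1%R[ (fun u => (brho u)%:E *
    tnorm (Lq 1) `]0%R, u[ (midf mu a0 p0 f (fun t => `]0%R, t[))).
  exact: LLL_fnormE.
have X10 f : 0 <= fnorm X1 f by apply: (ri_ge0 hE); exact: rearrangement_nneg.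
have [A A0 hA] := @ell_wt R a0; have [C C0 hC] := brho_B.
have AC : (0 < A * C)%R by rewrite mulr_gt0.
have vQ0 f n : 0 <= (B n)%:E * Qf a0 p0 (fstar mu f) n by exact: mule_ge0 (v0 n) (Qf_ge0 _ _ _ _).
have vP0 f n : 0 <= (B n)%:E * Pf a0 p0 (fstar mu f) n by exact: mule_ge0 (v0 n) (Pf_ge0 _ _ _ _).
have vP10 f n : 0 <= (B n)%:E * Pf a0 p0 (fstar mu f) n.+1 by exact: mule_ge0 (v0 n) (Pf_ge0 _ _ _ _).
pose MQ f := E (step (fun n => (B n)%:E * Qf a0 p0 (fstar mu f) n)).
pose MP f := E (step (fun n => (B n)%:E * Pf a0 p0 (fstar mu f) n)).
have up1 f : fnorm X1 f <= (A * C)%:E * MQ f.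
  rewrite X1E; apply: tnorm_le_step => // k t kt; have t0 := cell_gt0 kt; split.
    by rewrite mule_ge0 ?tnorm_Lq_ge0// lee_fin mulr_ge0 ?powR_ge0 ?brho_ge0.
  rewrite /Qf !muleA -!EFinM; apply: lee_pmul; rewrite ?tnorm_Lq_ge0 ?inner_Gf_le//.
    by rewrite lee_fin mulr_ge0 ?powR_ge0 ?brho_ge0.
  rewrite lee_fin (_ : A * C * _ * _ = (A * wt a0 k) * (C * B k))%R; last by ring.
  by rewrite ler_pM ?powR_ge0 ?brho_ge0//; [have [] := hA _ _ kt|have [] := hC _ _ kt].
pose G := (A * C * expR (2 / p0))%R; have G0 : (0 < G)%R by rewrite mulr_gt0// expR_gt0.
have down1 f : MQ f <= G%:E * fnorm X1 f.
  rewrite X1E; apply: (@step_le_tnorm _ _ _ 0) => // k t; rewrite add0n => kt; have t0 := cell_gt0 kt; split.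
    by rewrite mule_ge0 ?tnorm_Lq_ge0// lee_fin mulr_ge0 ?powR_ge0 ?brho_ge0.
  rewrite /Qf muleA -EFinM.
  apply: (@le_trans _ _ ((A * ell a0 t * (C * brho t))%:E * ((expR (2 / p0))%:E * tnorm (Lq p0) `]0%R, t[ (pf mu p0 f)))).
    apply: lee_pmul; rewrite ?Gf_ge0 ?inner_Gf_ge//.
      by rewrite lee_fin mulr_ge0 ?(ltW (B0 _))// ltW// wt_gt0.
    rewrite lee_fin mulrC ler_pM ?(ltW (wt_gt0 _ _)) ?(ltW (B0 _))//.
      by have [] := hA _ _ kt.
    by have [] := hC _ _ kt.
  rewrite !muleA -!EFinM lee_wpmul2r ?tnorm_Lq_ge0// lee_fin /G.
  by rewrite le_eqVlt; apply/orP; left; apply/eqP; ring.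
have [H H0 hH] := mid_Pf_le mu a0 p0_gt0; have [I I0 hI] := mid_Pf_ge mu a0 p0_gt0.
have CH : (0 < C * H)%R by rewrite mulr_gt0.
have CI : (0 < C * I)%R by rewrite mulr_gt0.
have up2 f : fnorm X2 f <= (C * H)%:E * MP f.
  rewrite X2E; apply: tnorm_le_step => // k t kt; have t0 := cell_gt0 kt; split.
    by rewrite mule_ge0 ?tnorm_Lq_ge0// lee_fin brho_ge0.
  apply: (@le_trans _ _ ((C * B k)%:E * (H%:E * Pf a0 p0 (fstar mu f) k))).
    apply: lee_pmul; rewrite ?tnorm_Lq_ge0 ?lee_fin ?brho_ge0//; last exact: hH.
    by have [] := hC _ _ kt.
  rewrite !muleA -!EFinM lee_wpmul2r ?Pf_ge0// lee_fin.
  by rewrite le_eqVlt; apply/orP; left; apply/eqP; ring.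
have down2 f : E (step (fun n => (B n)%:E * Pf a0 p0 (fstar mu f) n.+1)) <= (C * I)%:E * fnorm X2 f.
  rewrite X2E; apply: (@step_le_tnorm _ _ _ 0) => // k t; rewrite add0n => kt; have t0 := cell_gt0 kt; split.
    by rewrite mule_ge0 ?tnorm_Lq_ge0// lee_fin brho_ge0.
  rewrite (_ : (C * I)%:E * _ = (C * brho t)%:E * (I%:E * tnorm (Lq 1) `]0%R, t[ (midf mu a0 p0 f (fun t => `]0%R, t[)))); last first.
    by rewrite !muleA -!EFinM; congr (_%:E * _); ring.
  apply: lee_pmul; rewrite ?Pf_ge0 ?lee_fin ?(ltW (B0 _))//; first by have [] := hC _ _ kt.
  apply: hI => j s js kj; rewrite in_itv/= (cell_gt0 js)/=.
  exact: cell_lt js kt kj.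
(* Both norms of the intersection enter: [LLL] controls [P] from the next index on, and the term
   restored by [Pf_step] is controlled by [LL]. *)
have MPle f : MP f <= (C * I)%:E * fnorm X2 f + G%:E * fnorm X1 f.
  apply: le_trans (leeD (down2 f) (down1 f)).
  apply: le_trans (M_add hE (vP10 f) (vQ0 f)); apply: (M_mono hE (vP0 f)) => n.
  rewrite -ge0_muleDr ?Pf_ge0 ?Qf_ge0//; apply: lee_wpmul2l => //.
  exact: Pf_step.
have MQE f : MQ f = E (step (fun n => (vw b p0 p1 a0 a1 0 n)%:E * Qf a0 p0 (fstar mu f) n)).
  by congr (E (step _)); apply/funext => n; rewrite vwE0.
have MPE f : MP f = E (step (fun n => (vw b p0 p1 a0 a1 0 n)%:E * Pf a0 p0 (fstar mu f) n)).
  by congr (E (step _)); apply/funext => n; rewrite vwE0.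
have [K3 K30 hK3] := vR_le_Wh a0 hb hE hp0 hp01 ha1 (@ltr01 R).
have XX f : fnorm X1 f <= fnorm (space_cap X1 X2) f by exact: fnorm_capl.
have XX2 f : fnorm X2 f <= fnorm (space_cap X1 X2) f by exact: fnorm_capr.
have eG : 0 <= G%:E :> \bar R by rewrite lee_fin ltW.
have eCI : 0 <= (C * I)%:E :> \bar R by rewrite lee_fin ltW.
have eAC : 0 <= (A * C)%:E :> \bar R by rewrite lee_fin ltW.
have eCH : 0 <= (C * H)%:E :> \bar R by rewrite lee_fin ltW.
have MQX f : MQ f <= G%:E * fnorm (space_cap X1 X2) f.
  exact: le_trans (down1 f) (lee_wpmul2l eG (XX f)).
have MPX f : MP f <= (C * I + G)%:E * fnorm (space_cap X1 X2) f.
  apply: le_trans (MPle f) _.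
  exact: lec_add (ltW CI) (ltW G0) (lee_wpmul2l eCI (XX2 f)) (lee_wpmul2l eG (XX f)).
have CIG : (0 < C * I + G)%R by rewrite addr_gt0.
apply: interp_space_eq.
- by move=> f; exact: carrier_cap.
- move=> f; exact: le_trans (X10 f) (XX f).
- exists (A * C + C * H)%R; first by rewrite addr_gt0.
  move=> f; have N0 : 0 <= N 0 f by apply: (M_ge0 hE) => n; exact: vPhi_ge0.
  rewrite fnorm_cap_le; apply/andP; split.
    have w : (A * C <= A * C + C * H)%R by rewrite lerDl ltW.
    have u := vQ_le_Ntheta p0 p1 a0 a1 0 hb hE (fstar mu f); rewrite -MQE in u.
    exact: lec_weak N0 w (le_trans (up1 f) (lee_wpmul2l eAC u)).
  have w : (C * H <= A * C + C * H)%R by rewrite lerDr ltW.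
  have u := vP_le_Ntheta p0 p1 a0 a1 0 hb hE (fstar mu f); rewrite -MPE in u.
  exact: lec_weak N0 w (le_trans (up2 f) (lee_wpmul2l eCH u)).
- exists ((C * I + G) + G + K3 * G)%R; first by rewrite !addr_gt0// mulr_gt0.
  move=> f; apply: le_trans (Ntheta_le _ _ _ _ _ hb hE _) _.
  have K3G : (0 <= K3 * G)%R by rewrite mulr_ge0 ?ltW.
  have CIGG : (0 <= C * I + G + G)%R by rewrite addr_ge0 ?(ltW CIG) ?(ltW G0).
  rewrite -MPE -MQE.
  apply: lec_add CIGG K3G (lec_add (ltW CIG) (ltW G0) (MPX f) (MQX f)) _.
  have u := Wh_le_vQ_norm p1 a0 a1 0 hb hE hp0 (fs0 f); rewrite -MQE in u.
  exact: lec_trans (ltW K30) (hK3 _ (fs0 f)) (le_trans u (MQX f)).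
(* Here [W] need not produce summable tails; instead [P] at index 0 is [Sf] itself, and [M_fin]
   bounds [B 0] times it. *)
- move=> f Xfin.
  have MPfin : MP f < +oo by exact: le_lt_trans (MPX f) (lec_lty CIG Xfin).
  have [Z Z0 hZ] := M_fin hE (vP0 f) MPfin.
  have SP : Sf a0 p0 (fstar mu f) = Pf a0 p0 (fstar mu f) 0 by [].
  have h := hZ 0%N; rewrite SP ltey; apply/negP => /eqP e; move: h.
  by rewrite e gt0_muley ?lte_fin// leye_eq.
Qed.

Let vrE1 n : (vw b p0 p1 a0 a1 1 n * r n = B n)%R.
Proof.
rewrite /vw powR_inv1 ?(ltW (rw_gt0 _ _ _ _ _))// mulrAC mulVf ?mul1r//.
by rewrite gt_eqF// rw_gt0.
Qed.

Lemma interp_one : space_eq (interp Y0 Y1 1%R b E)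
  (LLR mu p1 brho E (ell (a1 - 1)) (Lq 1) (fun=> 1%R) (Lq p1)).
Proof.
have B0 n : (0 < B n)%R by exact: Bn_gt0.
have v0 n : 0 <= (B n)%:E :> \bar R by rewrite lee_fin ltW.
set X := LLR _ _ _ _ _ _ _ _.
have XE f : fnorm X f = tnorm E `]0%R, 1%R[ (fun u => (brho u)%:E *
    tnorm (Lq 1) `]u, 1%R[ (midf mu a1 p1 f (fun t => `]u, t[))).
  exact: LLR_fnormE.
have X0 f : 0 <= fnorm X f by apply: (ri_ge0 hE); exact: rearrangement_nneg.
have [C C0 hC] := brho_B.
have [H H0 hH] := mid_Rf_le mu a1 p1_gt0; have [I I0 hI] := mid_Rf_ge mu a1 p1_gt0.
have [D D0 hD] := regvar_near 2 (regvar_Bn hb (a0 - a1) dl0).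
have vR0 f n : 0 <= (B n)%:E * Rf a1 p1 (fstar mu f) n by exact: mule_ge0 (v0 n) (Rf_ge0 _ _ _ _).
pose MR f := E (step (fun n => (B n)%:E * Rf a1 p1 (fstar mu f) n)).
have CH : (0 < C * H)%R by rewrite mulr_gt0.
have DCI : (0 < D * C * I)%R by rewrite !mulr_gt0.
have up f : fnorm X f <= (C * H)%:E * MR f.
  rewrite XE; apply: tnorm_le_step => // k t kt; have t0 := cell_gt0 kt; split.
    by rewrite mule_ge0 ?tnorm_Lq_ge0// lee_fin brho_ge0.
  apply: (@le_trans _ _ ((C * B k)%:E * (H%:E * Rf a1 p1 (fstar mu f) k))).
    apply: lee_pmul; rewrite ?tnorm_Lq_ge0 ?lee_fin ?brho_ge0//; last exact: hH.
    by have [] := hC _ _ kt.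
  rewrite !muleA -!EFinM lee_wpmul2r ?Rf_ge0// lee_fin.
  by rewrite le_eqVlt; apply/orP; left; apply/eqP; ring.
have down f : MR f <= (D * C * I)%:E * fnorm X f.
  (* [mid_Rf_ge] needs the outer variable in [cell k.+2], hence the offset 2; [D] compares [B k]
     with [B] two indices later. *)
  rewrite XE; apply: (@step_le_tnorm _ _ _ 2) => // k t kt; have t0 := cell_gt0 kt; split.
    by rewrite mule_ge0 ?tnorm_Lq_ge0// lee_fin brho_ge0.
  rewrite (_ : (D * C * I)%:E * _ = (D * (C * brho t))%:E * (I%:E * tnorm (Lq 1) `]t, 1%R[ (midf mu a1 p1 f (fun s => `]t, s[)))); last first.
    by rewrite !muleA -!EFinM; congr (_%:E * _); ring.
  apply: lee_pmul; rewrite ?Rf_ge0 ?lee_fin ?(ltW (B0 _))//; last exact: hI.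
  apply: le_trans (hD k (2 + k)%N (leq_trans (leq_addl 2 k) (leq_addr 2 (2 + k))) _) _.
    by rewrite addnC.
  by rewrite ler_pM2l//; have [] := hC _ _ kt.
have MRE f : MR f = E (step (fun n => (vw b p0 p1 a0 a1 1 n * r n)%:E * Rf a1 p1 (fstar mu f) n)).
  by congr (E (step _)); apply/funext => n; rewrite vrE1.
have [K1 K10 hK1] := vQ_le_Wh a0 a1 hb hE hp0 hp01 (@ltr01 R).
have [K2 K20 hK2] := vP_le_vQ a0 a1 hb hE hp0 hp01 (@ltr01 R).
have [K3 K30 hK3] := Wh_le_vR_norm a0 1 hb hE hp0 hp01 ha1.
have WX f : E (step (fun n => (Ww b p0 p1 a0 a1 1 n)%:E * fstar mu f n)) <= (K3 * (D * C * I))%:E * fnorm X f.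
  by apply: lec_trans (ltW K30) (hK3 _ (fs0 f)) _; rewrite -MRE.
have K3D : (0 < K3 * (D * C * I))%R by rewrite mulr_gt0.
apply: interp_space_eq => //.
- exists (C * H)%R => // f; apply: le_trans (up f) _.
  rewrite lee_wpmul2l ?lee_fin ?(ltW CH)// MRE.
  exact: vR_le_Ntheta.
- pose K := (K1 * (K3 * (D * C * I)))%R; have K0 : (0 < K)%R by rewrite mulr_gt0.
  exists (K2 * K + K + D * C * I)%R; first by rewrite !addr_gt0// mulr_gt0.
  move=> f; apply: le_trans (Ntheta_le _ _ _ _ _ hb hE _) _.
  have K2K : (0 <= K2 * K)%R by rewrite mulr_ge0 ?ltW.
  have hQ : E (step (fun n => (vw b p0 p1 a0 a1 1 n)%:E * Qf a0 p0 (fstar mu f) n)) <= K%:E * fnorm X f.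
    exact: lec_trans (ltW K10) (hK1 _ (fs0 f)) (WX f).
  apply: lec_add => //; [by rewrite addr_ge0 ?(ltW K0)|exact: ltW| |by rewrite -MRE].
  apply: lec_add => //; first exact: ltW.
  exact: lec_trans (ltW K20) (hK2 _ (fs0 f)) hQ.
- move=> f Xfin; apply: (Sf_fin_of_Wh hb hE hp0 hp01 (@ltr01 R) (fs0 f)).
  exact: le_lt_trans (WX f) (lec_lty K3D Xfin).
Qed.

End Interpolation.

Theorem corollary5p7 (R : realType) (d : measure_display) (T : measurableType d)
    (mu : probability T R) (E : (R -> \bar R) -> \bar R) (b : R -> R)
    (p0 p1 alpha beta : R)
    (hE : is_ri_norm E) (hb : slowly_varying b)
    (hp0 : 1 < p0) (hp01 : p0 < p1) (halpha : 0 < alpha) (hbeta : 0 < beta) :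
  let rho := fun u : R =>
    u `^ (p0^-1 - p1^-1) * ell (alpha / conjexp p0 - beta / conjexp p1) u in
  let brho := fun u : R => sv_ext b (rho u) in
  [/\ forall theta p : R, 0 < theta < 1 ->
        p^-1 = (1 - theta) / p0 + theta / p1 ->
        let Btheta := fun u : R =>
          ell (alpha * (1 - theta) / conjexp p0 + beta * theta / conjexp p1) u
            * brho u in
        space_eq (interp (smallL mu p0 alpha) (smallL mu p1 beta) theta b E)
                 (Lpb mu p Btheta E),
      let B0 := fun u : R => ell (alpha / conjexp p0) u * brho u in
      space_eq (interp (smallL mu p0 alpha) (smallL mu p1 beta) 0 b E)
        (space_cap
           (LL mu p0 B0 E (fun=> 1) (Lq p0))
           (LLL mu p0 brho E (ell (alpha / conjexp p0 - 1)) (Lq 1)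
              (fun=> 1) (Lq p0)))
    & (tnorm E `]0%R, 1%R[ (EFin \o b) < +oo)%E ->
      space_eq (interp (smallL mu p0 alpha) (smallL mu p1 beta) 1 b E)
        (LLR mu p1 brho E (ell (beta / conjexp p1 - 1)) (Lq 1)
           (fun=> 1) (Lq p1))].
Proof.
move=> rho brho; split.
- move=> theta p th pE; exact: interp_theta.
- exact: interp_zero.
- move=> _; exact: interp_one.
Qed.
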